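(* Let $d=2$ and let $\alpha:\mathbb R^2\to U(m)$ be a family of matching matrices (with $\varepsilon=\mathbf 1$ or $\varepsilon=J$). Then there exists a sequence $(\widehat\alpha_n)_{n\in\mathbb N}$ of continuous, $\mathbb Z^2$-periodic maps $\widehat\alpha_n:\mathbb R^2\to U(m)$ such that $\sup_{\mathbf k\in\mathbb R^2}\|\widehat\alpha_n(\mathbf k)-\alpha(\mathbf k)\|\to 0$ as $n\to\infty$, and for every $n$ and every $\mathbf k\in\mathbb R^2$ the matrix $\widehat\alpha_n(\mathbf k)$ has completely non-degenerate spectrum, with $\sigma(\widehat\alpha_n(\mathbf k))=\sigma(\widehat\alpha_n(-\mathbf k))$.
   Context: $\varepsilon$ is either the $m\times m$ identity $\mathbf 1$ or, for $m$ even, $J=\begin{pmatrix}0&\mathbf 1\\-\mathbf 1&0\end{pmatrix}$. A family of matching matrices is a continuous, $\mathbb Z^2$-periodic map $\alpha:\mathbb R^2\to U(m)$ with $\varepsilon\alpha(\mathbf k)=\alpha(-\mathbf k)^t\varepsilon$ for all $\mathbf k$. No homotopy assumption on $\alpha$ is made, and the approximants are not required to satisfy the time-reversal relation. *)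

(* Defs.v *)
From Stdlib Require Import Reals.
Open Scope R_scope.

Record Cx : Type := mkCx { re : R ; im : R }.

Definition C0 : Cx := mkCx 0 0.
Definition C1 : Cx := mkCx 1 0.
Definition cadd (a b : Cx) : Cx := mkCx (re a + re b) (im a + im b).
Definition copp (a : Cx) : Cx := mkCx (- re a) (- im a).
Definition csub (a b : Cx) : Cx := cadd a (copp b).
Definition cmul (a b : Cx) : Cx :=
  mkCx (re a * re b - im a * im b) (re a * im b + im a * re b).
Definition cconj (a : Cx) : Cx := mkCx (re a) (- im a).
Definition cnorm2 (a : Cx) : R := re a * re a + im a * im a.
Definition cmod (a : Cx) : R := sqrt (cnorm2 a).

Fixpoint csum (n : nat) (f : nat -> Cx) : Cx :=
  match n with
  | O => C0
  | S n' => cadd (csum n' f) (f n')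
  end.
Fixpoint rsum (n : nat) (f : nat -> R) : R :=
  match n with
  | O => 0
  | S n' => rsum n' f + f n'
  end.

(* ---------- m x m matrices: entries (i,j) with i,j < m are meaningful ---- *)
Definition Mat := nat -> nat -> Cx.
Definition Vec := nat -> Cx.

Definition mmul (m : nat) (A B : Mat) : Mat :=
  fun i j => csum m (fun k => cmul (A i k) (B k j)).
Definition msub (A B : Mat) : Mat := fun i j => csub (A i j) (B i j).
Definition mtr (A : Mat) : Mat := fun i j => A j i.
Definition madj (A : Mat) : Mat := fun i j => cconj (A j i).
Definition mid : Mat := fun i j => if Nat.eqb i j then C1 else C0.
Definition mv (m : nat) (A : Mat) (v : Vec) : Vec :=
  fun i => csum m (fun k => cmul (A i k) (v k)).
Definition vnorm2 (m : nat) (v : Vec) : R := rsum m (fun i => cnorm2 (v i)).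

Definition meq (m : nat) (A B : Mat) : Prop :=
  forall i j, (i < m)%nat -> (j < m)%nat -> A i j = B i j.

Definition unitary (m : nat) (A : Mat) : Prop :=
  meq m (mmul m (madj A) A) mid.

(* The matrix J = [[0, 1], [-1, 0]] in blocks of size p, for m = 2p. *)
Definition Jmat (p : nat) : Mat :=
  fun i j =>
    if Nat.ltb i p then (if Nat.eqb j (i + p) then C1 else C0)
    else (if Nat.eqb i (j + p) then copp C1 else C0).

Inductive eps_choice : Type := EpsOne | EpsJ.

Definition eps_ok (e : eps_choice) (m : nat) : Prop :=
  match e with EpsOne => True | EpsJ => Nat.Even m end.
Definition eps_mat (e : eps_choice) (m : nat) : Mat :=
  match e with EpsOne => mid | EpsJ => Jmat (Nat.div m 2) end.

Definition MatFam := R -> R -> Mat.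

(* continuity (entrywise, equivalently in any matrix norm) *)
Definition fam_continuous (m : nat) (a : MatFam) : Prop :=
  forall k1 k2 eps, 0 < eps -> exists delta, 0 < delta /\
    forall l1 l2, Rabs (l1 - k1) < delta -> Rabs (l2 - k2) < delta ->
      forall i j, (i < m)%nat -> (j < m)%nat ->
        cmod (csub (a l1 l2 i j) (a k1 k2 i j)) < eps.

Definition fam_periodic (m : nat) (a : MatFam) : Prop :=
  forall k1 k2, meq m (a (k1 + 1) k2) (a k1 k2) /\ meq m (a k1 (k2 + 1)) (a k1 k2).

Definition fam_unitary (m : nat) (a : MatFam) : Prop :=
  forall k1 k2, unitary m (a k1 k2).

Definition matching_family (e : eps_choice) (m : nat) (a : MatFam) : Prop :=
  fam_continuous m a /\ fam_periodic m a /\ fam_unitary m a /\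
  forall k1 k2,
    meq m (mmul m (eps_mat e m) (a k1 k2))
          (mmul m (mtr (a (- k1) (- k2))) (eps_mat e m)).

Definition opnorm_le (m : nat) (A : Mat) (c : R) : Prop :=
  forall v : Vec, vnorm2 m (mv m A v) <= c * c * vnorm2 m v.

Definition nonzero_vec (m : nat) (v : Vec) : Prop :=
  exists i, (i < m)%nat /\ v i <> C0.

Definition eigenvalue (m : nat) (A : Mat) (lam : Cx) : Prop :=
  exists v, nonzero_vec m v /\ forall i, (i < m)%nat -> mv m A v i = cmul lam (v i).

Definition nondegenerate_spectrum (m : nat) (A : Mat) : Prop :=
  exists lam : nat -> Cx,
    (forall i j, (i < m)%nat -> (j < m)%nat -> i <> j -> lam i <> lam j) /\
    (forall i, (i < m)%nat -> eigenvalue m A (lam i)).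

Definition same_spectrum (m : nat) (A B : Mat) : Prop :=
  forall lam, eigenvalue m A lam <-> eigenvalue m B lam.

(* Main.v *)
(* The approximants are built in two steps.

   First, a family with simple spectrum and no symmetry. Replace alpha by a
   nearby Lipschitz family beta (inf-convolution of the entries, then the unitary
   polar factor) and multiply it by a constant unitary g close to 1, the Cayley
   transform of a Hermitian matrix H. Unitary matrices with a double eigenvalue
   have codimension 3 and the torus has dimension 2, so the matrices H for which
   some g beta(k) is degenerate depend in a Lipschitz way on m^2 - 1 real
   parameters; a grid of N^(m^2) matrices H therefore contains a good one once N
   is large.

   Second, the spectra at k and -k are made equal. By the relation satisfied by
   alpha, gamma = g beta has the property that gamma(-k) is isospectral to a
   matrix close to gamma(k). Cut the circle at a point mu far from both spectra,
   pair the eigenvalues of gamma(k) and gamma(-k) by their rank counted from mu,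
   and move each eigenvalue of gamma(k), within its eigenspace, to the midpoint of
   its pair. Paired eigenvalues are close (Weyl), midpoints of ordered pairs
   remain distinct, and the pairing does not depend on mu, which makes the
   construction continuous in k. *)

(* With no homotopy assumption the eigenvalues may wind round the circle and return permuted, so
   they cannot be numbered over the whole torus. Hence the cut is chosen afresh at each [k], and the
   real work is to show that the result forgets it.

   Lipschitz rather than continuous dependence is needed for the pigeonhole: [N ^ (m ^ 2)] grid
   matrices are compared with a constant times [N ^ (m ^ 2 - 1)] cells, and a merely continuous
   family would not tie the size of a cell to the grid step.

   Most matrix estimates come from scalar ones: the squared Frobenius distance of two normal
   matrices is the sum of the squared distances of their eigenvalues with doubly stochastic weights.
   This replaces spectral projections, and it yields the polar factor, Weyl's inequality and the
   continuity of the final family alike. *)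
Require Import Defs.
From Stdlib Require Import Reals.
From Coquelicot Require Continuity.
From mathcomp Require all_boot all_order all_algebra.
From mathcomp Require reals boolp classical_sets complex Rstruct.
From mathcomp Require ring lra zify.

(* Inside the module [<=], [<] and [0] are those of MathComp, which would change the
   meaning of the theorem. *)
Module Approximation.

Import all_boot all_order all_algebra.
Import reals boolp classical_sets.
Import mathcomp.algebra_tactics.ring mathcomp.algebra_tactics.lra mathcomp.zify.zify.

Set Implicit Arguments.
Unset Strict Implicit.
Unset Printing Implicit Defensive.

Import Order.TTheory GRing.Theory Num.Theory.
Local Open Scope ring_scope.
Local Open Scope sesquilinear_scope.

(* The complex numbers over [R] are used through this interface because
   unification over the concrete type [R[i]] is prohibitively slow. *)
Record complexModel (R : realType) := ComplexModel {
  cfield :> numClosedFieldType;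
  re : cfield -> R;
  im : cfield -> R;
  mkC : R -> R -> cfield;
  re_mk : forall x y, re (mkC x y) = x;
  im_mk : forall x y, im (mkC x y) = y;
  mkC_eta : forall z, mkC (re z) (im z) = z;
  reD : forall z w, re (z + w) = re z + re w;
  imD : forall z w, im (z + w) = im z + im w;
  reM : forall z w, re (z * w) = re z * re w - im z * im w;
  imM : forall z w, im (z * w) = re z * im w + im z * re w;
  re_conj : forall z, re (z^*) = re z;
  im_conj : forall z, im (z^*) = - im z }.

(** * Real and imaginary parts, and a real-valued modulus *)

Section ComplexModel.
Variables (R : realType) (C : complexModel R).
Implicit Types (z w : C) (x y : R).

Lemma complex_ext z w : re z = re w -> im z = im w -> z = w.
Proof. by move=> e1 e2; rewrite -[z]mkC_eta -[w]mkC_eta e1 e2. Qed.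

Lemma re0 : re (0 : C) = 0.
Proof. by apply: (addrI (re (0 : C))); rewrite -reD !addr0. Qed.

Lemma im0 : im (0 : C) = 0.
Proof. by apply: (addrI (im (0 : C))); rewrite -imD !addr0. Qed.

Lemma reN z : re (- z) = - re z.
Proof. by apply/eqP; rewrite -subr_eq0 opprK -reD addNr re0. Qed.

Lemma imN z : im (- z) = - im z.
Proof. by apply/eqP; rewrite -subr_eq0 opprK -imD addNr im0. Qed.

Lemma im1 : im (1 : C) = 0.
Proof. by have := im_conj (1 : C); rewrite rmorph1; lra. Qed.

Lemma re1 : re (1 : C) = 1.
Proof.
have h z : re z * re (1 : C) = re z.
  by rewrite -[in RHS](mulr1 z) reM im1 mulr0 subr0.
by rewrite -[LHS]mul1r -[X in X * _](@re_mk R C 1 0) h re_mk.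
Qed.

Definition rc x : C := mkC C x 0.

Lemma re_rc x : re (rc x) = x. Proof. exact: re_mk. Qed.
Lemma im_rc x : im (rc x) = 0. Proof. exact: im_mk. Qed.

Definition reimE := (reD, imD, reN, imN, reM, imM, re_conj, im_conj, re_rc, im_rc,
  re0, im0, re1, im1, re_mk, im_mk).

Lemma rcD x y : rc (x + y) = rc x + rc y.
Proof. by apply: complex_ext; rewrite !reimE ?addr0. Qed.
Lemma rcN x : rc (- x) = - rc x.
Proof. by apply: complex_ext; rewrite !reimE ?oppr0. Qed.
Lemma rcM x y : rc (x * y) = rc x * rc y.
Proof. by apply: complex_ext; rewrite !reimE; ring. Qed.
Lemma rc0 : rc 0 = 0. Proof. by apply: complex_ext; rewrite !reimE. Qed.
Lemma rc1 : rc 1 = 1. Proof. by apply: complex_ext; rewrite !reimE. Qed.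
Lemma rc_inj : injective rc.
Proof. by move=> x y /(congr1 (@re R C)); rewrite !re_rc. Qed.

Lemma rc_sum (I : Type) (r : seq I) (P : pred I) (F : I -> R) :
  rc (\sum_(i <- r | P i) F i) = \sum_(i <- r | P i) rc (F i).
Proof. exact: (big_morph rc rcD rc0). Qed.

Definition cabs z : R := Num.sqrt (re z ^+ 2 + im z ^+ 2).

Lemma cabs_ge0 z : 0 <= cabs z.
Proof. exact: sqrtr_ge0. Qed.

Lemma sqr_cabsE z : cabs z ^+ 2 = re z ^+ 2 + im z ^+ 2.
Proof. by rewrite sqr_sqrtr // addr_ge0 // sqr_ge0. Qed.

Lemma sqr_cabs_conj z : rc (cabs z ^+ 2) = z * z^*.
Proof. by rewrite sqr_cabsE; apply: complex_ext; rewrite !reimE; ring. Qed.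

Lemma cabs_conj z : cabs (z^*) = cabs z.
Proof. by rewrite /cabs re_conj im_conj sqrrN. Qed.

Lemma cabs_eq0 z : (cabs z == 0) = (z == 0).
Proof.
rewrite -(eqrXn2 (isT : 0 < 2)%N) ?cabs_ge0 // sqr_cabsE expr0n /=.
rewrite paddr_eq0 ?sqr_ge0 // !sqrf_eq0; apply/andP/eqP => [[/eqP e1 /eqP e2]|->].
  by apply: complex_ext; rewrite ?e1 ?e2 !reimE.
by rewrite !reimE.
Qed.

Lemma cabs0 : cabs 0 = 0. Proof. by apply/eqP; rewrite cabs_eq0. Qed.

Lemma cabs_gt0 z : (0 < cabs z) = (z != 0).
Proof. by rewrite lt_def cabs_eq0 cabs_ge0 andbT. Qed.

Lemma cabsN z : cabs (- z) = cabs z.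
Proof. by rewrite /cabs reN imN !sqrrN. Qed.

Lemma cabsBC z w : cabs (z - w) = cabs (w - z).
Proof. by rewrite -cabsN opprB. Qed.

Lemma cabsM z w : cabs (z * w) = cabs z * cabs w.
Proof.
rewrite -sqrtrM ?addr_ge0 ?sqr_ge0 //; congr Num.sqrt.
by rewrite reM imM; ring.
Qed.

Lemma cabs1 : cabs 1 = 1.
Proof. by rewrite /cabs re1 im1 expr0n addr0 expr1n sqrtr1. Qed.

Lemma cabsV z : cabs (z^-1) = (cabs z)^-1.
Proof.
have [->|z0] := eqVneq z 0; first by rewrite invr0 cabs0 invr0.
have nz0 : cabs z != 0 by rewrite cabs_eq0.
by apply: (mulfI nz0); rewrite -cabsM !divff // cabs1.
Qed.

Lemma cabsD z w : cabs (z + w) <= cabs z + cabs w.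
Proof.
have hz := cabs_ge0 z; have hw := cabs_ge0 w.
rewrite -ler_sqr ?nnegrE ?cabs_ge0 ?addr_ge0 // sqrrD !sqr_cabsE !reimE.
suff : re z * re w + im z * im w <= cabs z * cabs w by nra.
rewrite -cabs_conj -cabsM; apply: le_trans (_ : `|re (z^* * w)| <= _).
  by rewrite reM re_conj im_conj mulNr opprK ler_norm.
rewrite -ler_sqr ?nnegrE ?cabs_ge0 // real_normK ?num_real // sqr_cabsE.
by rewrite lerDl sqr_ge0.
Qed.

Lemma cabsB z w : cabs (z - w) <= cabs z + cabs w.
Proof. by rewrite (le_trans (cabsD _ _)) // cabsN. Qed.

Lemma cabs_rc x : cabs (rc x) = `|x|.
Proof. by rewrite /cabs re_rc im_rc expr0n addr0 sqrtr_sqr. Qed.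

Lemma normr_re_le z : `|re z| <= cabs z.
Proof.
rewrite -ler_sqr ?nnegrE ?cabs_ge0 // real_normK ?num_real // sqr_cabsE.
by rewrite lerDl sqr_ge0.
Qed.

Lemma normr_im_le z : `|im z| <= cabs z.
Proof.
rewrite -ler_sqr ?nnegrE ?cabs_ge0 // real_normK ?num_real // sqr_cabsE.
by rewrite lerDr sqr_ge0.
Qed.

Lemma cabs_le_reim z : cabs z <= `|re z| + `|im z|.
Proof.
rewrite -ler_sqr ?nnegrE ?cabs_ge0 ?addr_ge0 // sqr_cabsE sqrrD.
rewrite !real_normK ?num_real // addrAC lerDl mulrn_wge0 //.
by rewrite mulr_ge0.
Qed.

Lemma cabs_sum (I : Type) (r : seq I) (P : pred I) (F : I -> C) :
  cabs (\sum_(i <- r | P i) F i) <= \sum_(i <- r | P i) cabs (F i).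
Proof.
elim/big_rec2: _ => [|i x z _ le]; first by rewrite cabs0.
by rewrite (le_trans (cabsD _ _)) // lerD2l.
Qed.

End ComplexModel.

(** * Frobenius norm and unitary diagonalization *)

Section Frobenius.
Variables (R : realType) (C : complexModel R).
Implicit Types z w : C.

(** Cauchy-Schwarz, from the Lagrange identity: the double sum of the squares of
    [a i * b j - a j * b i] is twice the defect. *)
Lemma sqr_sumM_le (I : finType) (a b : I -> R) :
  (\sum_i a i * b i) ^+ 2 <= (\sum_i a i ^+ 2) * (\sum_i b i ^+ 2).
Proof.
have H : 0 <= \sum_i \sum_j (a i * b j - a j * b i) ^+ 2.
  by apply: sumr_ge0 => i _; apply: sumr_ge0 => j _; exact: sqr_ge0.
have E : \sum_i \sum_j (a i * b j - a j * b i) ^+ 2 =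
   2 * ((\sum_i a i ^+ 2) * (\sum_i b i ^+ 2) - (\sum_i a i * b i) ^+ 2).
  rewrite mulrBr expr2 !big_distrlr /=.
  transitivity (\sum_i \sum_j (a i ^+ 2 * b j ^+ 2 + a j ^+ 2 * b i ^+ 2
                 - 2 * ((a i * b i) * (a j * b j)))).
    by apply: eq_bigr => i _; apply: eq_bigr => j _; ring.
  under [LHS]eq_bigr => i _ do rewrite sumrB big_split /=.
  rewrite sumrB big_split /= [X in _ + X - _]exchange_big /= -mulr2n.
  congr (_ - _); first by rewrite mulr_natl.
  rewrite mulr_sumr; apply: eq_bigr => i _.
  by rewrite mulr_sumr.
by move: H; rewrite E pmulr_rge0 ?ltr0n // subr_ge0.
Qed.

(** Kept squared throughout: this form is additive over entries and avoids roots, at the price of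
    the factor 2 in [fro2D]. *)
Definition fro2 m n (A : 'M[C]_(m, n)) : R := \sum_i \sum_j cabs (A i j) ^+ 2.

Lemma fro2_ge0 m n (A : 'M[C]_(m, n)) : 0 <= fro2 A.
Proof. by apply: sumr_ge0 => i _; apply: sumr_ge0 => j _; exact: sqr_ge0. Qed.

Lemma fro2_trace m n (A : 'M[C]_(m, n)) : rc C (fro2 A) = \tr (A *m A^t*).
Proof.
rewrite /fro2 /mxtrace rc_sum; apply: eq_bigr => i _.
rewrite mxE rc_sum; apply: eq_bigr => j _.
by rewrite !mxE -sqr_cabs_conj.
Qed.

Lemma fro2_unitary_l m n (Q : 'M[C]_m) (A : 'M[C]_(m, n)) :
  Q \is unitarymx -> fro2 (Q *m A) = fro2 A.
Proof.
move=> uQ; apply: (@rc_inj R C); rewrite !fro2_trace trmx_mul map_mxM.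
rewrite mulmxA mxtrace_mulC !mulmxA.
by move: uQ; rewrite -trmxC_unitary => /unitarymxP; rewrite trmxCK => ->; rewrite mul1mx.
Qed.

Lemma fro2_adj m n (A : 'M[C]_(m, n)) : fro2 (A^t*) = fro2 A.
Proof. by apply: (@rc_inj R C); rewrite !fro2_trace trmxCK mxtrace_mulC. Qed.

Lemma fro2_tr m n (A : 'M[C]_(m, n)) : fro2 A^T = fro2 A.
Proof.
rewrite /fro2 exchange_big; apply: eq_bigr => i _; apply: eq_bigr => j _.
by rewrite mxE.
Qed.

Lemma fro2_unitary_r m n (Q : 'M[C]_n) (A : 'M[C]_(m, n)) :
  Q \is unitarymx -> fro2 (A *m Q) = fro2 A.
Proof.
by move=> uQ; rewrite -fro2_adj trmx_mul map_mxM fro2_unitary_l ?fro2_adj // trmxC_unitary.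
Qed.

Lemma fro2N m n (A : 'M[C]_(m, n)) : fro2 (- A) = fro2 A.
Proof. by apply: eq_bigr => i _; apply: eq_bigr => j _; rewrite mxE cabsN. Qed.

Lemma sqr_cabsD z w : cabs (z + w) ^+ 2 <= 2 * (cabs z ^+ 2 + cabs w ^+ 2).
Proof.
have := cabsD z w; have := cabs_ge0 (z + w).
set x := cabs _; set y := cabs _; set t := cabs _ => h0 h.
have : x ^+ 2 <= (y + t) ^+ 2 by rewrite ler_sqr ?nnegrE //; lra.
move=> /le_trans; apply; have : 0 <= (y - t) ^+ 2 by exact: sqr_ge0.
by nra.
Qed.

Lemma fro2D m n (A B : 'M[C]_(m, n)) : fro2 (A + B) <= 2 * (fro2 A + fro2 B).
Proof.
rewrite /fro2 -big_split mulr_sumr; apply: ler_sum => i _.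
rewrite -big_split mulr_sumr; apply: ler_sum => j _; rewrite mxE.
exact: sqr_cabsD.
Qed.

Lemma fro2B m n (A B : 'M[C]_(m, n)) : fro2 (A - B) <= 2 * (fro2 A + fro2 B).
Proof. by rewrite -[fro2 B]fro2N; exact: fro2D. Qed.

Lemma fro2M m n p (A : 'M[C]_(m, n)) (B : 'M[C]_(n, p)) :
  fro2 (A *m B) <= fro2 A * fro2 B.
Proof.
rewrite -[fro2 B]fro2_tr /fro2 mulr_suml; apply: ler_sum => i _.
rewrite mulr_sumr; apply: ler_sum => j _; rewrite mxE.
under [X in _ <= _ * X]eq_bigr => k _ do rewrite mxE.
apply: le_trans (sqr_sumM_le _ _); rewrite ler_sqr ?nnegrE ?cabs_ge0 //.
  by apply: le_trans (cabs_sum _ _ _) _; apply: ler_sum => k _; rewrite cabsM.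
by apply: sumr_ge0 => k _; rewrite mulr_ge0 ?cabs_ge0.
Qed.

Lemma entry_le_fro2 m n (A : 'M[C]_(m, n)) i j : cabs (A i j) ^+ 2 <= fro2 A.
Proof.
rewrite /fro2 (bigD1 i) //= (bigD1 j) //= -addrA lerDl addr_ge0 //.
  by apply: sumr_ge0 => k _; exact: sqr_ge0.
by apply: sumr_ge0 => k _; apply: sumr_ge0 => l _; exact: sqr_ge0.
Qed.

Lemma fro2_le_entries m n (A : 'M[C]_(m, n)) (c : R) :
  (forall i j, cabs (A i j) <= c) -> fro2 A <= (m * n)%:R * c ^+ 2.
Proof.
move=> h.
have -> : (m * n)%:R * c ^+ 2 = \sum_(i < m) \sum_(j < n) c ^+ 2.
  by rewrite !sumr_const !card_ord -mulrnA mulr_natl mulnC.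
apply: ler_sum => i _; apply: ler_sum => j _; rewrite ler_sqr ?nnegrE ?cabs_ge0 //.
exact: le_trans (cabs_ge0 _) (h i j).
Qed.

Lemma fro2_0 m n : fro2 (0 : 'M[C]_(m, n)) = 0.
Proof. by rewrite /fro2 big1 // => i _; rewrite big1 // => j _; rewrite mxE cabs0 expr0n. Qed.

Lemma fro2_eq0 m n (A : 'M[C]_(m, n)) : fro2 A <= 0 -> A = 0.
Proof.
move=> h; apply/matrixP => i j; rewrite mxE; apply/eqP; rewrite -cabs_eq0 -sqrf_eq0.
by rewrite eq_le sqr_ge0 andbT (le_trans (entry_le_fro2 A i j)).
Qed.

Lemma unitary_row_sum m (T : 'M[C]_m) : T \is unitarymx ->
  forall i, \sum_j cabs (T i j) ^+ 2 = 1.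
Proof.
move=> /unitarymxP /matrixP uT i; apply: (@rc_inj R C); move/(_ i i): uT.
rewrite !mxE eqxx mulr1n => uT.
rewrite rc_sum rc1 -uT; apply: eq_bigr => j _.
by rewrite !mxE -sqr_cabs_conj.
Qed.

Lemma unitary_col_sum m (T : 'M[C]_m) : T \is unitarymx ->
  forall j, \sum_i cabs (T i j) ^+ 2 = 1.
Proof.
rewrite -trmx_unitary => uT j; rewrite -[RHS](unitary_row_sum uT j).
by apply: eq_bigr => i _; rewrite mxE.
Qed.

Lemma unitary_entry m (T : 'M[C]_m) : T \is unitarymx ->
  forall i j, cabs (T i j) <= 1.
Proof.
move=> uT i j; rewrite -ler_sqr ?nnegrE ?cabs_ge0 // expr1n.
rewrite -(unitary_row_sum uT i) (bigD1 j) //= lerDl.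
by apply: sumr_ge0 => k _; exact: sqr_ge0.
Qed.

Lemma fro2_unitary m (T : 'M[C]_m) : T \is unitarymx -> fro2 T = m%:R.
Proof.
move=> uT; rewrite /fro2; under eq_bigr => i _ do rewrite unitary_row_sum //.
by rewrite sumr_const card_ord.
Qed.

(** The columns of [Q^t*] are the eigenvectors. Keeping [Q] and the eigenvalues apart allows the
    latter to be replaced without touching the eigenvectors. *)
Definition sdec m (Q : 'M[C]_m) (a : 'I_m -> C) : 'M[C]_m :=
  Q^t* *m diag_mx (\row_i a i) *m Q.

Lemma eq_sdec m (Q : 'M[C]_m) (a b : 'I_m -> C) : a =1 b -> sdec Q a = sdec Q b.
Proof. by move=> ab; congr (_ *m diag_mx _ *m _); apply/rowP => i; rewrite !mxE ab. Qed.

Lemma adj_unitaryP m (Q : 'M[C]_m) : Q \is unitarymx -> Q^t* *m Q = 1%:M.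
Proof. by rewrite -trmxC_unitary => /unitarymxP; rewrite trmxCK. Qed.

Lemma sdec_const m (Q : 'M[C]_m) (c : C) : Q \is unitarymx ->
  sdec Q (fun=> c) = c%:M.
Proof.
move=> uQ; rewrite /sdec; have -> : diag_mx (\row__ c) = c%:M :> 'M[C]_m.
  by apply/matrixP => i j; rewrite !mxE.
by rewrite mul_mx_scalar -scalemxAl adj_unitaryP // scalemx1.
Qed.

Lemma sdecD m (Q : 'M[C]_m) (a b : 'I_m -> C) :
  sdec Q (fun i => a i + b i) = sdec Q a + sdec Q b.
Proof.
rewrite /sdec -mulmxDl -mulmxDr -raddfD; congr (_ *m diag_mx _ *m _).
by apply/rowP => i; rewrite !mxE.
Qed.

Lemma sdecZ m (Q : 'M[C]_m) (c : C) (a : 'I_m -> C) :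
  sdec Q (fun i => c * a i) = c *: sdec Q a.
Proof.
rewrite /sdec scalemxAl scalemxAr; congr (_ *m _ *m _).
by apply/matrixP => i j; rewrite !mxE mulrnAr.
Qed.

Lemma sdecM m (Q : 'M[C]_m) (a b : 'I_m -> C) : Q \is unitarymx ->
  sdec Q (fun i => a i * b i) = sdec Q a *m sdec Q b.
Proof.
move=> /unitarymxP uQ; rewrite /sdec -!mulmxA; congr (_ *m _).
rewrite !mulmxA -[_ *m Q *m Q^t*]mulmxA uQ mulmx1; congr (_ *m _).
by rewrite mulmx_diag; congr diag_mx; apply/rowP => i; rewrite !mxE.
Qed.

Lemma sdec_adj m (Q : 'M[C]_m) (a : 'I_m -> C) :
  (sdec Q a)^t* = sdec Q (fun i => (a i)^*).
Proof.
rewrite /sdec !trmx_mul !map_mxM trmxCK mulmxA tr_diag_mx map_diag_mx.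
by congr (_ *m diag_mx _ *m _); apply/rowP => i; rewrite !mxE.
Qed.

Lemma sdec_unitary m (Q : 'M[C]_m) (a : 'I_m -> C) : Q \is unitarymx ->
  (forall i, cabs (a i) = 1) -> sdec Q a \is unitarymx.
Proof.
move=> uQ a1; apply/unitarymxP; rewrite sdec_adj -sdecM //.
rewrite -(sdec_const 1 uQ); apply: eq_sdec => i.
by rewrite -sqr_cabs_conj a1 expr1n rc1.
Qed.

(* In the two eigenbases the difference of two normal matrices has the entries
   [(a i - b j) * T i j], where [T] is the unitary change of basis. *)
Lemma fro2_sdecB m (Q Q' : 'M[C]_m) (a b : 'I_m -> C) :
  Q \is unitarymx -> Q' \is unitarymx ->
  fro2 (sdec Q a - sdec Q' b) =
  \sum_i \sum_j cabs (a i - b j) ^+ 2 * cabs ((Q *m Q'^t*) i j) ^+ 2.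
Proof.
move=> uQ uQ'; have uQ't : Q'^t* \is unitarymx by rewrite trmxC_unitary.
rewrite -(fro2_unitary_l _ uQ) -(fro2_unitary_r _ uQ't) /sdec.
rewrite mulmxBr mulmxBl !mulmxA (unitarymxP uQ) mul1mx.
rewrite -[_ *m Q' *m _]mulmxA (unitarymxP uQ') mulmx1 -[_ *m Q *m _]mulmxA.
move: (Q *m _) => T; apply: eq_bigr => i _; apply: eq_bigr => j _.
rewrite -exprMn -cabsM mul_diag_mx mul_mx_diag; congr (cabs _ ^+ 2).
by rewrite !mxE mulrBl [T i j * _]mulrC.
Qed.

(** Both sides carry the same weights [cabs (T i j) ^+ 2], whose total is [m], so an inequality
    between eigenvalues becomes one between matrices. The new eigenvalues need not be functions of
    the old ones; this is what allows pairing by rank. *)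
Lemma sdec_transfer m (Q Q' : 'M[C]_m) (a b a' b' : 'I_m -> C) (K c : R) :
  Q \is unitarymx -> Q' \is unitarymx ->
  (forall i j, cabs (a' i - b' j) ^+ 2 <= K * cabs (a i - b j) ^+ 2 + c) ->
  fro2 (sdec Q a' - sdec Q' b') <= K * fro2 (sdec Q a - sdec Q' b) + m%:R * c.
Proof.
move=> uQ uQ' h; rewrite !fro2_sdecB //.
have uT : Q *m Q'^t* \is unitarymx by rewrite mul_unitarymx ?trmxC_unitary.
rewrite -(fro2_unitary uT) /fro2 mulr_suml mulr_sumr -big_split /=.
apply: ler_sum => i _; rewrite mulr_suml mulr_sumr -big_split /=.
apply: ler_sum => j _; have := h i j.
set x := cabs _ ^+ 2; set y := cabs (a i - _) ^+ 2; set t := cabs _ ^+ 2.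
have : 0 <= t by exact: sqr_ge0.
move=> t0 le; apply: le_trans (ler_wpM2r t0 le) _.
by rewrite mulrDl -mulrA [c * t]mulrC.
Qed.

(** The weights in column [j] add up to 1, so the squared distances from [b j], averaged with them,
    cannot all exceed the whole double sum. *)
Lemma sdec_near m (Q Q' : 'M[C]_m) (a b : 'I_m -> C) (j : 'I_m) :
  Q \is unitarymx -> Q' \is unitarymx ->
  exists i, cabs (a i - b j) ^+ 2 <= fro2 (sdec Q a - sdec Q' b).
Proof.
move=> uQ uQ'; apply/existsP; apply: contraT; rewrite negb_exists => /forallP h.
have uT : Q *m Q'^t* \is unitarymx by rewrite mul_unitarymx ?trmxC_unitary.
have := fro2_sdecB a b uQ uQ'; set F := fro2 _ in h * => EF.
have hF i : F < cabs (a i - b j) ^+ 2 by rewrite ltNge h.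
have : \sum_i F * cabs ((Q *m Q'^t*) i j) ^+ 2 <
       \sum_i cabs (a i - b j) ^+ 2 * cabs ((Q *m Q'^t*) i j) ^+ 2.
  have [i0 Hi0] : exists i0, 0 < cabs ((Q *m Q'^t*) i0 j) ^+ 2.
    apply/existsP; apply: contraT; rewrite negb_exists => /forallP h0.
    have := unitary_col_sum uT j; rewrite big1 => [/eqP|i _].
      by rewrite eq_sym oner_eq0.
    by apply/eqP; rewrite eq_le sqr_ge0 leNgt h0.
  rewrite (bigD1 i0) //= [X in _ < X](bigD1 i0) //=.
  apply: ltr_leD; first by rewrite ltr_pM2r.
  by apply: ler_sum => i _; rewrite ler_wpM2r ?sqr_ge0 // ltW.
rewrite -mulr_sumr (unitary_col_sum uT) mulr1 => lt.
have : \sum_i cabs (a i - b j) ^+ 2 * cabs ((Q *m Q'^t*) i j) ^+ 2 <= F.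
  rewrite EF; apply: ler_sum => i _; rewrite [X in _ <= X](bigD1 j) //= lerDl.
  by apply: sumr_ge0 => k _; rewrite mulr_ge0 ?sqr_ge0.
by move=> /(lt_le_trans lt); rewrite ltxx.
Qed.

(* Weyl's inequality in Frobenius norm: the block of [T] with rows [i >= j] and
   columns [l <= j] carries weight at least [1], since [T] is doubly stochastic
   and the block has [m + 1] rows and columns in total. *)
Lemma sorted_perturb m (Q Q' : 'M[C]_m) (a b : 'I_m -> C) (x y : 'I_m -> R) (K : R) :
  Q \is unitarymx -> Q' \is unitarymx ->
  {homo x : i j / (i <= j)%N >-> i <= j} -> {homo y : i j / (i <= j)%N >-> i <= j} ->
  (forall i j, (x i - y j) ^+ 2 <= K * cabs (a i - b j) ^+ 2) ->
  forall j, x j - y j <= 0 \/ (x j - y j) ^+ 2 <= K * fro2 (sdec Q a - sdec Q' b).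
Proof.
move=> uQ uQ' mx my hK j.
have [|xy] := leP (x j - y j) 0; first by left.
right; rewrite fro2_sdecB // mulr_sumr.
have uT : Q *m Q'^t* \is unitarymx by rewrite mul_unitarymx ?trmxC_unitary.
set T := Q *m Q'^t* in uT *; pose t p l := cabs (T p l) ^+ 2.
have t0 p l : 0 <= t p l by exact: sqr_ge0.
have block : 1 <= \sum_(p < m | (j <= p)%N) \sum_(l < m | (l <= j)%N) t p l.
  have E : \sum_(p < m | (j <= p)%N) \sum_(l < m | (l <= j)%N) t p l =
     \sum_(p < m | (j <= p)%N) 1 - \sum_(p < m | (j <= p)%N) \sum_(l < m | ~~ (l <= j)%N) t p l.
    rewrite -sumrB; apply: eq_bigr => p _; rewrite -(unitary_row_sum uT p).
    by rewrite [X in _ = X - _](bigID (fun l : 'I_m => (l <= j)%N)) /= addrK.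
  have L : \sum_(p < m | (j <= p)%N) \sum_(l < m | ~~ (l <= j)%N) t p l <=
           \sum_(l < m | ~~ (l <= j)%N) 1.
    rewrite exchange_big /=; apply: ler_sum => l _.
    rewrite -(unitary_col_sum uT l) [X in _ <= X](bigID (fun p : 'I_m => (j <= p)%N)) /=.
    by rewrite lerDl; apply: sumr_ge0 => p _; exact: t0.
  have S : \sum_(p < m | (j <= p)%N) 1 = 1 + \sum_(l < m | ~~ (l <= j)%N) 1 :> R.
    rewrite (bigD1 j) //=; congr (_ + _); apply: eq_bigl => l.
    by rewrite -ltnNge ltn_neqAle eq_sym andbC.
  by lra.
apply: (@le_trans _ _ ((x j - y j) ^+ 2 *
    \sum_(p < m | (j <= p)%N) \sum_(l < m | (l <= j)%N) t p l)).
  by rewrite ler_peMr ?sqr_ge0.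
rewrite mulr_sumr [X in _ <= X](bigID (fun p : 'I_m => (j <= p)%N)) /=.
have K0 : forall p l, 0 <= K * (cabs (a p - b l) ^+ 2 * t p l).
  by move=> p l; rewrite mulrA mulr_ge0 // (le_trans _ (hK p l)) ?sqr_ge0.
apply: le_trans (_ : \sum_(p < m | (j <= p)%N)
    K * (\sum_l cabs (a p - b l) ^+ 2 * t p l) <= _); last first.
  by rewrite lerDl; apply: sumr_ge0 => p _; rewrite mulr_sumr; apply: sumr_ge0.
apply: ler_sum => p jp; rewrite !mulr_sumr.
rewrite [X in _ <= X](bigID (fun l : 'I_m => (l <= j)%N)) /=.
apply: le_trans (_ : \sum_(l < m | (l <= j)%N) K * (cabs (a p - b l) ^+ 2 * t p l) <= _); last first.
  by rewrite lerDl; apply: sumr_ge0 => l _; exact: K0.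
apply: ler_sum => l lj; rewrite [X in _ <= X]mulrA ler_wpM2r //.
apply: le_trans (hK p l); rewrite ler_sqr ?nnegrE.
- by have := mx j p jp; have := my l j lj; lra.
- exact: ltW.
- by have := mx j p jp; have := my l j lj; lra.
Qed.

Lemma sorted_perturb_sqr m (Q Q' : 'M[C]_m) (a b : 'I_m -> C) (x y : 'I_m -> R) (K : R) :
  0 <= K -> Q \is unitarymx -> Q' \is unitarymx ->
  {homo x : i j / (i <= j)%N >-> i <= j} -> {homo y : i j / (i <= j)%N >-> i <= j} ->
  (forall i j, (x i - y j) ^+ 2 <= K * cabs (a i - b j) ^+ 2) ->
  forall j, (x j - y j) ^+ 2 <= K * fro2 (sdec Q a - sdec Q' b).
Proof.
move=> K0 uQ uQ' mx my hK j.
have [h1|//] := sorted_perturb uQ uQ' mx my hK j.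
have hK' : forall i j, (y i - x j) ^+ 2 <= K * cabs (b i - a j) ^+ 2.
  by move=> i l; rewrite -sqrrN opprB cabsBC.
have [h2|h2] := sorted_perturb uQ' uQ my mx hK' j; last first.
  by rewrite -sqrrN opprB -fro2N opprB.
have -> : x j - y j = 0 by lra.
by rewrite expr0n mulr_ge0 ?fro2_ge0.
Qed.

Lemma sdecK m (Q : 'M[C]_m) (a : 'I_m -> C) : Q \is unitarymx ->
  Q *m sdec Q a *m Q^t* = diag_mx (\row_i a i).
Proof.
move=> /unitarymxP uQ; rewrite /sdec -mulmxA -[_ *m Q *m Q^t*]mulmxA uQ mulmx1.
by rewrite mulmxA uQ mul1mx.
Qed.

Lemma sdec_inj m (Q : 'M[C]_m) (a b : 'I_m -> C) : Q \is unitarymx ->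
  sdec Q a = sdec Q b -> a =1 b.
Proof.
move=> uQ e i; have := sdecK a uQ; rewrite e sdecK // => /matrixP/(_ i i).
by rewrite !mxE eqxx !mulr1n.
Qed.

Lemma normal_sdec m (A : 'M[C]_m) : A *m A^t* = A^t* *m A ->
  exists Q a, Q \is unitarymx /\ A = sdec Q a.
Proof.
move=> /normalmxP/orthomx_spectralP nA.
exists (spectralmx A), (spectral_diag A 0); split; first exact: spectral_unitarymx.
rewrite {1}nA invmx_unitary ?spectral_unitarymx //; congr (_ *m diag_mx _ *m _).
by apply/rowP => i; rewrite mxE.
Qed.

Lemma hermitian_sdec m (A : 'M[C]_m) : A^t* = A ->
  exists Q (x : 'I_m -> R), Q \is unitarymx /\ A = sdec Q (fun i => rc C (x i)).
Proof.
move=> hA; have [|Q [a [uQ eA]]] := @normal_sdec m A; first by rewrite hA.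
exists Q, (fun i => re (a i)); split=> //; rewrite eA; apply: eq_sdec => i.
have /(sdec_inj uQ)/(_ i) : sdec Q (fun i => (a i)^*) = sdec Q a.
  by rewrite -sdec_adj -eA.
move=> /(congr1 (@im R C)); rewrite im_conj => e.
by apply: complex_ext; rewrite ?re_rc // im_rc; lra.
Qed.

Lemma sdec_unitary_cabs m (Q : 'M[C]_m) (a : 'I_m -> C) :
  Q \is unitarymx -> sdec Q a \is unitarymx -> forall i, cabs (a i) = 1.
Proof.
move=> uQ + i => /unitarymxP; rewrite sdec_adj -sdecM // -(sdec_const 1 uQ).
move=> /(sdec_inj uQ)/(_ i); rewrite -sqr_cabs_conj -rc1 => /rc_inj/eqP.
by rewrite sqrp_eq1 ?cabs_ge0 // => /eqP.
Qed.

Lemma unitary_sdec m (A : 'M[C]_m) : A \is unitarymx ->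
  exists Q a, Q \is unitarymx /\ A = sdec Q a.
Proof. by move=> uA; apply: normal_sdec; rewrite adj_unitaryP // (unitarymxP uA). Qed.

End Frobenius.

(** * Double eigenvalues and echelon bases of eigenspaces *)

Section Degenerate.
Variables (R : realType) (C : complexModel R).

Definition simple m (U : 'M[C]_m) :=
  forall Q a, Q \is unitarymx -> U = sdec Q a -> injective a.

Lemma sdec_eigen m (Q : 'M[C]_m) (a : 'I_m -> C) i : Q \is unitarymx ->
  sdec Q a *m col i (Q^t*) = a i *: col i (Q^t*).
Proof.
move=> /unitarymxP uQ; rewrite {1}colE mulmxA {1}/sdec -[_ *m Q *m _]mulmxA uQ mulmx1 -colE.
by rewrite mul_mx_diag; apply/matrixP => k l; rewrite ord1 !mxE mulrC.
Qed.

(** If every 2x2 minor vanished, [w t] would equal [v t] times the inner product of [w] with [v],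
    hence be 0. *)
Lemma orthonormal_minor m (v w : 'I_m -> C) :
  \sum_i v i * (v i)^* = 1 -> \sum_i w i * (w i)^* = 1 ->
  \sum_i w i * (v i)^* = 0 ->
  exists s t, v s * w t - v t * w s != 0.
Proof.
move=> hv hw hvw; apply: contrapT => hN.
have z s t : v s * w t = v t * w s.
  by apply/eqP; rewrite -subr_eq0; apply: contraT => h; case: hN; exists s, t.
have w0 t : w t = 0.
  rewrite -[w t]mul1r -hv mulr_suml.
  transitivity (\sum_i v t * (w i * (v i)^* )).
    by apply: eq_bigr => i _; rewrite mulrAC z; ring.
  by rewrite -mulr_sumr hvw mulr0.
move: hw; rewrite big1 => [/eqP|i _]; first by rewrite eq_sym oner_eq0.
by rewrite w0 mul0r.
Qed.

(* A two-dimensional eigenspace has a basis in reduced echelon form with respect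
   to the pair of coordinates of its largest 2x2 minor; all entries are then
   bounded by 1. *)
Lemma degenerate_pair m (Q : 'M[C]_m) (a : 'I_m -> C) (i0 j0 : 'I_m) :
  Q \is unitarymx -> i0 != j0 -> a i0 = a j0 ->
  exists s t (p q : 'cV[C]_m), [/\ s != t,
    sdec Q a *m p = a i0 *: p /\ sdec Q a *m q = a i0 *: q,
    p s 0 = 1 /\ p t 0 = 0, q s 0 = 0 /\ q t 0 = 1 &
    forall u, cabs (p u 0) <= 1 /\ cabs (q u 0) <= 1].
Proof.
move=> uQ ij aij; pose v := col i0 (Q^t*); pose w := col j0 (Q^t*).
have ev : sdec Q a *m v = a i0 *: v by exact: sdec_eigen.
have ew : sdec Q a *m w = a i0 *: w by rewrite aij; exact: sdec_eigen.
have dot k l : \sum_i (col k (Q^t*)) i 0 * ((col l (Q^t*)) i 0)^* = (l == k)%:R.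
  move/unitarymxP/matrixP/(_ l k): uQ; rewrite !mxE => <-.
  by apply: eq_bigr => i _; rewrite !mxE conjCK mulrC.
pose mnr (st : 'I_m * 'I_m) := v st.1 0 * w st.2 0 - v st.2 0 * w st.1 0.
have [s0 [t0 n0]] : exists s t, v s 0 * w t 0 - v t 0 * w s 0 != 0.
  apply: (@orthonormal_minor m (fun i => v i 0) (fun i => w i 0)).
  - by rewrite dot eqxx.
  - by rewrite dot eqxx.
  - by rewrite dot (negPf ij).
case: (@Order.TotalTheory.arg_maxP _ _ _ (s0, t0) predT (fun st => cabs (mnr st)) isT) => -[s t] _ hmax.
have n1 : mnr (s, t) != 0.
  rewrite -cabs_gt0; apply: lt_le_trans (hmax (s0, t0) isT).
  by rewrite cabs_gt0.
set D := mnr (s, t) in n1 hmax.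
have Dp : 0 < cabs D by rewrite cabs_gt0.
have bd x y : cabs (mnr (x, y) / D) <= 1.
  by rewrite cabsM cabsV ler_pdivrMr // mul1r; exact: (hmax (x, y)).
(* Cramer's rule on the coordinates [s], [t]: entry [u] of the two vectors is the minor [(u, t)],
   respectively [(s, u)], divided by the largest minor [D]. *)
exists s, t, (D^-1 *: (w t 0 *: v - v t 0 *: w)), (D^-1 *: (v s 0 *: w - w s 0 *: v)).
have st : s != t.
  by apply: contra n1 => /eqP est; rewrite /D /mnr est /= subrr.
split => //.
- rewrite -!scalemxAr !mulmxBr -!scalemxAr ev ew; split.
    by rewrite [RHS]scalerA mulrC -scalerA; congr (_ *: _); rewrite scalerBr !scalerA ![a i0 * _]mulrC.
  by rewrite [RHS]scalerA mulrC -scalerA; congr (_ *: _); rewrite scalerBr !scalerA ![a i0 * _]mulrC.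
- move: n1; rewrite /D /mnr; move: (v) (w) => v' w'; rewrite !mxE /= => n1; split.
    by apply: (mulfI n1); rewrite mulVKf // mulr1; ring.
  by apply: (mulfI n1); rewrite mulVKf // mulr0; ring.
- move: n1; rewrite /D /mnr; move: (v) (w) => v' w'; rewrite !mxE /= => n1; split.
    by apply: (mulfI n1); rewrite mulVKf // mulr0; ring.
  by apply: (mulfI n1); rewrite mulVKf // mulr1; ring.
- move=> u; have := bd u t; have := bd s u.
  move: (D) => D'; rewrite /mnr /=; move: (v) (w) => v' w'; rewrite !mxE; split.
    by rewrite mulrC [w' t 0 * _]mulrC.
  by rewrite mulrC [w' s 0 * _]mulrC.
Qed.

End Degenerate.

(** * Lipschitz dependence of a degenerate [H] on its parameters *)

Section Rigidity.
Variables (R : realType) (C : complexModel R).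

Lemma mxBE m n (A B : 'M[C]_(m, n)) i j : (A - B) i j = A i j - B i j.
Proof. by rewrite !mxE. Qed.

Lemma mxZE m n (c : C) (A : 'M[C]_(m, n)) i j : (c *: A) i j = c * A i j.
Proof. by rewrite mxE. Qed.

Definition ic : C := mkC C 0 1.

Lemma icM : ic * ic = -1.
Proof. by apply: complex_ext; rewrite !reimE; ring. Qed.

Lemma cabs_ic : cabs ic = 1.
Proof. by rewrite /cabs re_mk im_mk expr0n expr1n add0r sqrtr1. Qed.

(** The coefficient matrix is entrywise within 1/4 of [lam + lam] times the identity, hence
    diagonally dominant: adding the two estimates absorbs the small terms in [x1] and [x2]. *)
Lemma two_by_two (x1 x2 y1 y2 z1 z2 lam : C) (rho : R) :
  cabs lam = 1 -> cabs (y1 - (lam + lam)) <= 4^-1 -> cabs y2 <= 4^-1 ->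
  cabs z1 <= 4^-1 -> cabs (z2 - (lam + lam)) <= 4^-1 ->
  cabs (x1 * y1 + x2 * y2) <= rho -> cabs (x1 * z1 + x2 * z2) <= rho ->
  cabs x1 <= 2 * rho /\ cabs x2 <= 2 * rho.
Proof.
move=> l1 hy1 hy2 hz1 hz2 hy hz.
have two (x : C) : cabs (x * (lam + lam)) = 2 * cabs x.
  have -> : x * (lam + lam) = rc C (1 + 1) * (x * lam) by rewrite rcD rc1; ring.
  by rewrite !cabsM l1 mulr1 cabs_rc ger0_norm ?addr_ge0.
have e1 : 2 * cabs x1 <= rho + cabs x1 / 4 + cabs x2 / 4.
  rewrite -two; have -> : x1 * (lam + lam) =
     (x1 * y1 + x2 * y2) - x1 * (y1 - (lam + lam)) - x2 * y2 by ring.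
  apply: le_trans (cabsB _ _) _; rewrite cabsM.
  have := cabsB (x1 * y1 + x2 * y2) (x1 * (y1 - (lam + lam))).
  rewrite [cabs (x1 * (_ - _))]cabsM.
  have := ler_wpM2l (cabs_ge0 x1) hy1; have := ler_wpM2l (cabs_ge0 x2) hy2.
  lra.
have e2 : 2 * cabs x2 <= rho + cabs x1 / 4 + cabs x2 / 4.
  rewrite -two; have -> : x2 * (lam + lam) =
     (x1 * z1 + x2 * z2) - x2 * (z2 - (lam + lam)) - x1 * z1 by ring.
  apply: le_trans (cabsB _ _) _; rewrite cabsM.
  have := cabsB (x1 * z1 + x2 * z2) (x2 * (z2 - (lam + lam))).
  rewrite [cabs (x2 * (_ - _))]cabsM.
  have := ler_wpM2l (cabs_ge0 x1) hz1; have := ler_wpM2l (cabs_ge0 x2) hz2.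
  lra.
by have := cabs_ge0 x1; have := cabs_ge0 x2; split; lra.
Qed.

(* For [g] the Cayley transform of [H], [g *m b *m p = l *: p] reads
   [H *m (b + l) p = i (b - l) p]. *)
Definition cayley_eigen m (H b : 'M[C]_m) (l : C) (p : 'cV[C]_m) :=
  H *m (b *m p + l *: p) = ic *: (b *m p - l *: p).

Section Fixed.
Variables (m : nat) (r0 : R).
Hypothesis r0m : m%:R * r0 * (m%:R + 1) <= 4^-1.

Lemma cabs_mulmx (A : 'M[C]_m) (v : 'cV[C]_m) (c e : R) i :
  (forall j, cabs (A i j) <= c) -> (forall j, cabs (v j 0) <= e) ->
  cabs ((A *m v) i 0) <= m%:R * (c * e).
Proof.
move=> hA hv; rewrite mxE; apply: le_trans (cabs_sum _ _ _) _.
apply: le_trans (_ : \sum_(j < m) c * e <= _); last first.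
  by rewrite sumr_const card_ord mulr_natl.
by apply: ler_sum => j _; rewrite cabsM; apply: ler_pM; rewrite ?cabs_ge0.
Qed.

Lemma cayley_bound (b : 'M[C]_m) l (p : 'cV[C]_m) i :
  (forall i j, cabs (b i j) <= 1) -> cabs l = 1 -> (forall i, cabs (p i 0) <= 1) ->
  cabs ((b *m p + l *: p) i 0) <= m%:R + 1.
Proof.
move=> hb hl hp; rewrite mxE; apply: le_trans (cabsD _ _) _; apply: lerD.
  by have := @cabs_mulmx b p 1 1 i (hb i) hp; rewrite !mulr1.
by rewrite mxE cabsM hl mul1r.
Qed.

(** For [y = b p + l p] the eigenvector equation gives [y - 2 l p = - i H y], and [r0m] makes the
    right side small. On the coordinates [s], [t] of an echelon basis the two vectors [y] are thus
    close to [2 l] times the identity. *)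
Lemma cayley_near (H b : 'M[C]_m) l (p : 'cV[C]_m) i :
  (forall i j, cabs (H i j) <= r0) -> (forall i j, cabs (b i j) <= 1) ->
  cabs l = 1 -> (forall i, cabs (p i 0) <= 1) -> cayley_eigen H b l p ->
  cabs ((b *m p + l *: p) i 0 - (l + l) * p i 0) <= 4^-1.
Proof.
move=> hH hb hl hp eH.
have e : (b *m p + l *: p) i 0 - (l + l) * p i 0 = - (ic * (H *m (b *m p + l *: p)) i 0).
  by rewrite eH; move: (b *m p) => B; rewrite !mxE mulrA icM; ring.
rewrite e cabsN cabsM cabs_ic mul1r; apply: le_trans r0m; rewrite -mulrA.
by apply: cabs_mulmx => // j; exact: cayley_bound.
Qed.

Variables (s t : 'I_m).
Hypothesis st : s != t.

Definition echelon (p q : 'cV[C]_m) := [/\ p s 0 = 1 /\ p t 0 = 0, q s 0 = 0 /\ q t 0 = 1 &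
  forall u, cabs (p u 0) <= 1 /\ cabs (q u 0) <= 1].

(** Subtracting the two equations leaves [i] times the variation of [b p - l p], minus
    [H' (y - y')]; the second term costs little because [H'] is small. *)
Lemma cayley_diff (H H' b b' : 'M[C]_m) l l' (p p' : 'cV[C]_m) (d : R) i :
  (forall i j, cabs (H' i j) <= r0) ->
  (forall i j, cabs (b' i j) <= 1) -> cabs l' = 1 ->
  (forall i, cabs (p i 0) <= 1) ->
  cayley_eigen H b l p -> cayley_eigen H' b' l' p' ->
  (forall i j, cabs (b i j - b' i j) <= d) -> cabs (l - l') <= d ->
  (forall i, cabs (p i 0 - p' i 0) <= d) ->
  cabs (((H - H') *m (b *m p + l *: p)) i 0) <= 4 * (m%:R + 1) * d.
Proof.
move=> hH' hb' hl' hp e e' db dl dp.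
have d0 : 0 <= d by exact: le_trans (cabs_ge0 _) dl.
have m0 : 0 <= m%:R :> R by exact: ler0n.
have dbp j : cabs ((b *m p - b' *m p') j 0) <= m%:R * (d + d).
  have -> : b *m p - b' *m p' = (b - b') *m p + b' *m (p - p').
    by rewrite mulmxBl mulmxBr addrA subrK.
  rewrite mxE mulrDr; apply: le_trans (cabsD _ _) _; apply: lerD.
    rewrite -[d]mulr1; apply: cabs_mulmx => // k.
    by rewrite !mxE.
  rewrite -[d]mul1r; apply: cabs_mulmx => // k.
  by rewrite !mxE.
have dlp j : cabs ((l *: p - l' *: p') j 0) <= d + d.
  have -> : (l *: p - l' *: p') j 0 = (l - l') * p j 0 + l' * (p j 0 - p' j 0).
    by rewrite !mxE; ring.
  apply: le_trans (cabsD _ _) _; rewrite !cabsM hl' mul1r; apply: lerD => //.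
  by apply: le_trans dl; rewrite ler_piMr ?cabs_ge0.
set y := b *m p + l *: p in e *; set y' := b' *m p' + l' *: p' in e' *.
have dy j : cabs ((y - y') j 0) <= 2 * (m%:R + 1) * d.
  have -> : (y - y') j 0 = (b *m p - b' *m p') j 0 + (l *: p - l' *: p') j 0.
    by rewrite /y /y'; move: (b *m p) (b' *m p') => B B'; rewrite !mxE; ring.
  apply: le_trans (cabsD _ _) _; have := dbp j; have := dlp j; lra.
have -> : (H - H') *m y = ic *: ((b *m p - b' *m p') - (l *: p - l' *: p')) - H' *m (y - y').
  rewrite mulmxBl e mulmxBr e'; move: (H' *m y) => P0.
  move: (b *m p) (b' *m p') (l *: p) (l' *: p') => P1 P2 P3 P4.
  by apply/matrixP => k k'; rewrite !mxE; ring.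
rewrite mxBE; apply: le_trans (cabsD _ _) _; rewrite cabsN.
have hz : cabs ((ic *: ((b *m p - b' *m p') - (l *: p - l' *: p'))) i 0) <= 2 * (m%:R + 1) * d.
  rewrite mxZE cabsM cabs_ic mul1r mxBE.
  apply: le_trans (cabsD _ _) _; rewrite cabsN.
  have := dbp i; have := dlp i; lra.
have hq := @cabs_mulmx H' (y - y') r0 (2 * (m%:R + 1) * d) i (hH' i) dy.
have : m%:R * (r0 * (2 * (m%:R + 1) * d)) <= 4^-1 * (2 * d).
  have -> : m%:R * (r0 * (2 * (m%:R + 1) * d)) = (m%:R * r0 * (m%:R + 1)) * (2 * d) by ring.
  by apply: ler_wpM2r => //; lra.
have : 0 <= m%:R * d by exact: mulr_ge0.
lra.
Qed.

(** Row [u] of [D] has only two entries not known to be small, those in columns [s] and [t]; the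
    vectors [y] and [z] give two equations for them, solved by [two_by_two]. *)
Lemma row_solve (D : 'M[C]_m) (u : 'I_m) (y z : 'cV[C]_m) l (c rho : R) : 0 <= c ->
  (forall w, w != s -> w != t -> cabs (D u w) <= c) ->
  (forall w, cabs (y w 0) <= m%:R + 1) -> (forall w, cabs (z w 0) <= m%:R + 1) ->
  cabs l = 1 -> cabs (y s 0 - (l + l)) <= 4^-1 -> cabs (y t 0) <= 4^-1 ->
  cabs (z s 0) <= 4^-1 -> cabs (z t 0 - (l + l)) <= 4^-1 ->
  cabs ((D *m y) u 0) <= rho -> cabs ((D *m z) u 0) <= rho ->
  forall w, cabs (D u w) <= 2 * (rho + m%:R * (c * (m%:R + 1))).
Proof.
move=> c0 hD hy hz hl ys yt zs zt Dy Dz.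
have part (v : 'cV[C]_m) : (forall w, cabs (v w 0) <= m%:R + 1) ->
    cabs ((D *m v) u 0) <= rho ->
    cabs (D u s * v s 0 + D u t * v t 0) <= rho + m%:R * (c * (m%:R + 1)).
  move=> hv; rewrite mxE (bigD1 s) //= (bigD1 t) 1?eq_sym //= addrA => h.
  rewrite -[X in cabs X](addrK (\sum_(i < m | (i != s) && (i != t)) D u i * v i 0)).
  apply: le_trans (cabsB _ _) _; apply: lerD => //.
  apply: le_trans (cabs_sum _ _ _) _.
  apply: le_trans (_ : \sum_(i < m | (i != s) && (i != t)) c * (m%:R + 1) <= _).
    apply: ler_sum => i /andP[i1 i2]; rewrite cabsM.
    by apply: ler_pM; rewrite ?cabs_ge0 //; exact: hD.
  rewrite sumr_const mulr_natl; apply: ler_wpMn2l; rewrite ?mulr_ge0 ?addr_ge0 //.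
  by rewrite -[X in (_ <= X)%N]card_ord max_card.
have [h1 h2] := two_by_two hl ys yt zs zt (part _ hy Dy) (part _ hz Dz).
move=> w; have [->//|ws] := eqVneq w s; have [->//|wt] := eqVneq w t.
apply: le_trans (hD w ws wt) _.
have rho0 : 0 <= rho by exact: le_trans (cabs_ge0 _) Dy.
have m1 : 1 <= m%:R :> R by rewrite ler1n; exact: leq_ltn_trans (leq0n u) (ltn_ord u).
have : c * 1 <= m%:R * (c * (m%:R + 1)).
  rewrite mulrCA; apply: ler_wpM2l => //; nra.
lra.
Qed.

(** Lipschitz form of the codimension count: a degenerate [H] is recovered from its entries off the
    rows and columns [s], [t], together with the eigenvalue, the echelon basis and [b]. *)
Lemma cayley_rigidity (H H' b b' : 'M[C]_m) l l' (p q p' q' : 'cV[C]_m) (d : R) :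
  H^t* = H -> H'^t* = H' ->
  (forall i j, cabs (H i j) <= r0) -> (forall i j, cabs (H' i j) <= r0) ->
  (forall i j, cabs (b i j) <= 1) -> (forall i j, cabs (b' i j) <= 1) ->
  cabs l = 1 -> cabs l' = 1 -> echelon p q -> echelon p' q' ->
  cayley_eigen H b l p -> cayley_eigen H b l q ->
  cayley_eigen H' b' l' p' -> cayley_eigen H' b' l' q' ->
  (forall i j, cabs (b i j - b' i j) <= d) -> cabs (l - l') <= d ->
  (forall i, cabs (p i 0 - p' i 0) <= d) -> (forall i, cabs (q i 0 - q' i 0) <= d) ->
  (forall u w, u != s -> u != t -> w != s -> w != t -> H u w = H' u w) ->
  forall i j, cabs (H i j - H' i j) <= 32 * (m%:R + 1) ^+ 3 * d.
Proof.
move=> sH sH' hH hH' hb hb' hl hl' [[ps pt] [qs qt] pq] [_ _ pq'].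
move=> ep eq ep' eq' db dl dp dq HH.
have hp i : cabs (p i 0) <= 1 by case: (pq i).
have hq i : cabs (q i 0) <= 1 by case: (pq i).
have d0 : 0 <= d by exact: le_trans (cabs_ge0 _) dl.
pose D := H - H'.
have sD u w : cabs (D u w) = cabs (D w u).
  by rewrite /D !mxBE -{1}sH -{1}sH' !mxE -rmorphB cabs_conj.
have Dp i := cayley_diff i hH' hb' hl' hp ep ep' db dl dp.
have Dq i := cayley_diff i hH' hb' hl' hq eq eq' db dl dq.
have yp i := cayley_bound i hb hl hp; have yq i := cayley_bound i hb hl hq.
have np i := cayley_near i hH hb hl hp ep; have nq i := cayley_near i hH hb hl hq eq.
have := np s; have := np t; have := nq s; have := nq t.
rewrite ps pt qs qt !mulr0 !mulr1 !subr0 => nqt nqs npt nps.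
have solve u c c0 hD := @row_solve D u _ _ l c _ c0 hD yp yq hl nps npt nqs nqt (Dp u) (Dq u).
set e := 4 * (m%:R + 1) * d in solve.
have m0 : 0 <= m%:R :> R by exact: ler0n.
have e0 : 0 <= e by rewrite /e !mulr_ge0 ?addr_ge0.
(* Off [s] and [t], a row of [D] vanishes outside the columns [s], [t], so [c] is 0. Hermitian
   symmetry then bounds the outer entries of the rows [s], [t], which are solved with
   [c = 2 * e]. *)
have row u : u != s -> u != t -> forall w, cabs (D u w) <= 2 * e.
  move=> us ut w; have := solve u 0 (lexx 0); rewrite mul0r mulr0 addr0; apply => v vs vt.
  by rewrite /D mxBE HH // subrr cabs0.
have e2 : 0 <= 2 * e by rewrite mulr_ge0.
have row2 u w : cabs (D u w) <= 2 * (e + m%:R * (2 * e * (m%:R + 1))).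
  apply: (solve u (2 * e) e2) => v vs vt.
  by rewrite sD; exact: row.
move=> i j; have := row2 i j; rewrite /D mxBE => /le_trans; apply.
have me : 0 <= m%:R * d by exact: mulr_ge0.
have mme : 0 <= m%:R * (m%:R * d) by exact: mulr_ge0.
have mmme : 0 <= m%:R * (m%:R * (m%:R * d)) by exact: mulr_ge0.
rewrite /e; set n : R := m%:R in m0 me mme mmme *.
have -> : 32 * (n + 1) ^+ 3 * d = 32 * d + 96 * (n * d) + 96 * (n * (n * d)) + 32 * (n * (n * (n * d))) by ring.
have -> : 2 * (4 * (n + 1) * d + n * (2 * (4 * (n + 1) * d) * (n + 1))) =
  8 * d + 24 * (n * d) + 32 * (n * (n * d)) + 16 * (n * (n * (n * d))) by ring.
lra.
Qed.

End Fixed.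
End Rigidity.

(** * The Cayley transform of a Hermitian matrix *)

Section CayleyTransform.
Variables (R : realType) (C : complexModel R).

(** With [g = (1 + i H) / (1 - i H)] one has [H (g + 1) = - i (g - 1)]; applied to [b p] this is the
    eigenvector equation. On eigenvalues [|w - 1|^2 = 4 x^2 / (1 + x^2)], whence the factor 4. *)
Lemma cayley_transform m (H : 'M[C]_m) : H^t* = H ->
  exists g, [/\ g \is unitarymx, fro2 (g - 1%:M) <= 4 * fro2 H &
    forall b l (p : 'cV[C]_m), g *m b *m p = l *: p -> cayley_eigen H b l p].
Proof.
move=> /hermitian_sdec[Q [x [uQ eH]]].
pose c j : C := 1 - ic C * rc C (x j).
have rec j : re (c j) = 1 by rewrite /c !reimE; ring.
have imc j : im (c j) = - x j by rewrite /c !reimE; ring.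
have c0 j : c j != 0.
  by apply/eqP => e; have := rec j; rewrite e re0 => /eqP; rewrite eq_sym oner_eq0.
pose w j := (1 + ic C * rc C (x j)) / c j.
have w1 j : w j - 1 = rc C (x j) * (ic C + ic C) / c j.
  by apply: (mulIf (c0 j)); rewrite /w mulrBl !divfK // /c; ring.
have w2 j : w j + 1 = (1 + 1) / c j.
  by apply: (mulIf (c0 j)); rewrite /w mulrDl !divfK // /c; ring.
exists (sdec Q w); split.
- apply: sdec_unitary => // j; rewrite /w cabsM cabsV; apply/eqP.
  rewrite -(inj_eq (mulIf (_ : cabs (c j) != 0))) ?cabs_eq0 // divfK ?cabs_eq0 // mul1r.
  by rewrite /cabs rec imc !reimE; apply/eqP; congr Num.sqrt; ring.
- have E0 : sdec Q (fun=> 0) = 0 by rewrite sdec_const // raddf0.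
  rewrite -(sdec_const 1 uQ) eH -[X in 4 * fro2 X]subr0 -E0.
  apply: (@le_trans _ _ (4 * fro2 (sdec Q (fun i => rc C (x i)) - sdec Q (fun=> 0)) + m%:R * 0)).
    apply: sdec_transfer => // i _; rewrite w1 subr0 addr0 cabsM cabsV !cabsM exprMn exprMn.
    have -> : cabs (ic C + ic C) = 2.
      rewrite /cabs !reimE; have -> : (0 + 0) ^+ 2 + (1 + 1) ^+ 2 = 2 ^+ 2 :> R by ring.
      by rewrite sqrtr_sqr ger0_norm.
    rewrite -natrX mulrAC [_ * 4%:R]mulrC ler_wpM2l // ler_piMr ?sqr_ge0 //.
    rewrite exprVn invf_le1 ?exprn_gt0 ?cabs_gt0 // sqr_cabsE rec imc expr1n lerDl.
    exact: sqr_ge0.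
  by rewrite mulr0 addr0.
move=> b l p e; rewrite /cayley_eigen -e -mulmxA.
have -> : b *m p + sdec Q w *m (b *m p) = (sdec Q w + 1%:M) *m (b *m p).
  by rewrite mulmxDl mul1mx addrC.
have -> : b *m p - sdec Q w *m (b *m p) = - ((sdec Q w - 1%:M) *m (b *m p)).
  by rewrite mulmxBl mul1mx opprB.
rewrite mulmxA scalerN -scaleNr scalemxAl; congr (_ *m _).
have -> : sdec Q w + 1%:M = sdec Q (fun j => w j + 1) by rewrite sdecD sdec_const.
have -> : sdec Q w - 1%:M = sdec Q (fun j => w j - 1).
  by rewrite sdecD sdec_const // raddfN.
rewrite -sdecZ eH -sdecM //; apply: eq_sdec => j.
rewrite w2 w1; apply: (mulIf (c0 j)).
rewrite -!mulrA mulVf // !mulr1.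
transitivity (- (ic C * ic C) * (rc C (x j) * (1 + 1))); last by ring.
by rewrite icM opprK mul1r.
Qed.

End CayleyTransform.

(** * Grid of Hermitian matrices, cells, and arcs of the circle *)

Section Pigeonhole.
Variables (R : realType) (C : complexModel R).

Section Grid.
Variables (m N : nat) (eta : R).
Hypothesis eta0 : 0 < eta.
Implicit Types h : {ffun 'I_m * 'I_m -> 'I_N}.

(** The [m ^ 2] values of [h] are the real coordinates of a Hermitian matrix: an entry above the
    diagonal takes its real part from [(i, j)] and its imaginary part from [(j, i)]. *)
Definition hgrid h : 'M[C]_m := \matrix_(i, j)
  let v a b := (h (a, b))%:R * eta in
  if i == j then rc C (v i i) else if (i < j)%N then mkC C (v i j) (v j i)
  else mkC C (v j i) (- v i j).

Lemma hgrid_herm h : (hgrid h)^t* = hgrid h.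
Proof.
apply/matrixP => i j; rewrite !mxE [j == i]eq_sym; case: eqVneq => [->|ij].
  by apply: complex_ext; rewrite !reimE ?oppr0.
case: ltngtP => [lt|lt|/val_inj e]; last by rewrite e eqxx in ij.
  by apply: complex_ext; rewrite !reimE ?opprK.
by apply: complex_ext; rewrite !reimE ?opprK.
Qed.

Lemma hgrid_bound h i j : cabs (hgrid h i j) <= 2 * (N%:R * eta).
Proof.
have b a : 0 <= (h a)%:R * eta <= N%:R * eta.
  apply/andP; split; first by rewrite mulr_ge0 // ltW.
  by apply: ler_wpM2r; [exact: ltW | rewrite ler_nat ltnW].
have ab a : `|(h a)%:R * eta| <= N%:R * eta by have /andP[? ?] := b a; rewrite ger0_norm.
have n0 : 0 <= N%:R * eta by rewrite mulr_ge0 // ltW.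
apply: le_trans (cabs_le_reim _) _; have -> : 2 * (N%:R * eta) = N%:R * eta + N%:R * eta by ring.
by rewrite !mxE /=; case: ifP => _; last case: ifP => _;
  rewrite !reimE ?normrN ?normr0; apply: lerD.
Qed.

Lemma grid_eq (a b : 'I_N) : `|a%:R * eta - b%:R * eta| < eta -> a = b.
Proof.
move=> lt; apply: val_inj => /=; apply/eqP; move: lt.
rewrite -mulrBl normrM (gtr0_norm eta0) gtr_pMl // => lt.
have [ab|ab|//] := ltngtP (a : nat) b.
  move: lt; rewrite distrC -(natrB R (ltnW ab)) normr_nat -[1]/(1%:R) ltr_nat; lia.
move: lt; rewrite -(natrB R (ltnW ab)) normr_nat -[1]/(1%:R) ltr_nat; lia.
Qed.

Lemma hgrid_inj h h' : (forall i j, cabs (hgrid h i j - hgrid h' i j) < eta) -> h = h'.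
Proof.
move=> lt; apply/ffunP => -[i j].
have lre i' j' := le_lt_trans (normr_re_le _) (lt i' j').
have lim i' j' := le_lt_trans (normr_im_le _) (lt i' j').
have [e|ij] := eqVneq i j.
  by subst j; apply: grid_eq; have := lre i i; rewrite !mxE eqxx !reimE.
have [lij|lji|/val_inj e] := ltngtP i j; last by rewrite e eqxx in ij.
  by apply: grid_eq; have := lre i j; rewrite !mxE (negPf ij) lij !reimE.
apply: grid_eq; have := lim i j; rewrite !mxE (negPf ij) ltnNge ltnW //= !reimE.
by rewrite -opprD normrN.
Qed.

Lemma hgrid_local h h' u w : h (u, w) = h' (u, w) -> h (w, u) = h' (w, u) ->
  hgrid h u w = hgrid h' u w.
Proof.
move=> e1 e2; rewrite !mxE /= e1 e2; case: ifP => // /eqP uw; subst w.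
by rewrite e1.
Qed.

End Grid.

(** Boxes of width [2 / M] covering [[-1, 1]]; the endpoint 1 lands in box number [M], hence [M.+1]
    boxes. *)
Definition cell M (x : R) : 'I_M.+1 := inord (Num.trunc ((x + 1) / 2 * M%:R)).

Lemma cell_near M (x y : R) : (0 < M)%N -> `|x| <= 1 -> `|y| <= 1 ->
  cell M x = cell M y -> `|x - y| <= 2 / M%:R.
Proof.
rewrite !ler_norml => M0 /andP[x1 x2] /andP[y1 y2] /(congr1 val).
have M0' : 0 < M%:R :> R by rewrite ltr0n.
have tr (z : R) : -1 <= z -> z <= 1 -> 0 <= (z + 1) / 2 * M%:R /\
    (Num.trunc ((z + 1) / 2 * M%:R) < M.+1)%N.
  move=> z1 z2; have h0 : 0 <= (z + 1) / 2 * M%:R.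
    by apply: mulr_ge0; [lra | exact: ler0n].
  split=> //; rewrite ltnS -(ler_nat R).
  have /andP[+ _] := truncn_itv h0; move=> /le_trans; apply.
  by rewrite ler_piMl ?ler0n //; lra.
have [hx0 hx] := tr x x1 x2; have [hy0 hy] := tr y y1 y2.
rewrite /= !inordK // => e.
have := truncn_itv hx0; have := truncn_itv hy0; rewrite e.
set n := Num.trunc _; rewrite -[n.+1%:R]natr1 => /andP[ly uy] /andP[lx ux].
have ex : (x + 1) / 2 * M%:R = x * M%:R / 2 + M%:R / 2 by lra.
have ey : (y + 1) / 2 * M%:R = y * M%:R / 2 + M%:R / 2 by lra.
by apply/andP; split; rewrite ?[- (_ / _) <= _]lerNl ler_pdivlMr //; lra.
Qed.

(* Where [`|im l| <= `|re l|], the unit number [l] is a Lipschitz function of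
   [im l] and the sign of [re l]; elsewhere exchange the two. *)
Definition arc_label (l : C) : bool * bool :=
  (`|im l| <= `|re l|, if `|im l| <= `|re l| then 0 <= re l else 0 <= im l).

Definition arc_coord (l : C) : R := if `|im l| <= `|re l| then im l else re l.

(** [(a - a') (a + a') = - (b - b') (b + b')], and for [a], [a'] of the same sign
    [|a + a'| = |a| + |a'|] dominates [|b + b'|]. *)
Lemma arc_aux (a b a' b' d : R) : a ^+ 2 + b ^+ 2 = 1 -> a' ^+ 2 + b' ^+ 2 = 1 ->
  `|b| <= `|a| -> `|b'| <= `|a'| -> (0 <= a) = (0 <= a') -> `|b - b'| <= d ->
  `|a - a'| <= d.
Proof.
move=> e e' ab ab' s db; apply: le_trans db.
have [hs|hs] := boolP (a + a' == 0).
  have : a = 0 by move: s; case: (leP 0 a) => h h'; move: hs => /eqP hs; lra.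
  move=> a0; move: ab e; rewrite a0 normr0 normr_le0 => /eqP ->.
  by rewrite expr0n addr0 => /eqP; rewrite eq_sym oner_eq0.
have sa : `|a + a'| = `|a| + `|a'|.
  move: s; have [h|h] := leP 0 a => /esym s.
    by rewrite !ger0_norm // addr_ge0.
  move/negbT: s; rewrite -ltNge => s.
  by rewrite !ltr0_norm ?opprD // -oppr_gt0 opprD addr_gt0 // oppr_gt0.
have p : 0 < `|a + a'| by rewrite normr_gt0.
rewrite -(ler_pM2r p) -normrM.
have -> : (a - a') * (a + a') = - ((b - b') * (b + b')).
  have -> : (a - a') * (a + a') = a ^+ 2 - a' ^+ 2 by ring.
  have -> : (b - b') * (b + b') = b ^+ 2 - b' ^+ 2 by ring.
  lra.
rewrite normrN normrM ler_wpM2l // sa.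
by apply: le_trans (ler_normD _ _) _; apply: lerD.
Qed.

Lemma arc_near (l l' : C) (d : R) : cabs l = 1 -> cabs l' = 1 ->
  arc_label l = arc_label l' -> `|arc_coord l - arc_coord l'| <= d ->
  cabs (l - l') <= 2 * d.
Proof.
move=> n n'; have := sqr_cabsE l; have := sqr_cabsE l'; rewrite n n' expr1n => e' e.
rewrite /arc_label /arc_coord; case: ifP => h [h' s] hd.
  rewrite -h' in s hd.
  have hr := arc_aux (esym e) (esym e') h (esym h') s hd.
  by have := cabs_le_reim (l - l'); rewrite !reimE; lra.
rewrite -h' in s hd; move/negbT: h; rewrite -ltNge => /ltW h.
move/esym/negbT: h'; rewrite -ltNge => /ltW h'.
rewrite addrC in e; rewrite addrC in e'.
have hr := arc_aux (esym e) (esym e') h h' s hd.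
by have := cabs_le_reim (l - l'); rewrite !reimE; lra.
Qed.

Lemma arc_coord_le1 (l : C) : cabs l = 1 -> `|arc_coord l| <= 1.
Proof.
move=> l1; rewrite /arc_coord -l1; case: ifP => _; first exact: normr_im_le.
exact: normr_re_le.
Qed.

End Pigeonhole.

(** * A constant unitary factor that removes all degeneracies *)

Section GenericPerturbation.
Variables (R : realType) (C : complexModel R) (m : nat).
Variables (beta : R -> R -> 'M[C]_m) (L : R).
Hypothesis L0 : 0 <= L.
Hypothesis beta_unitary : forall k1 k2, beta k1 k2 \is unitarymx.
Hypothesis beta_lip : forall k1 k2 k1' k2' i j,
  cabs (beta k1 k2 i j - beta k1' k2' i j) <= L * (`|k1 - k1'| + `|k2 - k2'|).

(** What a double eigenvalue of [g *m beta k] leaves behind when [g] is the Cayley transform of [H],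
    phrased through [H] so that rigidity applies. *)
Definition degeneracy (H : 'M[C]_m) (st : 'I_m * 'I_m) (k : R * R) (l : C)
    (pq : 'cV[C]_m * 'cV[C]_m) :=
  [/\ st.1 != st.2, 0 <= k.1 <= 1 /\ 0 <= k.2 <= 1, cabs l = 1, echelon st.1 st.2 pq.1 pq.2 &
   cayley_eigen H (beta k.1 k.2) l pq.1 /\ cayley_eigen H (beta k.1 k.2) l pq.2].

(* The [m ^ 2 - 1] real coordinates of a degeneracy, as indices of a family:
   the entries of [H] outside the rows and columns [s], [t], then the free entries
   of the echelon basis, and finally the eigenvalue and the point of the torus. *)
Definition coord_index := ((('I_m * 'I_m) + ('I_m * (bool * bool))) + option bool)%type.

Definition off_pair (s t : 'I_m) := [seq u <- enum 'I_m | (u != s) && (u != t)].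

Definition coord_indices (s t : 'I_m) : seq coord_index :=
  [seq inl (inl (u, w)) | u <- off_pair s t, w <- off_pair s t] ++
  [seq inl (inr (u, b)) | u <- off_pair s t,
     b <- [:: (true, true); (true, false); (false, true); (false, false)]] ++
  [seq inr o | o <- [:: None; Some true; Some false]].

Lemma size_off_pair s t : s != t -> size (off_pair s t) = (m - 2)%N.
Proof.
move=> st; have -> : (m - 2)%N = #|~: [set s; t]|.
  by rewrite cardsCs finset.setCK cards2 st card_ord.
rewrite -(card_uniqP (filter_uniq _ (enum_uniq _))); apply: eq_card => u.
by rewrite mem_filter mem_enum !inE negb_or andbT.
Qed.

(** [(m - 2)^2 + 4 (m - 2) + 3 = m^2 - 1], one less than the dimension of the Hermitian matrices.
    The 3 counts the eigenvalue on its circle and the two directions of the torus. *)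
Lemma size_coord_indices s t : s != t -> (size (coord_indices s t)).+1 = (m * m)%N.
Proof.
move=> st; rewrite !size_cat !size_allpairs size_map !size_off_pair //=.
have : (2 <= m)%N.
  by have := max_card [set s; t]; rewrite cards2 st card_ord.
by move: (m) => n; nia.
Qed.

(** Dividing by [N] brings the values of [h] into [[0, 1]], so that one subdivision [cell] serves
    all coordinates. *)
Definition coordinate N (h : {ffun 'I_m * 'I_m -> 'I_N}) (k : R * R) (l : C)
    (pq : 'cV[C]_m * 'cV[C]_m) (e : coord_index) : R :=
  match e with
  | inl (inl uw) => (h uw)%:R / N%:R
  | inl (inr (u, (b1, b2))) =>
      let z := (if b1 then pq.1 else pq.2) u 0 in if b2 then re z else im z
  | inr None => arc_coord l
  | inr (Some b) => if b then k.1 else k.2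
  end.

Lemma coordinate_le1 N (h : {ffun 'I_m * 'I_m -> 'I_N}) H st k l pq e :
  degeneracy H st k l pq -> `|coordinate h k l pq e| <= 1.
Proof.
move=> [_ [/andP[k1 k1'] /andP[k2 k2']] l1 [_ _ pqb] _].
case: e => [[uw|[u [b1 b2]]]|[b|]] /=; last exact: arc_coord_le1.
- have N0 : 0 < N%:R :> R by rewrite ltr0n (leq_ltn_trans (leq0n _) (ltn_ord (h uw))).
  rewrite ger0_norm ?divr_ge0 ?ler0n // ler_pdivrMr // mul1r ler_nat ltnW //.
- have [p1 q1] := pqb u; have pb : cabs ((if b1 then pq.1 else pq.2) u 0) <= 1 by case: b1.
  by case: b2; apply: le_trans pb; [exact: normr_re_le | exact: normr_im_le].
- by case: b; rewrite ger0_norm.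
Qed.

(** Equal cells mean coordinates within [2 / M]. As this is less than [1 / N], the outer entries of
    [h] and [h'] coincide; the other data differ by at most [d], and rigidity then places the two
    matrices less than one grid step apart. *)
Lemma degeneracy_rigid N M (r0 d : R) (h h' : {ffun 'I_m * 'I_m -> 'I_N}) st
    k k' l l' pq pq' :
  (0 < N)%N -> (0 < M)%N -> 0 < r0 -> m%:R * r0 * (m%:R + 1) <= 4^-1 ->
  2 / M%:R < N%:R^-1 :> R ->
  d = (2 * L + 2) * (2 / M%:R) ->
  32 * (m%:R + 1) ^+ 3 * d < r0 / (2 * N%:R) ->
  degeneracy (hgrid C (r0 / (2 * N%:R)) h) st k l pq ->
  degeneracy (hgrid C (r0 / (2 * N%:R)) h') st k' l' pq' ->
  arc_label l = arc_label l' ->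
  (forall e, e \in coord_indices st.1 st.2 ->
     cell M (coordinate h k l pq e) = cell M (coordinate h' k' l' pq' e)) ->
  h = h'.
Proof.
move=> N0 M0 r00 r0m MN dE dr dg dg' ll hc.
have N0' : 0 < N%:R :> R by rewrite ltr0n.
have M0' : 0 < M%:R :> R by rewrite ltr0n.
set eta := r0 / (2 * N%:R) in dr dg dg' *.
have eta0 : 0 < eta by rewrite divr_gt0 // mulr_gt0.
set del := 2 / M%:R in MN dE.
have del0 : 0 < del by rewrite divr_gt0.
have near e : e \in coord_indices st.1 st.2 ->
    `|coordinate h k l pq e - coordinate h' k' l' pq' e| <= del.
  by move=> /hc; apply: cell_near => //; [exact: coordinate_le1 dg | exact: coordinate_le1 dg'].
have off u : u != st.1 -> u != st.2 -> u \in off_pair st.1 st.2.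
  by move=> us ut; rewrite mem_filter us ut mem_enum.
have dd : 2 * del <= d.
  by rewrite dE; apply: ler_wpM2r; [exact: ltW | rewrite lerDr mulr_ge0].
have hh u w : u != st.1 -> u != st.2 -> w != st.1 -> w != st.2 -> h (u, w) = h' (u, w).
  move=> us ut ws wt; have := near (inl (inl (u, w))); rewrite !mem_cat.
  rewrite (allpairs_f (fun u w => inl (inl (u, w)))) ?off // => /(_ isT) /= lt.
  apply: (@grid_eq R N N%:R^-1); first by rewrite invr_gt0.
  exact: le_lt_trans lt MN.
have kk (b : bool) : `|(if b then k.1 else k.2) - (if b then k'.1 else k'.2)| <= del.
  have := near (inr (Some b)); rewrite !mem_cat (map_f (fun o => inr o)) ?orbT.
    by move=> /(_ isT).
  by case: b.
have lnear : cabs (l - l') <= d.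
  apply: le_trans dd; have [_ _ l1 _ _] := dg; have [_ _ l1' _ _] := dg'.
  apply: arc_near => //; have := near (inr None).
  rewrite !mem_cat (map_f (fun o => inr o)) ?orbT //.
  by move=> /(_ isT).
have bnear i j : cabs (beta k.1 k.2 i j - beta k'.1 k'.2 i j) <= d.
  apply: le_trans (beta_lip _ _ _ _ _ _) _.
  have := kk true; have := kk false => /= h1 h2.
  apply: le_trans (_ : L * (del + del) <= _); first by apply: ler_wpM2l => //; lra.
  have -> : L * (del + del) = (2 * L) * del by ring.
  by rewrite dE; apply: ler_wpM2r; [exact: ltW | rewrite lerDl].
have d0 : 0 <= d by exact: le_trans (cabs_ge0 _) lnear.
have [st0 _ l1 ech [c1 c2]] := dg; have [_ _ l1' ech' [c1' c2']] := dg'.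
have pnear (b : bool) i : cabs ((if b then pq.1 else pq.2) i 0 - (if b then pq'.1 else pq'.2) i 0) <= d.
  have [[ps pt] [qs qt] _] := ech; have [[ps' pt'] [qs' qt'] _] := ech'.
  have [->|is_] := eqVneq i st.1.
    by case: b; rewrite ?ps ?ps' ?qs ?qs' subrr cabs0.
  have [->|it] := eqVneq i st.2.
    by case: b; rewrite ?pt ?pt' ?qt ?qt' subrr cabs0.
  apply: le_trans dd; apply: le_trans (cabs_le_reim _) _.
  have nr (b' : bool) := near (inl (inr (i, (b, b')))).
  have mem b' : inl (inr (i, (b, b'))) \in coord_indices st.1 st.2.
    rewrite !mem_cat (allpairs_f (fun u b => inl (inr (u, b)))) ?orbT ?off //.
    by case: (b); case: b'.
  have := nr true (mem true); have := nr false (mem false); rewrite /= !reimE; lra.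
have bu k0 i j : cabs (beta k0.1 k0.2 i j) <= 1 by exact: unitary_entry.
have hb (h0 : {ffun 'I_m * 'I_m -> 'I_N}) i j : cabs (hgrid C eta h0 i j) <= r0.
  have e : 2 * (N%:R * eta) = r0 by rewrite /eta; field; rewrite lt0r_neq0.
  by have := @hgrid_bound R C m N eta eta0 h0 i j; rewrite e.
apply: (@hgrid_inj R C m N eta eta0) => i j; apply: le_lt_trans dr.
apply: (cayley_rigidity r0m st0 (hgrid_herm _ _ _) (hgrid_herm _ _ _) (hb h) (hb h')
  (bu k) (bu k') l1 l1' ech ech' c1 c2 c1' c2' bnear lnear (pnear true) (pnear false)).
move=> u w us ut ws wt; apply: hgrid_local; exact: hh.
Qed.

Theorem exists_simple_perturbation (r : R) : 0 < r ->
  exists g, [/\ g \is unitarymx, fro2 (g - 1%:M) <= r &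
    forall k1 k2, 0 <= k1 <= 1 -> 0 <= k2 <= 1 -> simple (g *m beta k1 k2)].
Proof.
move=> r_gt0.
pose n : R := m%:R; have n0 : 0 <= n by exact: ler0n.
(* The first bound gives [r0m]; the other two give [4 m^2 r0^2 <= r], which controls the distance
   from [g] to 1. *)
pose r0 : R := Num.min (4 * (n + 1) ^+ 2)^-1 (Num.min 1 (r / (4 * (n + 1) ^+ 2))).
have q0 : 0 < (n + 1) ^+ 2 by rewrite exprn_gt0 // ltr_wpDl.
have q4 : 0 < 4 * (n + 1) ^+ 2 by rewrite mulr_gt0.
have r00 : 0 < r0 by rewrite !lt_min invr_gt0 q4 ltr01 divr_gt0.
have r0m : m%:R * r0 * (m%:R + 1) <= 4^-1.
  have h : r0 <= (4 * (n + 1) ^+ 2)^-1 by rewrite ge_min lexx.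
  rewrite -/n mulrAC; apply: le_trans (ler_wpM2l _ h) _.
    by rewrite mulr_ge0 ?addr_ge0.
  rewrite invfM mulrCA ler_piMr ?invr_ge0 //.
  rewrite ler_pdivrMr // mul1r expr2; apply: ler_wpM2r; first exact: addr_ge0.
  by rewrite lerDl.
have r0r : 4 * ((m * m)%:R * r0 ^+ 2) <= r.
  have h : r0 <= r / (4 * (n + 1) ^+ 2) by rewrite !ge_min lexx !orbT.
  have h1 : r0 <= 1 by rewrite !ge_min lexx orbT.
  rewrite natrM -/n; apply: le_trans (_ : (4 * (n * n)) * r0 <= _).
    rewrite -[X in _ <= X]mulrA; apply: ler_wpM2l => //; apply: ler_wpM2l; first exact: mulr_ge0.
    by rewrite expr2 ler_piMr // ltW.
  rewrite (ler_pdivlMr _ _ q4) in h; apply: le_trans h; rewrite [r0 * _]mulrC.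
  apply: ler_wpM2r; first exact: ltW.
  by apply: ler_wpM2l => //; nra.
pose Q := 32 * (n + 1) ^+ 3 * (2 * L + 2) * 4 / r0.
have Q0 : 0 <= Q by rewrite /Q divr_ge0 ?mulr_ge0 ?exprn_ge0 ?addr_ge0 ?mulr_ge0 // ltW.
(* For [M = K * N], the bound [Q < K] makes the rigidity estimate smaller than the grid step
   [r0 / (2 * N)]; [.+3] ensures [2 < K], hence [2 / M < 1 / N]. *)
pose K := (Num.trunc Q).+3.
have KQ : Q < K%:R.
  have /andP[_ h] := truncn_itv Q0; apply: lt_le_trans h _.
  by rewrite ler_nat /K ltnW.
apply: contrapT => hN.
pose A := (m * m * 4)%N.
(* If every point of the grid were bad, sending it to the cells of its [m ^ 2 - 1]
   coordinates, plus one of [4 m ^ 2] labels, would be injective. *)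
have key N : (0 < N)%N -> exists2 c : nat, c.+1 = (m * m)%N & (N ^ c.+1 <= A * (K * N).+1 ^ c)%N.
  move=> N0; pose M := (K * N)%N; pose eta := r0 / (2 * N%:R).
  have M0 : (0 < M)%N by rewrite muln_gt0.
  have N0' : 0 < N%:R :> R by rewrite ltr0n.
  have K0' : 0 < K%:R :> R by rewrite ltr0n.
  have MN : 2 / M%:R < N%:R^-1 :> R.
    rewrite /M natrM invfM mulrA -[X in _ < X]mul1r ltr_pM2r ?invr_gt0 //.
    by rewrite ltr_pdivrMr // mul1r ltr_nat.
  have dr : 32 * (m%:R + 1) ^+ 3 * ((2 * L + 2) * (2 / M%:R)) < r0 / (2 * N%:R).
    move: KQ; rewrite /Q -/n ltr_pdivrMr // /M natrM => h.
    rewrite ltr_pdivlMr ?mulr_gt0 //.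
    have -> : 32 * (n + 1) ^+ 3 * ((2 * L + 2) * (2 / (K%:R * N%:R))) * (2 * N%:R) =
      32 * (n + 1) ^+ 3 * (2 * L + 2) * 4 / K%:R.
      by field; rewrite !lt0r_neq0.
    by rewrite ltr_pdivrMr // [r0 * _]mulrC.
  have bad (h : {ffun 'I_m * 'I_m -> 'I_N}) : exists x :
      ('I_m * 'I_m) * (R * R) * C * ('cV[C]_m * 'cV[C]_m),
      degeneracy (hgrid C eta h) x.1.1.1 x.1.1.2 x.1.2 x.2.
    have [g [ug gr gc]] := cayley_transform (hgrid_herm C eta h).
    apply: contrapT => hN2; apply: hN; exists g; split=> //.
      apply: le_trans gr _; apply: le_trans r0r; apply: ler_wpM2l => //.
      apply: fro2_le_entries => i j.
      have e : 2 * (N%:R * eta) = r0 by rewrite /eta; field; rewrite lt0r_neq0.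
      have eta0 : 0 < eta by rewrite divr_gt0 // mulr_gt0.
      by have := @hgrid_bound R C m N eta eta0 h i j; rewrite e.
    move=> k1 k2 hk1 hk2 Q1 a uQ1 eg i j aij; apply: contrapT => /eqP ij.
    have [s [t [p [q [st [ep eq] ep1 eq1 pq]]]]] := degenerate_pair uQ1 ij aij.
    apply: hN2; exists ((s, t), (k1, k2), a i, (p, q)); split=> //=.
    - by apply: (sdec_unitary_cabs uQ1); rewrite -eg mul_unitarymx.
    - by split; apply: gc; rewrite eg.
  have [x xP] := choice bad.
  have [h0] : exists h : {ffun 'I_m * 'I_m -> 'I_N}, true by exists [ffun=> Ordinal N0].
  move=> _; have [st0 _ _ _ _] := xP h0.
  exists (size (coord_indices (x h0).1.1.1.1 (x h0).1.1.1.2)); first exact: size_coord_indices.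
  set c := size _; have cE : c.+1 = (m * m)%N by exact: size_coord_indices.
  have sz h : size (coord_indices (x h).1.1.1.1 (x h).1.1.1.2) = c.
    by apply: succn_inj; rewrite cE size_coord_indices //; have [] := xP h.
  pose code h := ((x h).1.1.1, arc_label (x h).1.2,
    [ffun i : 'I_c => cell M (coordinate h (x h).1.1.2 (x h).1.2 (x h).2
        (nth (inr None) (coord_indices (x h).1.1.1.1 (x h).1.1.1.2) i))]).
  have inj : injective code.
    move=> h h' e3; have est : (x h).1.1.1 = (x h').1.1.1 := congr1 (fun c => c.1.1) e3.
    have elab := congr1 (fun c => c.1.2) e3.
    apply: (degeneracy_rigid N0 M0 r00 r0m MN erefl dr (xP h) _ elab).
      by rewrite est; exact: xP.
    move=> e eX; have ic : (index e (coord_indices (x h).1.1.1.1 (x h).1.1.1.2) < c)%N.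
      by rewrite -(sz h) index_mem.
    move/(congr1 snd)/ffunP/(_ (Ordinal ic)): e3; rewrite !ffunE /= nth_index //.
    by rewrite -est nth_index.
  have := leq_card code inj.
  rewrite card_ffun !card_prod card_ffun !card_ord card_bool -cE.
  by rewrite /A -cE.
have [c cE _] := key 1%N isT.
(* For [B = A * (2 * K) ^ c] and [N = B.+1], the estimate [K * N + 1 <= 2 * K * N] makes the left
   side at most [B * N ^ c], which is less than [N ^ c.+1]. *)
have [N [N0 hNc]] : exists N, (0 < N)%N /\ (A * (K * N).+1 ^ c < N ^ c.+1)%N.
  have [B BE] : exists B, B = (A * (2 * K) ^ c)%N by eexists.
  exists B.+1; split=> //.
  have h1 : ((K * B.+1).+1 <= 2 * K * B.+1)%N by rewrite /K; nia.
  have h2 : ((K * B.+1).+1 ^ c <= (2 * K * B.+1) ^ c)%N.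
    by case: (c) => // c'; rewrite leq_exp2r.
  rewrite expnS; apply: leq_ltn_trans (_ : B * B.+1 ^ c < _)%N.
    by rewrite [in X in (_ <= X * _)%N]BE -mulnA -expnMn leq_mul2l h2 orbT.
  by rewrite ltn_mul2r expn_gt0 /= leqnn.
have [c' c'E] := key N N0; have -> : c' = c by apply: succn_inj; rewrite c'E.
by rewrite leqNgt hNc.
Qed.

End GenericPerturbation.

(** * The unitary polar factor of a nearly unitary matrix *)

Section Polar.
Variables (R : realType) (C : complexModel R) (m : nat).

(** [P] is the inverse square root of [B]. Eigenvalues at least 1/2 keep the inverse square root
    Lipschitz on the spectrum. *)
Definition inv_sqrt (B P : 'M[C]_m) := exists Q (b : 'I_m -> R),
  [/\ Q \is unitarymx, B = sdec Q (fun j => rc C (b j)), forall j, 1 / 2 <= b j &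
      P = sdec Q (fun j => rc C (Num.sqrt (b j))^-1)].

Lemma inv_sqrt_lip (x y : R) : 1 / 2 <= x -> 1 / 2 <= y ->
  ((Num.sqrt x)^-1 - (Num.sqrt y)^-1) ^+ 2 <= 4 * (x - y) ^+ 2.
Proof.
move=> hx hy; set s := Num.sqrt x; set t := Num.sqrt y.
have ss : s ^+ 2 = x by rewrite sqr_sqrtr //; lra.
have tt : t ^+ 2 = y by rewrite sqr_sqrtr //; lra.
have s0 : 0 < s by rewrite sqrtr_gt0; lra.
have t0 : 0 < t by rewrite sqrtr_gt0; lra.
have -> : s^-1 - t^-1 = (t - s) / (s * t) by field; rewrite !lt0r_neq0.
rewrite -ss -tt expr_div_n ler_pdivrMr ?exprn_gt0 ?mulr_gt0 //.
have -> : 4 * (s ^+ 2 - t ^+ 2) ^+ 2 * (s * t) ^+ 2 =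
  (t - s) ^+ 2 * (4 * ((s + t) ^+ 2 * (s ^+ 2 * t ^+ 2))) by ring.
rewrite ler_peMr ?sqr_ge0 // ss tt.
have h1 : 1 <= (s + t) ^+ 2.
  have : 0 < s * t by exact: mulr_gt0.
  by rewrite sqrrD ss tt; lra.
have h2 : 1 / 4 <= x * y by nra.
nra.
Qed.

(** The scalar bound [inv_sqrt_lip], transferred. For [B = B'] it is also the uniqueness of the
    inverse square root. *)
Lemma inv_sqrt_near (B P B' P' : 'M[C]_m) : inv_sqrt B P -> inv_sqrt B' P' ->
  fro2 (P - P') <= 4 * fro2 (B - B').
Proof.
move=> [Q [b [uQ -> hb ->]]] [Q' [b' [uQ' -> hb' ->]]].
apply: (@le_trans _ _ (4 * fro2 (sdec Q (fun j => rc C (b j)) - sdec Q' (fun j => rc C (b' j))) + m%:R * 0)); last by rewrite mulr0 addr0.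
apply: sdec_transfer => // i j.
rewrite addr0 -!rcN -!rcD !cabs_rc !real_normK ?num_real //.
exact: inv_sqrt_lip.
Qed.

Lemma inv_sqrt1 : inv_sqrt 1%:M 1%:M.
Proof.
have u1 : (1%:M : 'M[C]_m) \is unitarymx by apply/unitarymxP; rewrite trmx1 map_mx1 mulmx1.
exists 1%:M, (fun=> 1); split=> //; last by rewrite sqrtr1 invr1 rc1 sdec_const.
  by rewrite rc1 sdec_const.
by move=> _; lra.
Qed.

Lemma inv_sqrt_exists (A : 'M[C]_m) : fro2 (A^t* *m A - 1%:M) <= 1 / 4 ->
  exists P, inv_sqrt (A^t* *m A) P.
Proof.
move=> hA; have hB : (A^t* *m A)^t* = A^t* *m A.
  by rewrite trmx_mul map_mxM trmxCK.
have [Q [b [uQ eB]]] := hermitian_sdec hB; rewrite eB in hA *.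
eexists; exists Q, b; split=> // j.
move: hA; rewrite -(sdec_const 1 uQ) => hA.
have [i] := sdec_near (fun=> 1) (fun j => rc C (b j)) j uQ uQ.
rewrite -fro2N opprB -rc1 -rcN -rcD cabs_rc real_normK ?num_real // rc1 => /le_trans/(_ hA) h.
nra.
Qed.

Lemma inv_sqrt_unitary (A P : 'M[C]_m) : inv_sqrt (A^t* *m A) P -> A *m P \is unitarymx.
Proof.
move=> [Q [b [uQ eB hb eP]]]; rewrite -trmxC_unitary; apply/unitarymxP.
rewrite trmxCK trmx_mul map_mxM mulmxA -[_ *m A]mulmxA.
rewrite eB eP sdec_adj -!sdecM // -(sdec_const 1 uQ).
apply: eq_sdec => j.
have -> : (rc C (Num.sqrt (b j))^-1)^* = rc C (Num.sqrt (b j))^-1.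
  by apply: complex_ext; rewrite !reimE ?oppr0.
rewrite -!rcM -rc1; congr rc; have b0 : 0 < b j by have := hb j; lra.
rewrite -{2}[b j]sqr_sqrtr ?ltW // expr2; field.
by rewrite lt0r_neq0 // sqrtr_gt0.
Qed.

Lemma adjD (A B : 'M[C]_m) : (A + B)^t* = A^t* + B^t*.
Proof. by apply/matrixP => i j; rewrite !mxE rmorphD. Qed.

Lemma adjB (A B : 'M[C]_m) : (A - B)^t* = A^t* - B^t*.
Proof. by apply/matrixP => i j; rewrite !mxE rmorphB. Qed.

Definition lipschitz_fam (A : R -> R -> 'M[C]_m) (L : R) :=
  0 <= L /\ forall k1 k2 k1' k2' i j,
    cabs (A k1 k2 i j - A k1' k2' i j) <= L * (`|k1 - k1'| + `|k2 - k2'|).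

(** With [A = U + E], [A^* A - 1 = E^* U + U^* E + E^* E] has squared norm at most [8 e + 2 e^2],
    and [A P - U = U (P - 1) + E P]. The bound 1/40 turns [10 e] into the 1/4 required by
    [inv_sqrt_exists]. *)
Lemma polar_bounds (A P U : 'M[C]_m) (e : R) : U \is unitarymx ->
  e <= 1 / 40 -> fro2 (A - U) <= e ->
  fro2 (A^t* *m A - 1%:M) <= 10 * e /\
  (inv_sqrt (A^t* *m A) P ->
   [/\ fro2 P <= 2 * m%:R + 2, fro2 A <= 2 * m%:R + 2 & fro2 (A *m P - U) <= (240 + 4 * m%:R) * e]).
Proof.
move=> uU e1; set E := A - U => hE; have eA : A = U + E by rewrite /E addrC subrK.
have n0 : 0 <= m%:R :> R by exact: ler0n.
have E0 := fro2_ge0 E; have e0 : 0 <= e by exact: le_trans hE.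
have uU' : U^t* \is unitarymx by rewrite trmxC_unitary.
have hB : fro2 (A^t* *m A - 1%:M) <= 10 * e.
  have -> : A^t* *m A - 1%:M = (E^t* *m U + U^t* *m E) + E^t* *m E.
    rewrite eA adjD mulmxDl !mulmxDr (adj_unitaryP uU).
    move: (E^t* *m U) (U^t* *m E) (E^t* *m E) => X Y Z.
    by apply/matrixP => i j; rewrite !mxE; ring.
  apply: le_trans (fro2D _ _) _; have := fro2D (E^t* *m U) (U^t* *m E).
  rewrite fro2_unitary_r // fro2_unitary_l // fro2_adj.
  have := fro2M (E^t*) E; rewrite fro2_adj; nra.
split=> // hP.
have hP1 : fro2 (P - 1%:M) <= 40 * e.
  by have := inv_sqrt_near hP inv_sqrt1; lra.
have u1 : (1%:M : 'M[C]_m) \is unitarymx by apply/unitarymxP; rewrite trmx1 map_mx1 mulmx1.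
have hPn : fro2 P <= 2 * m%:R + 80 * e.
  by have := fro2D (P - 1%:M) 1%:M; rewrite subrK [fro2 1%:M]fro2_unitary //; lra.
split; first by lra.
  by have := fro2D U E; rewrite -eA [fro2 U]fro2_unitary //; lra.
have -> : A *m P - U = U *m (P - 1%:M) + E *m P.
  by rewrite mulmxBr mulmx1 eA mulmxDl addrAC.
apply: le_trans (fro2D _ _) _; rewrite fro2_unitary_l //.
have := fro2M E P; have : fro2 E * fro2 P <= e * (2 * m%:R + 80 * e).
  by apply: ler_pM; rewrite ?fro2_ge0.
nra.
Qed.

(** The last clause says that the polar factor depends on the value of [A] only, although [P] is
    picked by choice at each point; it transports periodicity. *)
Lemma polar_lipschitz (U A : R -> R -> 'M[C]_m) (L e : R) :
  (forall k1 k2, U k1 k2 \is unitarymx) -> lipschitz_fam A L ->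
  e <= 1 / 40 -> (forall k1 k2, fro2 (A k1 k2 - U k1 k2) <= e) ->
  exists B L', [/\ lipschitz_fam B L', forall k1 k2, B k1 k2 \is unitarymx,
    forall k1 k2, fro2 (B k1 k2 - U k1 k2) <= (240 + 4 * m%:R) * e &
    forall k1 k2 k1' k2', A k1 k2 = A k1' k2' -> B k1 k2 = B k1' k2'].
Proof.
move=> uU [L0 lA] e1 hA.
have e4 : 10 * e <= 1 / 4 by lra.
have ex (k : R * R) : exists P, inv_sqrt ((A k.1 k.2)^t* *m A k.1 k.2) P.
  apply: inv_sqrt_exists; apply: le_trans e4.
  by have [] := polar_bounds 0 (uU k.1 k.2) e1 (hA k.1 k.2).
have [P hP] := choice ex.
have bd k1 k2 := (polar_bounds (P (k1, k2)) (uU k1 k2) e1 (hA k1 k2)).2 (hP (k1, k2)).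
pose n : R := m%:R; have n0 : 0 <= n by exact: ler0n.
pose c := 2 * n + 2; have c0 : 0 <= c by rewrite /c; lra.
pose K := 2 * c + 32 * c ^+ 2.
have K0 : 0 <= K by rewrite /K addr_ge0 ?mulr_ge0 ?exprn_ge0.
have lip k1 k2 k1' k2' :
    fro2 (A k1 k2 *m P (k1, k2) - A k1' k2' *m P (k1', k2')) <= K * fro2 (A k1 k2 - A k1' k2').
  have [p1 a1 _] := bd k1 k2; have [p2 a2 _] := bd k1' k2'.
  have := inv_sqrt_near (hP (k1, k2)) (hP (k1', k2')).
  move: p1 a1 a2 => /=; set X := A k1 k2; set X' := A k1' k2'.
  set Y := P _; set Y' := P (k1', k2') => p1 a1 a2 near.
  have d0 := fro2_ge0 (X - X').
  have hBB : fro2 (X^t* *m X - X'^t* *m X') <= 4 * c * fro2 (X - X').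
    have -> : X^t* *m X - X'^t* *m X' = X^t* *m (X - X') + (X - X')^t* *m X'.
      by rewrite adjB mulmxBr mulmxBl addrA subrK.
    apply: le_trans (fro2D _ _) _.
    have := fro2M (X^t*) (X - X'); have := fro2M ((X - X')^t*) X'; rewrite !fro2_adj.
    have : fro2 X * fro2 (X - X') <= c * fro2 (X - X') by apply: ler_wpM2r.
    have : fro2 (X - X') * fro2 X' <= c * fro2 (X - X') by rewrite mulrC; apply: ler_wpM2r.
    lra.
  have -> : X *m Y - X' *m Y' = (X - X') *m Y + X' *m (Y - Y').
    by rewrite mulmxBr mulmxBl addrA subrK.
  apply: le_trans (fro2D _ _) _.
  have := fro2M (X - X') Y; have := fro2M X' (Y - Y').
  have h1 : fro2 (X - X') * fro2 Y <= c * fro2 (X - X') by rewrite mulrC; apply: ler_wpM2r.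
  have h2 : fro2 X' * fro2 (Y - Y') <= c * (4 * (4 * c * fro2 (X - X'))).
    apply: ler_pM; rewrite ?fro2_ge0 //; apply: le_trans near _.
    by apply: ler_wpM2l.
  have -> : K * fro2 (X - X') = 2 * (c * fro2 (X - X')) + 2 * (c * (4 * (4 * c * fro2 (X - X')))).
    by rewrite /K; ring.
  lra.
(* [K <= (K + 1)^2] spares the square root of [K]; the factor [n] comes from bounding the norm of a
   matrix by its entries. *)
have L'0 : 0 <= (K + 1) * n * L by rewrite !mulr_ge0 // addr_ge0.
exists (fun k1 k2 => A k1 k2 *m P (k1, k2)), ((K + 1) * n * L); split.
- split=> // k1 k2 k1' k2' i j; set d := `|_| + `|_|.
  have d0 : 0 <= d by rewrite addr_ge0.
  rewrite -ler_sqr ?nnegrE ?cabs_ge0 ?(mulr_ge0 L'0 d0) //.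
  have := entry_le_fro2 (A k1 k2 *m P (k1, k2) - A k1' k2' *m P (k1', k2')) i j.
  rewrite mxBE => /le_trans; apply; apply: le_trans (lip _ _ _ _) _.
  have h : fro2 (A k1 k2 - A k1' k2') <= (m * m)%:R * (L * d) ^+ 2.
    by apply: fro2_le_entries => i' j'; rewrite mxBE; exact: lA.
  apply: le_trans (ler_wpM2l K0 h) _; rewrite natrM -/n.
  have -> : ((K + 1) * n * L * d) ^+ 2 = (K + 1) ^+ 2 * (n * n * (L * d) ^+ 2) by ring.
  by apply: ler_wpM2r; [rewrite !mulr_ge0 ?sqr_ge0 | nra].
- by move=> k1 k2; apply: inv_sqrt_unitary; exact: (hP (k1, k2)).
- by move=> k1 k2; have [] := bd k1 k2.
move=> k1 k2 k1' k2' eqA; have := lip k1 k2 k1' k2'; rewrite eqA subrr.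
by rewrite fro2_0 mulr0 => /fro2_eq0 h; apply/eqP; rewrite -subr_eq0 h.
Qed.

End Polar.

(** * Lipschitz regularization of a real function *)

Section InfConvolution.
Variable R : realType.
Local Open Scope classical_set_scope.

Definition unif_continuous2 (f : R -> R -> R) := forall e, 0 < e -> exists2 d, 0 < d &
  forall k1 k2 l1 l2, `|k1 - l1| < d -> `|k2 - l2| < d -> `|f k1 k2 - f l1 l2| < e.

Definition inf_conv (L : R) (f : R -> R -> R) (k1 k2 : R) : R :=
  inf [set x | exists l1 l2, x = f l1 l2 + L * (`|k1 - l1| + `|k2 - l2|)].

Section Bounded.
Variables (f : R -> R -> R) (L : R).
Hypothesis f1 : forall k1 k2, `|f k1 k2| <= 1.
Hypothesis L0 : 0 <= L.

Let S k1 k2 := [set x | exists l1 l2, x = f l1 l2 + L * (`|k1 - l1| + `|k2 - l2|)].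

Lemma inf_conv_has_inf k1 k2 : has_inf (S k1 k2).
Proof.
split; first by exists (f 0 0 + L * (`|k1 - 0| + `|k2 - 0|)), 0, 0.
exists (-1) => x [l1 [l2 ->]]; have := f1 l1 l2; rewrite ler_norml => /andP[h _].
by rewrite -[-1]addr0 lerD // mulr_ge0 // addr_ge0.
Qed.

Lemma inf_conv_le k1 k2 l1 l2 :
  inf_conv L f k1 k2 <= f l1 l2 + L * (`|k1 - l1| + `|k2 - l2|).
Proof.
by apply: ge_inf; [have [] := inf_conv_has_inf k1 k2 | exists l1, l2].
Qed.

Lemma inf_conv_ge k1 k2 c :
  (forall l1 l2, c <= f l1 l2 + L * (`|k1 - l1| + `|k2 - l2|)) -> c <= inf_conv L f k1 k2.
Proof.
move=> h; apply: lb_le_inf; first by have [] := inf_conv_has_inf k1 k2.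
by move=> x [l1 [l2 ->]].
Qed.

Lemma inf_conv_lipschitz k1 k2 k1' k2' :
  `|inf_conv L f k1 k2 - inf_conv L f k1' k2'| <= L * (`|k1 - k1'| + `|k2 - k2'|).
Proof.
have h a1 a2 b1 b2 : inf_conv L f a1 a2 - L * (`|a1 - b1| + `|a2 - b2|) <= inf_conv L f b1 b2.
  apply: inf_conv_ge => l1 l2; rewrite lerBlDr; apply: le_trans (inf_conv_le a1 a2 l1 l2) _.
  rewrite -addrA lerD2l -mulrDr; apply: ler_wpM2l => //.
  by have := ler_distD b1 a1 l1; have := ler_distD b2 a2 l2; lra.
have := h k1 k2 k1' k2'; have := h k1' k2' k1 k2.
rewrite [`|k1' - _|]distrC [`|k2' - _|]distrC ler_norml; lra.
Qed.

(** A point farther than [d] costs at least [L * d >= 2], the largest possible oscillation of [f],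
    so only points where [f] is within [e] can lower the infimum. *)
Lemma inf_conv_near (e d : R) : 0 < d -> 2 <= L * d ->
  (forall k1 k2 l1 l2, `|k1 - l1| < d -> `|k2 - l2| < d -> `|f k1 k2 - f l1 l2| < e) ->
  forall k1 k2, `|inf_conv L f k1 k2 - f k1 k2| <= e.
Proof.
move=> d0 Ld hd k1 k2; have e0 : 0 <= e.
  by apply: ltW; apply: le_lt_trans (hd k1 k2 k1 k2 _ _); rewrite ?subrr ?normr0.
have h1 := inf_conv_le k1 k2 k1 k2; rewrite !subrr normr0 addr0 mulr0 addr0 in h1.
have h2 : f k1 k2 - e <= inf_conv L f k1 k2.
  apply: inf_conv_ge => l1 l2.
  have t0 : 0 <= L * (`|k1 - l1| + `|k2 - l2|) by rewrite mulr_ge0 ?addr_ge0.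
  case: (ltP `|k1 - l1| d) => [c1|c1]; last first.
    have : L * d <= L * (`|k1 - l1| + `|k2 - l2|).
      by apply: ler_wpM2l => //; have := normr_ge0 (k2 - l2); lra.
    by have := f1 k1 k2; have := f1 l1 l2; rewrite !ler_norml => /andP[? ?] /andP[? ?]; lra.
  case: (ltP `|k2 - l2| d) => [c2|c2]; last first.
    have : L * d <= L * (`|k1 - l1| + `|k2 - l2|).
      by apply: ler_wpM2l => //; have := normr_ge0 (k1 - l1); lra.
    by have := f1 k1 k2; have := f1 l1 l2; rewrite !ler_norml => /andP[? ?] /andP[? ?]; lra.
  by have := hd _ _ _ _ c1 c2; rewrite ltr_norml => /andP[? ?]; lra.
rewrite ler_norml; lra.
Qed.

Lemma inf_conv_translate t1 t2 : (forall k1 k2, f (k1 + t1) (k2 + t2) = f k1 k2) ->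
  forall k1 k2, inf_conv L f (k1 + t1) (k2 + t2) = inf_conv L f k1 k2.
Proof.
move=> ft k1 k2; apply/eqP; rewrite eq_le; apply/andP; split; apply: inf_conv_ge => l1 l2.
  apply: le_trans (inf_conv_le _ _ (l1 + t1) (l2 + t2)) _.
  by rewrite ft !opprD ![_ + t1 + _]addrACA ![_ + t2 + _]addrACA !subrr !addr0.
apply: le_trans (inf_conv_le _ _ (l1 - t1) (l2 - t2)) _.
rewrite -(ft (l1 - t1)) !subrK.
have e k l t : k - (l - t) = k + t - l :> R by ring.
by rewrite !e.
Qed.

End Bounded.

Lemma lipschitz_approx (f : R -> R -> R) (e : R) : 0 < e ->
  (forall k1 k2, `|f k1 k2| <= 1) -> unif_continuous2 f ->
  exists2 L0, 0 <= L0 & forall L, L0 <= L ->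
    forall k1 k2, `|inf_conv L f k1 k2 - f k1 k2| <= e.
Proof.
move=> e0 f1 /(_ e e0)[d d0 hd].
have L0 : 0 <= 2 / d by rewrite divr_ge0 // ltW.
exists (2 / d) => // L hL; have L0' := le_trans L0 hL.
by apply: (inf_conv_near f1 L0' d0) => //; rewrite -ler_pdivrMr.
Qed.

End InfConvolution.

(** * Approximation by a Lipschitz family with simple spectrum *)

Section ApproxSimple.
Variables (R : realType) (C : complexModel R) (m : nat).

Definition int_periodic (A : R -> R -> 'M[C]_m) := forall (z1 z2 : int) k1 k2,
  A (k1 + z1%:~R) (k2 + z2%:~R) = A k1 k2.

Definition unif_continuous_fam (A : R -> R -> 'M[C]_m) := forall i j,
  unif_continuous2 (fun k1 k2 => re (A k1 k2 i j)) /\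
  unif_continuous2 (fun k1 k2 => im (A k1 k2 i j)).

Lemma exists_simple_approx (U : R -> R -> 'M[C]_m) (e : R) : 0 < e ->
  (forall k1 k2, U k1 k2 \is unitarymx) -> int_periodic U -> unif_continuous_fam U ->
  exists B L, [/\ lipschitz_fam B L, forall k1 k2, B k1 k2 \is unitarymx,
    forall k1 k2, fro2 (B k1 k2 - U k1 k2) <= e, int_periodic B &
    forall k1 k2, simple (B k1 k2)].
Proof.
move=> e0 uU pU cU; pose n : R := m%:R; have n0 : 0 <= n by exact: ler0n.
have q0 : 0 < 240 + 4 * n by lra.
(* 1/40 is required by [polar_lipschitz], whose loss is the factor [240 + 4 * n]; the division by 4
   leaves room for the multiplication by [g]. *)
pose e1 := Num.min (1 / 40) (e / (240 + 4 * n) / 4).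
have e10 : 0 < e1 by rewrite lt_min; apply/andP; split; [lra | rewrite !divr_gt0].
have e1le : e1 <= 1 / 40 by rewrite ge_min lexx.
have e1e : (240 + 4 * n) * e1 <= e / 4.
  have : e1 <= e / (240 + 4 * n) / 4 by rewrite ge_min lexx orbT.
  by rewrite mulrAC ler_pdivlMr // mulrC.
pose e2 := Num.min 1 (e1 / (4 * (n * n + 1))).
have nn0 : 0 < 4 * (n * n + 1) by nra.
have e20 : 0 < e2 by rewrite lt_min ltr01 divr_gt0.
have reU i j k1 k2 : `|re (U k1 k2 i j)| <= 1.
  by apply: le_trans (normr_re_le _) _; exact: unitary_entry.
have imU i j k1 k2 : `|im (U k1 k2 i j)| <= 1.
  by apply: le_trans (normr_im_le _) _; exact: unitary_entry.
have ex (ij : 'I_m * 'I_m) : exists L0, 0 <= L0 /\ forall L, L0 <= L -> forall k1 k2,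
   `|inf_conv L (fun k1 k2 => re (U k1 k2 ij.1 ij.2)) k1 k2 - re (U k1 k2 ij.1 ij.2)| <= e2 /\
   `|inf_conv L (fun k1 k2 => im (U k1 k2 ij.1 ij.2)) k1 k2 - im (U k1 k2 ij.1 ij.2)| <= e2.
  have [cr ci] := cU ij.1 ij.2.
  have [La La0 ha] := lipschitz_approx e20 (reU ij.1 ij.2) cr.
  have [Lb Lb0 hb] := lipschitz_approx e20 (imU ij.1 ij.2) ci.
  exists (La + Lb); split; first exact: addr_ge0.
  by move=> L hL k1 k2; split; [apply: ha | apply: hb]; lra.
have [Lf hLf] := choice ex; pose L := \sum_ij Lf ij.
have L0 : 0 <= L by apply: sumr_ge0 => ij _; have [] := hLf ij.
have LfL ij : Lf ij <= L.
  by rewrite /L (bigD1 ij) //= lerDl; apply: sumr_ge0 => kl _; have [] := hLf kl.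
pose A k1 k2 : 'M[C]_m := \matrix_(i, j)
  mkC C (inf_conv L (fun k1 k2 => re (U k1 k2 i j)) k1 k2)
        (inf_conv L (fun k1 k2 => im (U k1 k2 i j)) k1 k2).
have lipA : lipschitz_fam A (2 * L).
  split; first by rewrite mulr_ge0.
  move=> k1 k2 k1' k2' i j; rewrite !mxE; apply: le_trans (cabs_le_reim _) _.
  rewrite !reimE -mulrA mulr_natl mulr2n.
  by apply: lerD; apply: inf_conv_lipschitz.
have nearA k1 k2 : fro2 (A k1 k2 - U k1 k2) <= e1.
  have : fro2 (A k1 k2 - U k1 k2) <= (m * m)%:R * (2 * e2) ^+ 2.
    apply: fro2_le_entries => i j; rewrite !mxE; apply: le_trans (cabs_le_reim _) _.
    rewrite !reimE mulr_natl mulr2n.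
    by have [h1 h2] := (hLf (i, j)).2 L (LfL (i, j)) k1 k2; apply: lerD.
  have h1 : e2 <= 1 by rewrite ge_min lexx.
  have : e2 <= e1 / (4 * (n * n + 1)) by rewrite ge_min lexx orbT.
  rewrite ler_pdivlMr // natrM -/n => h2.
  have h3 : e2 ^+ 2 <= e2 by rewrite expr2 ler_piMr // ltW.
  have : n * n * (2 * e2) ^+ 2 <= 4 * (n * n) * e2.
    have -> : n * n * (2 * e2) ^+ 2 = 4 * (n * n) * e2 ^+ 2 by ring.
    by apply: ler_wpM2l => //; rewrite !mulr_ge0.
  nra.
have [B [L' [[L'0 lipB] uB nearB AB]]] := polar_lipschitz uU lipA e1le nearA.
have pA : int_periodic A.
  move=> z1 z2 k1 k2; apply/matrixP => i j; rewrite !mxE.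
  by congr mkC; apply: inf_conv_translate => // *; rewrite pU.
have pB : int_periodic B by move=> z1 z2 k1 k2; apply: AB; exact: pA.
pose r := e / (4 * (n + 1)).
have n1 : 0 < 4 * (n + 1) by lra.
have r0 : 0 < r by rewrite divr_gt0.
have [g [ug gr gs]] := exists_simple_perturbation L'0 uB lipB r0.
exists (fun k1 k2 => g *m B k1 k2), (n * L'); split.
- split; first exact: mulr_ge0.
  move=> k1 k2 k1' k2' i j; rewrite -mxBE -mulmxBr -mulrA.
  rewrite mxE; apply: le_trans (cabs_sum _ _ _) _.
  set d := L' * _; have -> : n * d = \sum_(k < m) 1 * d.
    by rewrite mul1r sumr_const card_ord mulr_natl.
  apply: ler_sum => k _; rewrite cabsM; apply: ler_pM; rewrite ?cabs_ge0 //.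
    exact: unitary_entry.
  by rewrite mxBE; exact: lipB.
- by move=> k1 k2; apply: mul_unitarymx.
- move=> k1 k2.
  have -> : g *m B k1 k2 - U k1 k2 = (g - 1%:M) *m B k1 k2 + (B k1 k2 - U k1 k2).
    by rewrite mulmxBl mul1mx addrA subrK.
  apply: le_trans (fro2D _ _) _; rewrite fro2_unitary_r //.
  have : r <= e / 4.
    rewrite /r invfM mulrA ler_pdivrMr; last by lra.
    by rewrite ler_peMr //; lra.
  by have := nearB k1 k2; rewrite -/n; lra.
- by move=> z1 z2 k1 k2; rewrite pB.
(* [g] is known to be good on the unit square only; subtracting integer parts brings every point
   there. *)
move=> k1 k2; rewrite -(pB (- Num.floor k1) (- Num.floor k2)); apply: gs.
  rewrite rmorphN /= subr_ge0 ge_floor //= lerBlDr addrC.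
  by have := floorD1_gt k1; rewrite intrD => /ltW.
rewrite rmorphN /= subr_ge0 ge_floor //= lerBlDr addrC.
by have := floorD1_gt k2; rewrite intrD => /ltW.
Qed.

End ApproxSimple.

(** * A rational coordinate on the circle, change of cut, midpoints *)

Section CayleyCircle.
Variables (R : realType) (C : complexModel R).
Implicit Types (x y z : R) (a b mu : C).

(** [x] is minus the cotangent of half the argument: the line runs once counterclockwise round the
    circle, from the cut at 1 back to it. This replaces the logarithm by a rational function. *)
Definition cay x : C := (rc C x - ic C) / (rc C x + ic C).

Lemma cay_den x : rc C x + ic C != 0.
Proof.
apply/eqP => /(congr1 (@im R C)); rewrite !reimE => /eqP.
by rewrite add0r oner_eq0.
Qed.

Lemma cayM x : cay x * (rc C x + ic C) = rc C x - ic C.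
Proof. by rewrite divfK // cay_den. Qed.

Lemma cabs_cay_den x : cabs (rc C x + ic C) ^+ 2 = x ^+ 2 + 1.
Proof. by rewrite sqr_cabsE !reimE; ring. Qed.

Lemma cabs_cay x : cabs (cay x) = 1.
Proof.
rewrite cabsM cabsV; have -> : cabs (rc C x - ic C) = cabs (rc C x + ic C).
  by rewrite /cabs !reimE; congr Num.sqrt; ring.
by rewrite divff // cabs_eq0 cay_den.
Qed.

Lemma cay_dist x y :
  cabs (cay x - cay y) ^+ 2 * ((x ^+ 2 + 1) * (y ^+ 2 + 1)) = 4 * (x - y) ^+ 2.
Proof.
rewrite -!cabs_cay_den -!exprMn -!cabsM.
have -> : (cay x - cay y) * ((rc C x + ic C) * (rc C y + ic C)) =
  rc C 2 * (rc C (x - y) * ic C).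
  have -> : (cay x - cay y) * ((rc C x + ic C) * (rc C y + ic C)) =
    (cay x * (rc C x + ic C)) * (rc C y + ic C) - (cay y * (rc C y + ic C)) * (rc C x + ic C) by ring.
  by rewrite !cayM; apply: complex_ext; rewrite !reimE; ring.
by rewrite !cabsM !cabs_rc cabs_ic mulr1 exprMn !real_normK ?num_real //; ring.
Qed.

Lemma sqr1_gt0 x : 0 < x ^+ 2 + 1.
Proof. by rewrite ltr_wpDl ?sqr_ge0. Qed.

Lemma cay_dist_le x y : cabs (cay x - cay y) ^+ 2 <= 4 * (x - y) ^+ 2.
Proof.
rewrite -cay_dist ler_peMr ?sqr_ge0 //.
have := sqr_ge0 x; have := sqr_ge0 y; nra.
Qed.

Lemma cay_dist_ge x y (M : R) : x ^+ 2 + 1 <= M -> y ^+ 2 + 1 <= M ->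
  (x - y) ^+ 2 <= M ^+ 2 / 4 * cabs (cay x - cay y) ^+ 2.
Proof.
move=> hx hy; have := cay_dist x y.
have : (x ^+ 2 + 1) * (y ^+ 2 + 1) <= M * M.
  by apply: ler_pM => //; apply: ltW; exact: sqr1_gt0.
move/(ler_wpM2l (sqr_ge0 (cabs (cay x - cay y)))); rewrite expr2; lra.
Qed.

Lemma cay_inj : injective cay.
Proof.
move=> x y e; have := cay_dist x y; rewrite e subrr cabs0 expr0n mul0r => /esym/eqP.
by rewrite mulf_eq0 pnatr_eq0 /= sqrf_eq0 subr_eq0 => /eqP.
Qed.

(** The limit of [cay_dist] as [y] tends to infinity: bounding the coordinate amounts to staying
    away from the cut. *)
Lemma cay_dist1 x : cabs (cay x - 1) ^+ 2 * (x ^+ 2 + 1) = 4.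
Proof.
rewrite -cabs_cay_den -exprMn -cabsM mulrBl cayM mul1r.
have -> : rc C x - ic C - (rc C x + ic C) = rc C 2 * - ic C.
  by apply: complex_ext; rewrite !reimE; ring.
by rewrite cabsM cabsN cabs_ic mulr1 cabs_rc real_normK ?num_real //; ring.
Qed.

Lemma cay_neq1 x : cay x != 1.
Proof.
apply/eqP => e; have := cay_dist1 x; rewrite e subrr cabs0 expr0n mul0r.
by move/esym/eqP; rewrite pnatr_eq0.
Qed.

Lemma cay_surj a : cabs a = 1 -> a != 1 -> exists x, a = cay x.
Proof.
move=> a1 an1; have e := sqr_cabsE a; rewrite a1 expr1n in e.
have r1 : re a != 1.
  apply: contra an1 => /eqP h; apply/eqP; apply: complex_ext; rewrite ?h ?reimE //.
  move: e; rewrite h expr1n => /eqP; rewrite -subr_eq0 opprD addrA subrr add0r oppr_eq0 sqrf_eq0.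
  by move/eqP.
have r10 : 1 - re a != 0 by rewrite subr_eq0 eq_sym.
exists (- im a / (1 - re a)); set x := _ / _.
have hx : x * (1 - re a) = - im a by rewrite divfK.
apply: (mulIf (cay_den x)); rewrite cayM.
apply: complex_ext; rewrite !reimE; first by lra.
have : im a ^+ 2 = (1 + re a) * (1 - re a) by lra.
move=> e2; apply: (mulIf r10).
have : im a * (x * (1 - re a)) = - ((1 + re a) * (1 - re a)) by rewrite hx -e2; ring.
lra.
Qed.

(* The coordinate of [cay x] after moving the cut of the circle from [1] to [cay z]. *)
Definition recut (z x : R) := (1 + x * z) / (z - x).

Lemma cay_recut z x : x != z -> cay x = cay z * cay (recut z x).
Proof.
move=> xz; have d0 : z - x != 0 by rewrite subr_eq0 eq_sym.
apply: (mulIf (cay_den x)); apply: (mulIf (cay_den z)); apply: (mulIf (cay_den (recut z x))).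
rewrite cayM.
have -> : cay z * cay (recut z x) * (rc C x + ic C) * (rc C z + ic C) * (rc C (recut z x) + ic C) =
  (cay z * (rc C z + ic C)) * (cay (recut z x) * (rc C (recut z x) + ic C)) * (rc C x + ic C) by ring.
have h : recut z x * (z - x) = 1 + x * z by rewrite divfK.
rewrite !cayM; apply: complex_ext; rewrite !reimE.
  move: h; move: (recut z x) => t h.
  have : t * z = t * x + 1 + x * z by lra.
  lra.
move: h; move: (recut z x) => t h; lra.
Qed.

(** The difference of the new coordinates is [(x2 - x1) (z^2 + 1) / ((z - x1) (z - x2))]: the order
    is reversed exactly when [z] separates the two points. *)
Lemma recut_lt z x1 x2 : x1 != z -> x2 != z ->
  (recut z x1 < recut z x2) = if (x1 < z) == (x2 < z) then x1 < x2 else z < x1.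
Proof.
move=> h1 h2; rewrite -subr_gt0.
have d1 : z - x1 != 0 by rewrite subr_eq0 eq_sym.
have d2 : z - x2 != 0 by rewrite subr_eq0 eq_sym.
have -> : recut z x2 - recut z x1 = ((x2 - x1) * (z ^+ 2 + 1)) / ((z - x1) * (z - x2)).
  by rewrite /recut; field; rewrite d1 d2.
have z1 := sqr1_gt0 z; set D := (z - x1) * (z - x2).
have Dp : 0 < D -> (0 < (x2 - x1) * (z ^+ 2 + 1) / D) = (x1 < x2).
  by move=> D0; rewrite pmulr_lgt0 ?invr_gt0 // pmulr_lgt0 // subr_gt0.
have Dn : D < 0 -> (0 < (x2 - x1) * (z ^+ 2 + 1) / D) = (x2 < x1).
  by move=> D0; rewrite nmulr_lgt0 ?invr_lt0 // pmulr_llt0 // subr_lt0.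
have [s1|s1|e] := ltgtP x1 z; last by rewrite e eqxx in h1.
  have [s2|s2|e] := ltgtP x2 z; last by rewrite e eqxx in h2.
    by rewrite Dp // mulr_gt0 ?subr_gt0.
  rewrite Dn /=; first by apply/negbTE; rewrite -leNgt ltW // (lt_trans s1).
  by rewrite pmulr_rlt0 ?subr_gt0 // subr_lt0.
have [s2|s2|e] := ltgtP x2 z; last by rewrite e eqxx in h2.
  rewrite Dn /=; first exact: lt_trans s2 s1.
  by rewrite nmulr_rlt0 ?subr_lt0 // subr_gt0.
by rewrite Dp // nmulr_rgt0 ?subr_lt0.
Qed.

(** The middle of the shorter arc between two unit numbers. For antipodal ones the division by 0
    gives 0, hence the conditions on [a + b] in what follows. *)
Definition midpoint a b : C := (a + b) / rc C (cabs (a + b)).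

Lemma midpointC a b : midpoint a b = midpoint b a.
Proof. by rewrite /midpoint addrC. Qed.

Lemma cabs_midpoint a b : a + b != 0 -> cabs (midpoint a b) = 1.
Proof.
move=> h; have c0 : cabs (a + b) != 0 by rewrite cabs_eq0.
by rewrite cabsM cabsV cabs_rc ger0_norm ?cabs_ge0 // divff.
Qed.

Lemma midpoint_id a : cabs a = 1 -> midpoint a a = a.
Proof.
move=> a1; have -> : midpoint a a = (a * rc C 2) / rc C (cabs (a * rc C 2)).
  by rewrite /midpoint; have -> : a + a = a * rc C 2; rewrite // [2]mulr2n rcD rc1; ring.
rewrite cabsM a1 mul1r cabs_rc ger0_norm // mulfK //.
by rewrite -rc0 (inj_eq (@rc_inj R C)) pnatr_eq0.
Qed.

Lemma cabs_dist_dist a b : `|cabs a - cabs b| <= cabs (a - b).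
Proof.
have := cabsD (a - b) b; have := cabsD (b - a) a; rewrite !subrK cabsBC.
rewrite ler_norml; lra.
Qed.

Lemma midpoint_lipschitz a b a' b' : 1 <= cabs (a + b) -> a' + b' != 0 ->
  cabs (midpoint a b - midpoint a' b') <= 2 * (cabs (a - a') + cabs (b - b')).
Proof.
move=> h h'; set s := a + b in h *; set s' := a' + b' in h' *.
have s0 : 0 < cabs s by lra.
have s0' : 0 < cabs s' by rewrite cabs_gt0.
have n0 x : 0 < x -> rc C x != 0.
  by move=> x0; rewrite -rc0 (inj_eq (@rc_inj R C)) lt0r_neq0.
have hs : cabs (s - s') <= cabs (a - a') + cabs (b - b').
  by apply: le_trans (cabsD _ _); rewrite /s /s' opprD addrACA.
apply: le_trans (ler_wpM2l _ hs) => //.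
rewrite /midpoint -/s -/s'.
have -> : s / rc C (cabs s) - s' / rc C (cabs s') =
  ((s - s') + s' / rc C (cabs s') * (rc C (cabs s') - rc C (cabs s))) / rc C (cabs s).
  by field; rewrite !n0.
rewrite cabsM cabsV cabs_rc ger0_norm ?cabs_ge0 // ler_pdivrMr //.
apply: le_trans (cabsD _ _) _.
have h1 : cabs (s' / rc C (cabs s') * (rc C (cabs s') - rc C (cabs s))) <= cabs (s - s').
  rewrite cabsM -rcN -rcD cabs_rc cabs_midpoint // mul1r distrC.
  exact: cabs_dist_dist.
have := cabs_ge0 (s - s').
nra.
Qed.

Lemma parallelogram a b : cabs a = 1 -> cabs b = 1 ->
  cabs (a + b) ^+ 2 = 4 - cabs (a - b) ^+ 2.
Proof.
move=> a1 b1; have := sqr_cabsE a; have := sqr_cabsE b; rewrite a1 b1 expr1n.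
by rewrite !sqr_cabsE !reimE; lra.
Qed.

Lemma cayD x y : (cay x + cay y) * ((rc C x + ic C) * (rc C y + ic C)) = rc C (2 * (x * y + 1)).
Proof.
have -> : (cay x + cay y) * ((rc C x + ic C) * (rc C y + ic C)) =
    (cay x * (rc C x + ic C)) * (rc C y + ic C) + (cay y * (rc C y + ic C)) * (rc C x + ic C) by ring.
by rewrite !cayM; apply: complex_ext; rewrite !reimE; ring.
Qed.

(* The argument of [midpoint (cay x) (cay y)] is a strictly monotone function of
   [x] and [y], so midpoints of two pairs ordered the same way never collide. *)
Lemma midpoint_neq mu x y x' y' : mu != 0 -> (x - y) ^+ 2 < 4 -> (x' - y') ^+ 2 < 4 ->
  x < x' -> y < y' ->
  midpoint (mu * cay x) (mu * cay y) != midpoint (mu * cay x') (mu * cay y').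
Proof.
move=> mu0 hxy hxy' lx ly; apply/eqP.
have pos1 (u v : R) : (u - v) ^+ 2 < 4 -> 0 < u * v + 1.
  have -> : u * v + 1 = ((u + v) ^+ 2 + (4 - (u - v) ^+ 2)) / 4 by field.
  by have := sqr_ge0 (u + v); lra.
have p0 := pos1 _ _ hxy; have p0' := pos1 _ _ hxy'.
have n0 z : 0 < z -> rc C z != 0.
  by move=> z0; rewrite -rc0 (inj_eq (@rc_inj R C)) lt0r_neq0.
have pos u v : 0 < u * v + 1 -> exists2 t, 0 < t &
    midpoint (mu * cay u) (mu * cay v) * ((rc C u + ic C) * (rc C v + ic C)) = mu * rc C t.
  move=> uv; have s0 : 0 < cabs (mu * cay u + mu * cay v).
    rewrite cabs_gt0 -mulrDr mulf_neq0 //; apply/eqP => e.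
    have := cayD u v; rewrite e mul0r => /esym/eqP; apply/negP; apply: n0; lra.
  exists (2 * (u * v + 1) / cabs (mu * cay u + mu * cay v)); first by rewrite divr_gt0 //; lra.
  rewrite /midpoint; apply: (mulIf (n0 _ s0)).
  rewrite mulrAC divfK ?n0 // -[in LHS]mulrDr -[LHS]mulrA cayD.
  by rewrite -[RHS]mulrA -rcM divfK // lt0r_neq0.
have [t t0 ht] := pos _ _ p0; have [t' t0' ht'] := pos _ _ p0'.
move=> e; rewrite e in ht.
have : mu * (rc C t * ((rc C x' + ic C) * (rc C y' + ic C))) =
       mu * (rc C t' * ((rc C x + ic C) * (rc C y + ic C))).
  by rewrite !mulrA -ht -ht'; ring.
move/(mulfI mu0) => h.
have := congr1 (@re R C) h; have := congr1 (@im R C) h; rewrite !reimE => hi hr.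
have e1 : t * (x' + y') = t' * (x + y) by lra.
have e2 : t * (x' * y' - 1) = t' * (x * y - 1) by lra.
(* [(p - i s) (q - i r)] is [(x' + i) (y' + i)] times the conjugate of [(x + i) (y + i)], so it
   would be a positive real: [p r + q s = 0] and [p q > s r > 0], which is impossible. *)
pose p := x * x' + 1; pose q := y * y' + 1; pose s := x' - x; pose r := y' - y.
have s0 : 0 < s by rewrite /s; lra.
have r0 : 0 < r by rewrite /r; lra.
have i0 : t * (p * r + q * s) = 0.
  have -> : t * (p * r + q * s) =
      (x + y) * (t * (x' * y' - 1)) - (x * y - 1) * (t * (x' + y')).
    by rewrite /p /q /r /s; ring.
  by rewrite e1 e2; ring.
have re0 : 0 < t * (p * q - s * r).
  have -> : t * (p * q - s * r) =
      (x * y - 1) * (t * (x' * y' - 1)) + (x + y) * (t * (x' + y')).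
    by rewrite /p /q /r /s; ring.
  rewrite e1 e2; have -> : (x * y - 1) * (t' * (x * y - 1)) + (x + y) * (t' * (x + y)) =
    t' * ((x ^+ 2 + 1) * (y ^+ 2 + 1)) by ring.
  by rewrite !mulr_gt0 ?sqr1_gt0.
move/eqP: i0; rewrite mulf_eq0 gt_eqF //= => /eqP i0.
rewrite pmulr_rgt0 // subr_gt0 in re0.
have sr : 0 < s * r by exact: mulr_gt0.
have : 0 < (p * r) * (q * s).
  have -> : p * r * (q * s) = p * q * (s * r) by ring.
  by apply: mulr_gt0 => //; lra.
have -> : p * r = - (q * s) by lra.
by rewrite mulNr -expr2 oppr_gt0 ltNge sqr_ge0.
Qed.

End CayleyCircle.

(** * Ranks and sorted families *)

Section Rank.
Variables (R : realType) (m : nat).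

Lemma card_ord_lt (l : 'I_m) : #|[set i : 'I_m | (i < l)%N]| = l.
Proof.
have -> : [set i : 'I_m | (i < l)%N] = widen_ord (ltnW (ltn_ord l)) @: [set: 'I_l].
  apply/setP => i; rewrite !inE; apply/idP/imsetP => [il|[j _ ->]]; last exact: (ltn_ord j).
  by exists (Ordinal il) => //; apply: val_inj.
rewrite card_imset ?cardsT ?card_ord // => i j /(congr1 val) e.
exact: val_inj.
Qed.

Lemma rank_bij (s : 'I_m -> 'I_m) j : injective s -> #|[set i | (s i < s j)%N]| = s j.
Proof.
move=> inj; rewrite -[RHS]card_ord_lt -(card_imset _ inj); apply: eq_card => l.
have [s' _ s's] := injF_bij inj.
rewrite inE; apply/imsetP/idP => [[i + ->]|h]; first by rewrite inE.
by exists (s' l); rewrite ?inE s's.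
Qed.

(** A permutation of ['I_m] is determined by the order of its values, since [s j] counts the [i]
    with [s i < s j]. *)
Lemma same_rank (s s' : 'I_m -> 'I_m) : injective s -> injective s' ->
  (forall i j, (s i < s j)%N = (s' i < s' j)%N) -> s =1 s'.
Proof.
move=> i1 i2 h j; apply: val_inj; rewrite /= -(rank_bij _ i1) -(rank_bij _ i2).
by apply: eq_card => i; rewrite !inE h.
Qed.

Definition increasing (x : 'I_m -> R) := forall i j : 'I_m, (i < j)%N -> x i < x j.

Lemma increasing_lt x i j : increasing x -> (x i < x j) = (i < j)%N.
Proof.
move=> h; have [/h->//|/h ji|/val_inj->] := ltngtP i j; last by rewrite ltxx.
by apply/negbTE; rewrite -leNgt ltW.
Qed.

Lemma increasing_le x : increasing x -> {homo x : i j / (i <= j)%N >-> i <= j}.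
Proof.
move=> h i j; rewrite leq_eqVlt => /orP[/eqP/val_inj->//|/h]; exact: ltW.
Qed.

Lemma increasing_inj x : increasing x -> injective x.
Proof.
move=> h i j e; have := increasing_lt i j h; have := increasing_lt j i h.
by rewrite e ltxx; case: ltngtP => // /val_inj.
Qed.

Lemma sort_family (x : 'I_m -> R) : injective x ->
  exists s : 'I_m -> 'I_m, injective s /\ increasing (fun i => x (s i)).
Proof.
move=> inj; pose r := sort (relpre x <=%R) (enum 'I_m).
have szr : size r = m by rewrite size_sort size_enum_ord.
have ur : uniq r by rewrite sort_uniq enum_uniq.
have sr : sorted (relpre x <=%R) r by apply: sort_sorted => i j /=; exact: le_total.
exists (fun i => nth i r i); split=> [i j|i j ij] /=.
  rewrite (set_nth_default j) ?szr // => /eqP.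
  by rewrite nth_uniq ?szr // => /eqP/val_inj.
rewrite (set_nth_default i j) ?szr // lt_neqAle; apply/andP; split.
  by rewrite (inj_eq inj) nth_uniq ?szr // ltn_eqF.
have tr : transitive (relpre x <=%R) by move=> a b c /=; exact: le_trans.
by apply: (sorted_ltn_nth tr i sr) => //; rewrite inE szr.
Qed.

End Rank.

(** * Cuts of the circle and ordered spectra *)

Section Cuts.
Variables (R : realType) (C : complexModel R) (m : nat).

Definition unit_gap : R := (1 + 4 * m%:R ^+ 2)^-1.

(** Pigeonhole: the [2 m + 1] points [cay 0], ..., [cay (2 m)] are at least [2 * unit_gap] apart, so
    each of the [2 m] eigenvalues spoils at most one of them. *)
Lemma exists_cut (a b : 'I_m -> C) : exists2 mu : C, cabs mu = 1 &
  forall j, unit_gap <= cabs (a j - mu) /\ unit_gap <= cabs (b j - mu).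
Proof.
apply: contrapT => hN.
have g0 : 0 < 1 + 4 * m%:R ^+ 2 :> R by rewrite ltr_wpDr // mulr_ge0 ?sqr_ge0.
pose pt (s : 'I_m + 'I_m) := match s with inl j => a j | inr j => b j end.
have bad (i : 'I_(m + m).+1) : exists s, cabs (pt s - cay C i%:R) < unit_gap.
  apply: contrapT => hi; apply: hN; exists (cay C i%:R); first exact: cabs_cay.
  move=> j; split; rewrite leNgt; apply/negP => h; apply: hi.
    by exists (inl j).
  by exists (inr j).
have [f hf] := choice bad.
have inj : injective f.
  move=> i i' e; apply: val_inj; apply: contrapT => /eqP ne.
  have h1 := hf i; have h2 := hf i'; rewrite -e in h2.
  have : cabs (cay C i%:R - cay C i'%:R) < 2 * unit_gap.
    have -> : cay C i%:R - cay C i'%:R = (pt (f i) - cay C i'%:R) - (pt (f i) - cay C i%:R) by ring.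
    by have := cabsB (pt (f i) - cay C i'%:R) (pt (f i) - cay C i%:R); lra.
  rewrite -ltr_sqr ?nnegrE ?cabs_ge0 //; last by rewrite mulr_ge0 // invr_ge0 ltW.
  have := cay_dist C i%:R i'%:R.
  have im (k : 'I_(m + m).+1) : (k%:R : R) ^+ 2 + 1 <= 1 + 4 * m%:R ^+ 2.
    have : k%:R <= 2 * m%:R :> R by rewrite mulr_natl mulr2n -natrD ler_nat -ltnS.
    have : 0 <= k%:R :> R by exact: ler0n.
    by move: (k%:R) => t t0 tm; nra.
  have ii : 1 <= (i%:R - i'%:R : R) ^+ 2.
    have [lt|lt|e2] := ltngtP (i : nat) i'; last by rewrite /= e2 eqxx in ne.
      have : i%:R + 1 <= i'%:R :> R by rewrite natr1 ler_nat.
      by nra.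
    have : i'%:R + 1 <= i%:R :> R by rewrite natr1 ler_nat.
    by nra.
  set D := cabs _ ^+ 2 => eD lt.
  have D0 : 0 <= D by exact: sqr_ge0.
  have : D * (((i%:R : R) ^+ 2 + 1) * ((i'%:R : R) ^+ 2 + 1)) <= D * ((1 + 4 * m%:R ^+ 2) * (1 + 4 * m%:R ^+ 2)).
    apply: ler_wpM2l => //; apply: ler_pM; rewrite ?im //; apply: ltW; exact: sqr1_gt0.
  rewrite eD; have : D * ((1 + 4 * m%:R ^+ 2) * (1 + 4 * m%:R ^+ 2)) < 4.
    have := lt; rewrite exprMn -(ltr_pM2r (mulr_gt0 g0 g0)).
    rewrite /unit_gap; move: (1 + 4 * m%:R ^+ 2) g0 => g g0.
    have -> : 2 ^+ 2 * g^-1 ^+ 2 * (g * g) = 4 by field; rewrite lt0r_neq0.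
    by [].
  lra.
by have := leq_card f inj; rewrite card_sum !card_ord ltnn.
Qed.

(* The eigenvalues of [U], listed counterclockwise from the cut [mu]. The bound on
   [x] says that they stay at distance at least [2 / sqrt M] from the cut. *)
Definition spec (M : R) (U : 'M[C]_m) (mu : C) (Q : 'M[C]_m) (x : 'I_m -> R) :=
  [/\ Q \is unitarymx, U = sdec Q (fun j => mu * cay C (x j)), increasing x &
      forall j, x j ^+ 2 + 1 <= M].

Lemma sdecE (Q : 'M[C]_m) a i j : sdec Q a i j = \sum_k (Q k i)^* * a k * Q k j.
Proof.
rewrite /sdec mxE; apply: eq_bigr => k _; congr (_ * _).
by rewrite mul_mx_diag !mxE.
Qed.

Lemma sdec_reindex (Q : 'M[C]_m) a (s : 'I_m -> 'I_m) : injective s -> Q \is unitarymx ->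
  exists Q', Q' \is unitarymx /\ sdec Q' (fun i => a (s i)) = sdec Q a.
Proof.
move=> inj uQ; exists (\matrix_(i, j) Q (s i) j); split.
  apply/unitarymxP/matrixP => i j; move/unitarymxP/matrixP/(_ (s i) (s j)): uQ.
  rewrite !mxE (inj_eq inj) => <-; apply: eq_bigr => k _; by rewrite !mxE.
apply/matrixP => i j; rewrite !sdecE [RHS](reindex_inj inj).
by apply: eq_bigr => k _; rewrite !mxE.
Qed.

Lemma spec_exists (M : R) (U : 'M[C]_m) (mu : C) (Q : 'M[C]_m) (a : 'I_m -> C) :
  0 < M -> Q \is unitarymx -> U = sdec Q a -> U \is unitarymx -> simple U -> cabs mu = 1 ->
  (forall j, 4 / M <= cabs (a j - mu) ^+ 2) ->
  exists Q' x, spec M U mu Q' x.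
Proof.
move=> M0 uQ eU uU sU mu1 hmu.
have mu0 : mu != 0 by rewrite -cabs_eq0 mu1 oner_eq0.
have inj := sU Q a uQ eU.
have a1 := sdec_unitary_cabs uQ (_ : sdec Q a \is unitarymx); rewrite -eU in a1.
have ex j : exists x, mu^-1 * a j = cay C x.
  apply: cay_surj; first by rewrite cabsM cabsV mu1 invr1 mul1r a1.
  apply/eqP => e; have := hmu j; have -> : a j = mu by apply: (mulfI (invr_neq0 mu0)); rewrite e mulVf.
  by rewrite subrr cabs0 expr0n leNgt divr_gt0.
have [x hx] := choice ex.
have ax j : a j = mu * cay C (x j) by rewrite -hx mulVKf.
have xinj : injective x by move=> i j e; apply: inj; rewrite !ax e.
have [s [sinj sinc]] := sort_family xinj.
have [Q' [uQ' eQ']] := sdec_reindex a sinj uQ.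
exists Q', (fun i => x (s i)); split=> //.
  by rewrite eU -eQ'; apply: eq_sdec => j; rewrite ax.
move=> j; have := hmu (s j); rewrite ax -[X in _ * _ - X]mulr1 -mulrBr cabsM mu1 mul1r.
have := cay_dist1 C (x (s j)); set D := cabs _ ^+ 2 => e.
rewrite -e ler_pdivrMr // ler_pM2l //.
rewrite lt_def sqr_ge0 andbT; apply/eqP => D0.
by move: e; rewrite D0 mul0r => /eqP; rewrite eq_sym pnatr_eq0.
Qed.

End Cuts.

(** * Moving the eigenvalues of one matrix halfway to those of another *)

Section Halfway.
Variables (R : realType) (C : complexModel R) (m : nat).
Implicit Types (U V W Q : 'M[C]_m) (x y : 'I_m -> R) (M e : R) (mu : C).

Definition isospectral V V' := forall Q b, Q \is unitarymx -> V = sdec Q b ->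
  exists2 Q', Q' \is unitarymx & V' = sdec Q' b.

Definition near_isospectral e U V := exists2 V', isospectral V V' & fro2 (U - V') <= e.

Lemma fro2_sdec Q (a : 'I_m -> C) : Q \is unitarymx -> fro2 (sdec Q a) = \sum_i cabs (a i) ^+ 2.
Proof.
move=> uQ; have uQ' : Q^t* \is unitarymx by rewrite trmxC_unitary.
rewrite /sdec fro2_unitary_r // fro2_unitary_l //; apply: eq_bigr => i _.
rewrite (bigD1 i) //= big1 ?addr0 => [|j ji]; first by rewrite !mxE eqxx.
by rewrite !mxE eq_sym (negPf ji) cabs0 expr0n.
Qed.

Lemma same_eigenvalues Q Q' (a b : 'I_m -> C) : Q \is unitarymx -> Q' \is unitarymx ->
  sdec Q a = sdec Q' b -> forall j, exists i, a i = b j.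
Proof.
move=> uQ uQ' e j; have [i] := sdec_near a b j uQ uQ'.
rewrite e subrr fro2_0 => h; exists i; apply/eqP; rewrite -subr_eq0 -cabs_eq0 -sqrf_eq0.
by rewrite eq_le h sqr_ge0.
Qed.

Lemma spec_perturb M U V mu Q x Q' y : cabs mu = 1 ->
  spec M U mu Q x -> spec M V mu Q' y ->
  forall j, (x j - y j) ^+ 2 <= M ^+ 2 / 4 * fro2 (U - V).
Proof.
move=> mu1 [uQ -> ix hx] [uQ' -> iy hy].
apply: sorted_perturb_sqr => //; try exact: increasing_le.
  by rewrite divr_ge0 ?sqr_ge0.
by move=> i j; rewrite -mulrBr cabsM mu1 mul1r; exact: cay_dist_ge.
Qed.

(** [V] may be far from [U], but the [V'] near [U] has the coordinates [y] of [V] for the same cut,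
    so Weyl's inequality applies to [V']. *)
Lemma near_dist M e U V mu Q x Q' y : cabs mu = 1 -> near_isospectral e U V ->
  spec M U mu Q x -> spec M V mu Q' y -> forall j, (x j - y j) ^+ 2 <= M ^+ 2 / 4 * e.
Proof.
move=> mu1 [V' iso near] sU [uQ' eV iy hy] j.
have [Q'' uQ'' eV'] := iso _ _ uQ' eV.
apply: le_trans (spec_perturb mu1 sU (_ : spec M V' mu Q'' y) j) _; first by split.
by rewrite ler_wpM2l // divr_ge0 ?sqr_ge0.
Qed.

Lemma recut_side (x y z M : R) : 0 < M -> (x - y) ^+ 2 < M^-1 -> M^-1 <= (x - z) ^+ 2 ->
  (x < z) = (y < z).
Proof.
move=> M0 h1 h2; have h : (x - y) ^+ 2 < (x - z) ^+ 2 by exact: lt_le_trans h2.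
have [xz|zx] := ltP x z; have [yz|zy] := ltP y z => //; nra.
Qed.

(* Moving the cut permutes the ranks cyclically, in the same way for the two
   spectra because no pair is separated by the new cut. *)
Lemma recut_match M U V mu nu Q x Q' y P x' P' y' : 0 < M -> cabs mu = 1 -> cabs nu = 1 ->
  spec M U mu Q x -> spec M V mu Q' y -> spec M U nu P x' -> spec M V nu P' y' ->
  (forall j, (x j - y j) ^+ 2 < M^-1) ->
  forall j l, mu * cay C (x j) = nu * cay C (x' l) -> mu * cay C (y j) = nu * cay C (y' l).
Proof.
move=> M0 mu1 nu1 [uQ eU ix _] [uQ' eV iy _] [uP eU' ix' hx'] [uP' eV' iy' hy'] xy j l.
have mu0 : mu != 0 by rewrite -cabs_eq0 mu1 oner_eq0.
have nu0 : nu != 0 by rewrite -cabs_eq0 nu1 oner_eq0.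
have [s hs] := choice (same_eigenvalues uP uQ (etrans (esym eU') eU)).
have [t ht] := choice (same_eigenvalues uP' uQ' (etrans (esym eV') eV)).
have inj_s : injective s.
  by move=> i1 i2 e; apply: (increasing_inj ix); apply: (@cay_inj _ C); apply: (mulfI mu0); rewrite -!hs e.
have inj_t : injective t.
  by move=> i1 i2 e; apply: (increasing_inj iy); apply: (@cay_inj _ C); apply: (mulfI mu0); rewrite -!ht e.
suff st : s =1 t.
  rewrite -hs => /(mulfI nu0)/cay_inj/(increasing_inj ix') <-.
  by rewrite -ht st.
apply: same_rank => // i1 i2.
rewrite -(increasing_lt (s i1) _ ix') -(increasing_lt (t i1) _ iy').
(* For [nu = mu] the quotient of the cuts is 1, the only unit number that [cay] misses. *)
have [e|ne] := eqVneq nu mu.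
  have ex i : x' (s i) = x i.
    by apply: (@cay_inj _ C); apply: (mulfI mu0); rewrite -hs e.
  have ey i : y' (t i) = y i.
    by apply: (@cay_inj _ C); apply: (mulfI mu0); rewrite -ht e.
  by rewrite !ex !ey !increasing_lt.
have [z hz] : exists z, mu^-1 * nu = cay C z.
  apply: cay_surj; first by rewrite cabsM cabsV mu1 nu1 invr1 mul1r.
  by apply: contra ne => /eqP h; rewrite -[nu](mulVKf mu0) h mulr1.
have enu : nu = mu * cay C z by rewrite -hz mulVKf.
have cayz0 : cay C z != 0 by rewrite -cabs_eq0 cabs_cay oner_eq0.
have far (u u' : R) : nu * cay C u' = mu * cay C u -> u' ^+ 2 + 1 <= M ->
    [/\ u != z, u' = recut z u & M^-1 <= (u - z) ^+ 2].
  rewrite enu -mulrA => /(mulfI mu0) h hM.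
  have uz : u != z.
    apply/eqP => uz; move: h; rewrite uz -[RHS]mulr1 => /(mulfI cayz0)/eqP.
    by apply/negP; exact: cay_neq1.
  split=> //.
    by apply: (@cay_inj _ C); apply: (mulfI cayz0); rewrite h; exact: cay_recut.
  have := cay_dist_le C u z; rewrite -h -[X in _ * _ - X]mulr1 -mulrBr cabsM cabs_cay mul1r.
  have := cay_dist1 C u'; set D := cabs _ ^+ 2 => eD hD.
  have D0 : 0 <= D by exact: sqr_ge0.
  have : D * (u' ^+ 2 + 1) <= D * M by exact: ler_wpM2l.
  rewrite eD => h4; rewrite -[M^-1]mul1r ler_pdivrMr //; nra.
have fx i := far _ _ (hs i) (hx' (s i)); have fy i := far _ _ (ht i) (hy' (t i)).
have [x1 -> sx1] := fx i1; have [x2 -> sx2] := fx i2.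
have [y1 -> _] := fy i1; have [y2 -> _] := fy i2.
rewrite !recut_lt // -(recut_side M0 (xy i1) sx1) -(recut_side M0 (xy i2) sx2).
rewrite (increasing_lt _ _ ix) (increasing_lt _ _ iy).
by case: ifP => // _; rewrite !lt_def x1 y1 /= !leNgt (recut_side M0 (xy i1) sx1).
Qed.

(** A relation, because the cut is free; for nearly isospectral [U] and [V], [halfway_unique] shows
    that [W] does not depend on it. *)
Definition halfway M U V W := exists mu Q x Q' y,
  [/\ cabs mu = 1, spec M U mu Q x, spec M V mu Q' y &
      W = sdec Q (fun j => midpoint (mu * cay C (x j)) (mu * cay C (y j)))].

Lemma halfway_exists U V : U \is unitarymx -> V \is unitarymx -> simple U -> simple V ->
  exists W, halfway (4 / unit_gap R m ^+ 2) U V W.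
Proof.
move=> uU uV sU sV.
have [Q [a [uQ eU]]] := unitary_sdec uU; have [Q' [b [uQ' eV]]] := unitary_sdec uV.
have [mu mu1 hmu] := exists_cut a b.
have g0 : 0 < unit_gap R m by rewrite invr_gt0 ltr_wpDr // mulr_ge0 ?sqr_ge0.
have M0 : 0 < 4 / unit_gap R m ^+ 2 by rewrite divr_gt0 // exprn_gt0.
have gM : 4 / (4 / unit_gap R m ^+ 2) = unit_gap R m ^+ 2 by field; rewrite lt0r_neq0.
have sq c : unit_gap R m <= cabs (c : C) -> unit_gap R m ^+ 2 <= cabs c ^+ 2.
  by move=> h; rewrite ler_sqr ?nnegrE ?cabs_ge0 // ltW.
have [|P [x sx]] := spec_exists M0 uQ eU uU sU mu1.
  by move=> j; rewrite gM; apply: sq; have [] := hmu j.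
have [|P' [y sy]] := spec_exists M0 uQ' eV uV sV mu1.
  by move=> j; rewrite gM; apply: sq; have [] := hmu j.
by eexists; exists mu, P, x, P', y.
Qed.

Lemma spec_le M M' U mu Q x : M <= M' -> spec M U mu Q x -> spec M' U mu Q x.
Proof. by move=> le [? ? ? h]; split=> // j; exact: le_trans (h j) le. Qed.

Lemma halfway_le M M' U V W : M <= M' -> halfway M U V W -> halfway M' U V W.
Proof.
move=> le [mu [Q [x [Q' [y [? sx sy ?]]]]]]; exists mu, Q, x, Q', y.
by split=> //; exact: spec_le le _.
Qed.

Lemma far_apart mu (x y : R) : cabs mu = 1 -> (x - y) ^+ 2 <= 1 / 4 ->
  1 <= cabs (mu * cay C x + mu * cay C y).
Proof.
move=> mu1 h.
have n1 (u : R) : cabs (mu * cay C u) = 1 by rewrite cabsM mu1 cabs_cay mul1r.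
have hp := parallelogram (n1 x) (n1 y); rewrite -mulrBr cabsM mu1 mul1r in hp.
have := cay_dist_le C x y; have := cabs_ge0 (mu * cay C x + mu * cay C y).
move: hp; nra.
Qed.

Lemma cabs_gt1_neq0 (z : C) : 1 <= cabs z -> z != 0.
Proof. by move=> h; rewrite -cabs_gt0; lra. Qed.

Lemma lower_bound (I : finType) (D : I -> R) : (forall i, 0 < D i) ->
  exists2 g, 0 < g & forall i, g <= D i.
Proof.
move=> D0; exists (\big[Num.min/1]_i D i); first exact: lt_bigmin.
by move=> i; exact: bigmin_le.
Qed.

Lemma sqr_cabs_ge_half (z w : C) : cabs z ^+ 2 / 2 - cabs (w - z) ^+ 2 <= cabs w ^+ 2.
Proof. have := sqr_cabsD w (z - w); rewrite addrC subrK cabsBC; lra. Qed.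

(* [M ^+ 2 / 4 * e] bounds the squared distance of paired coordinates; it has to be
   smaller than the squared distance from the coordinates to any other cut. *)
Definition small M e := 0 < M /\ M ^+ 2 / 4 * e < Num.min M^-1 (1 / 4).

Lemma small_dist M e U V mu Q x Q' y : small M e -> cabs mu = 1 -> near_isospectral e U V ->
  spec M U mu Q x -> spec M V mu Q' y ->
  forall j, (x j - y j) ^+ 2 < M^-1 /\ (x j - y j) ^+ 2 < 1 / 4.
Proof.
move=> [M0]; rewrite lt_min => /andP[h1 h2] mu1 near sx sy j.
by have le := near_dist mu1 near sx sy j; split; apply: le_lt_trans le _.
Qed.

Lemma midpoint_far M e U V mu Q x Q' y : small M e -> cabs mu = 1 -> near_isospectral e U V ->
  spec M U mu Q x -> spec M V mu Q' y ->
  forall j, 1 <= cabs (mu * cay C (x j) + mu * cay C (y j)).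
Proof.
move=> sm mu1 near sx sy j; apply: far_apart => //; apply: ltW.
by have [] := small_dist sm mu1 near sx sy j.
Qed.

Lemma sqr_cabsB_le4 (z w : C) : cabs z = 1 -> cabs w = 1 -> cabs (z - w) ^+ 2 <= 4.
Proof. by move=> z1 w1; have := sqr_cabsD z (- w); rewrite cabsN z1 w1 expr1n; lra. Qed.

(** [sdec_transfer] for two decompositions of the same [U]: equal eigenvalues have equal midpoints
    by [recut_match], distinct ones are separated by a gap [g], and [fro2 (U - U)] is 0. *)
Lemma halfway_unique M e U V W W' : small M e -> near_isospectral e U V ->
  halfway M U V W -> halfway M U V W' -> W = W'.
Proof.
move=> sm near [mu [Q [x [Q' [y [mu1 sx sy ->]]]]]] [nu [P [x' [P' [y' [nu1 sx' sy' ->]]]]]].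
have fx := midpoint_far sm mu1 near sx sy; have fx' := midpoint_far sm nu1 near sx' sy'.
have [uQ eU _ _] := sx; have [uP eU' _ _] := sx'.
(* The default 1 for coinciding eigenvalues keeps every [D p] positive. *)
pose D (p : 'I_m * 'I_m) := let d := cabs (mu * cay C (x p.1) - nu * cay C (x' p.2)) ^+ 2 in
  if d == 0 then 1 else d.
have [g g0 hg] : exists2 g, 0 < g & forall p, g <= D p.
  apply: lower_bound => p; rewrite /D /=; case: ifP => // /negbT h.
  by rewrite lt_def h sqr_ge0.
apply/eqP; rewrite -subr_eq0; apply/eqP/fro2_eq0.
apply: (@le_trans _ _ (4 / g * fro2 (U - U) + m%:R * 0)); last first.
  by rewrite subrr fro2_0 !mulr0 addr0.
rewrite {1}eU eU'; apply: sdec_transfer => // i j; rewrite addr0.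
have := hg (i, j); rewrite /D /=; case: ifP => [/eqP d0 _|/negbT d0 hd].
  have e1 : mu * cay C (x i) = nu * cay C (x' j).
    by apply/eqP; rewrite -subr_eq0 -cabs_eq0 -sqrf_eq0 d0.
  have e2 := recut_match sm.1 mu1 nu1 sx sy sx' sy' (fun j => (small_dist sm mu1 near sx sy j).1) e1.
  by rewrite e1 e2 !subrr cabs0 expr0n mulr0.
apply: (@le_trans _ _ 4).
  by apply: sqr_cabsB_le4; apply: cabs_midpoint; exact: cabs_gt1_neq0.
by rewrite mulrAC ler_pdivlMr // ler_pM2l.
Qed.

(** The cut of [U0] still serves for [U]: squared distances to it were at least [4 / M], and
    [sqr_cabs_ge_half] leaves at least [2 / M - 1 / M = 4 / (4 * M)]. *)
Lemma spec_persists M U0 U mu Q x : cabs mu = 1 -> 0 < M -> spec M U0 mu Q x ->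
  U \is unitarymx -> simple U -> fro2 (U0 - U) <= M^-1 -> exists Q' x', spec (4 * M) U mu Q' x'.
Proof.
move=> mu1 M0 [uQ eU0 ix hx] uU sU hF.
have [P [a [uP eU]]] := unitary_sdec uU.
apply: (spec_exists _ uP eU) => //; first by rewrite mulr_gt0.
move=> j; have [i] := sdec_near (fun j => mu * cay C (x j)) a j uQ uP.
rewrite -eU0 -eU => /le_trans/(_ hF) near.
have -> : 4 / (4 * M) = M^-1 by field; rewrite lt0r_neq0.
have h4 : 4 / M <= cabs (mu * cay C (x i) - mu) ^+ 2.
  rewrite -[X in _ * _ - X]mulr1 -mulrBr cabsM mu1 mul1r ler_pdivrMr //.
  by rewrite -(cay_dist1 C (x i)) ler_wpM2l ?sqr_ge0.
have := sqr_cabs_ge_half (mu * cay C (x i) - mu) (a j - mu).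
have -> : a j - mu - (mu * cay C (x i) - mu) = a j - mu * cay C (x i) by ring.
rewrite cabsBC; lra.
Qed.

(** Near [(U0, V0)] the same cut serves, and by uniqueness [W] may be computed with it. Then
    [sdec_transfer] applies: equal indices by the Lipschitz bound for midpoints, distinct ones by
    the gap [g] in the spectrum of [U0]. *)
Lemma halfway_continuous M e U0 V0 W0 : small M e -> small (4 * M) e ->
  near_isospectral e U0 V0 -> halfway M U0 V0 W0 ->
  exists D d, [/\ 0 <= D, 0 < d & forall U V W,
    U \is unitarymx -> V \is unitarymx -> simple U -> simple V -> near_isospectral e U V ->
    fro2 (U0 - U) <= d -> fro2 (V0 - V) <= d -> halfway M U V W ->
    fro2 (W0 - W) <= D * (fro2 (U0 - U) + fro2 (V0 - V))].
Proof.
move=> sm sm4 near0 [mu [Q0 [x0 [Q0' [y0 [mu1 sx0 sy0 ->]]]]]].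
have M0 := sm.1; have le4 : M <= 4 * M by lra.
have [uQ0 eU0 ix0 _] := sx0.
have mu0 : mu != 0 by rewrite -cabs_eq0 mu1 oner_eq0.
pose G (p : 'I_m * 'I_m) := if p.1 == p.2 then 1
  else cabs (mu * cay C (x0 p.1) - mu * cay C (x0 p.2)) ^+ 2.
have [g g0 hg] : exists2 g, 0 < g & forall p, g <= G p.
  apply: lower_bound => p; rewrite /G; case: ifP => // /negbT h.
  rewrite exprn_gt0 // cabs_gt0 subr_eq0 (inj_eq (mulfI mu0)) (inj_eq (@cay_inj R C)).
  by rewrite (inj_eq (increasing_inj ix0)).
pose K := (4 * M) ^+ 2; have K0 : 0 < K by rewrite exprn_gt0 // mulr_gt0.
(* [8 * K] is the Lipschitz bound for equal indices. For distinct ones [K * F <= g / 4] keeps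
   squared distances at least [g / 4], while 4 bounds every squared distance on the circle: hence
   [16 / g]. *)
exists (16 / g + m%:R * (8 * K)), (Num.min M^-1 (g / (4 * K))).
have sp0 : 0 <= 16 / g by rewrite divr_ge0 // ltW.
have sp1 : 0 <= m%:R * (8 * K) by rewrite !mulr_ge0 // ltW.
split; first exact: addr_ge0.
  by rewrite lt_min invr_gt0 M0 divr_gt0 // mulr_gt0.
move=> U V W uU uV sU sV near; rewrite !le_min => /andP[hF1 hF2] /andP[hF1' hF2'] hW.
set F := fro2 (U0 - U) in hF1 hF2 *; set F' := fro2 (V0 - V) in hF1' hF2' *.
have F0 : 0 <= F by exact: fro2_ge0.
have F0' : 0 <= F' by exact: fro2_ge0.
have [Q [x sx]] := spec_persists mu1 M0 sx0 uU sU hF1.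
have [Q' [y sy]] := spec_persists mu1 M0 sy0 uV sV hF1'.
have -> : W = sdec Q (fun j => midpoint (mu * cay C (x j)) (mu * cay C (y j))).
  apply: (halfway_unique sm4 near (halfway_le le4 hW)).
  by exists mu, Q, x, Q', y.
have [uQ eU _ _] := sx.
have dx j : cabs (mu * cay C (x0 j) - mu * cay C (x j)) ^+ 2 <= K * F.
  rewrite -mulrBr cabsM mu1 mul1r; apply: le_trans (cay_dist_le _ _ _) _.
  by have := spec_perturb mu1 (spec_le le4 sx0) sx j; rewrite -/F -/K; lra.
have dy j : cabs (mu * cay C (y0 j) - mu * cay C (y j)) ^+ 2 <= K * F'.
  rewrite -mulrBr cabsM mu1 mul1r; apply: le_trans (cay_dist_le _ _ _) _.
  by have := spec_perturb mu1 (spec_le le4 sy0) sy j; rewrite -/F' -/K; lra.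
have f0 := midpoint_far sm mu1 near0 sx0 sy0; have f1 := midpoint_far sm4 mu1 near sx sy.
apply: (@le_trans _ _ (16 / g * F + m%:R * (8 * K * (F + F')))); last first.
  have -> : (16 / g + m%:R * (8 * K)) * (F + F') =
    16 / g * (F + F') + m%:R * (8 * K * (F + F')) by ring.
  rewrite lerD2r; apply: ler_wpM2l => //.
  by rewrite lerDl.
rewrite /F {1}eU0 {1}eU; apply: sdec_transfer => // i j.
have T0 : 0 <= 8 * K * (F + F') by rewrite !mulr_ge0 ?addr_ge0 // ltW.
have [<-|ij] := eqVneq i j.
  apply: (@le_trans _ _ (8 * K * (F + F'))); last first.
    by rewrite lerDr mulr_ge0 ?sqr_ge0.
  have := midpoint_lipschitz (f0 i) (cabs_gt1_neq0 (f1 i)).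
  have := dx i; have := dy i.
  set A := cabs (_ - mu * cay C (y i)); set B := cabs (_ - mu * cay C (x i)).
  set Z := cabs (midpoint _ _ - _) => hA hB hZ.
  have Z0 : 0 <= Z by exact: cabs_ge0.
  have : Z ^+ 2 <= (2 * (B + A)) ^+ 2.
    by rewrite ler_sqr // nnegrE (le_trans Z0).
  have : 0 <= (B - A) ^+ 2 by exact: sqr_ge0.
  have -> : 8 * K * (F + F') = 8 * (K * F) + 8 * (K * F') by ring.
  move: hA hB; move: (K * F) (K * F') => kf kf'; nra.
apply: (@le_trans _ _ 4).
  by apply: sqr_cabsB_le4; apply: cabs_midpoint; exact: cabs_gt1_neq0.
have := hg (i, j); rewrite /G /= (negPf ij) => hgij.
have := sqr_cabs_ge_half (mu * cay C (x0 i) - mu * cay C (x0 j)) (mu * cay C (x0 i) - mu * cay C (x j)).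
have -> : mu * cay C (x0 i) - mu * cay C (x j) - (mu * cay C (x0 i) - mu * cay C (x0 j)) =
  mu * cay C (x0 j) - mu * cay C (x j) by ring.
have hF : K * F <= g / 4.
  by move: hF2; rewrite ler_pdivlMr ?mulr_gt0 // => h; rewrite ler_pdivlMr // mulrC mulrA mulrC.
have := dx j; set S := cabs (mu * cay C (x0 i) - mu * cay C (x j)) ^+ 2 => h1 h2.
have hS : g / 4 <= S by lra.
apply: (@le_trans _ _ (16 / g * S)); last by rewrite lerDl.
by rewrite mulrAC ler_pdivlMr //; lra.
Qed.

(** [W - U] is diagonal in the common eigenbasis, and an eigenvalue of [U] is its own midpoint, so
    the Lipschitz bound for midpoints reduces everything to the distance of [y j] from [x j]. *)
Lemma halfway_near M e U V W : small M e -> near_isospectral e U V -> halfway M U V W ->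
  fro2 (W - U) <= m%:R * (4 * M ^+ 2 * e).
Proof.
move=> sm near [mu [Q [x [Q' [y [mu1 sx sy ->]]]]]].
have [uQ {1}-> _ _] := sx; have f := midpoint_far sm mu1 near sx sy.
have -> : sdec Q (fun j => midpoint (mu * cay C (x j)) (mu * cay C (y j))) -
   sdec Q (fun j => mu * cay C (x j)) =
   sdec Q (fun j => midpoint (mu * cay C (x j)) (mu * cay C (y j)) + -1 * (mu * cay C (x j))).
  by rewrite sdecD (sdecZ Q (-1)) scaleN1r.
rewrite fro2_sdec //.
have -> : m%:R * (4 * M ^+ 2 * e) = \sum_(i < m) (4 * M ^+ 2 * e).
  by rewrite sumr_const card_ord mulr_natl.
apply: ler_sum => j _; rewrite mulN1r.
have a1 : cabs (mu * cay C (x j)) = 1 by rewrite cabsM mu1 cabs_cay mulr1.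
rewrite -[X in _ - X](midpoint_id a1).
have aa : mu * cay C (x j) + mu * cay C (x j) != 0.
  apply: cabs_gt1_neq0; apply: far_apart => //; rewrite subrr expr0n /=; lra.
have := midpoint_lipschitz (f j) aa; rewrite subrr cabs0 add0r -mulrBr cabsM mu1 mul1r.
set Z := cabs _ => hZ; have Z0 : 0 <= Z by exact: cabs_ge0.
have d1 := cay_dist_le C (y j) (x j); have d2 := near_dist mu1 near sx sy j.
have : Z ^+ 2 <= (2 * cabs (cay C (y j) - cay C (x j))) ^+ 2.
  by rewrite ler_sqr // nnegrE (le_trans Z0).
rewrite exprMn; have e2 : (y j - x j) ^+ 2 = (x j - y j) ^+ 2 by ring.
by rewrite e2 in d1; lra.
Qed.

(** Midpoints are symmetric in the pair, so the same numbers [c] on the eigenvectors of [V] form a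
    halfway matrix for [(V, U)]. *)
Lemma halfway_spectrum M e U V W : small M e -> near_isospectral e U V -> halfway M U V W ->
  exists Q Q' c, [/\ Q \is unitarymx /\ Q' \is unitarymx, W = sdec Q c,
    halfway M V U (sdec Q' c), injective c & forall j, cabs (c j) = 1].
Proof.
move=> sm near [mu [Q [x [Q' [y [mu1 sx sy ->]]]]]].
have [uQ _ ix _] := sx; have [uQ' _ iy _] := sy; have f := midpoint_far sm mu1 near sx sy.
have mu0 : mu != 0 by rewrite -cabs_eq0 mu1 oner_eq0.
exists Q, Q', (fun j => midpoint (mu * cay C (x j)) (mu * cay C (y j))); split=> //; last first.
- by move=> j; apply: cabs_midpoint; exact: cabs_gt1_neq0.
- have lt4 j : (x j - y j) ^+ 2 < 4.
    by have [_ h] := small_dist sm mu1 near sx sy j; lra.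
  have ne (i j : 'I_m) : (i < j)%N ->
      midpoint (mu * cay C (x i)) (mu * cay C (y i)) != midpoint (mu * cay C (x j)) (mu * cay C (y j)).
    by move=> ij; apply: midpoint_neq => //; [exact: ix | exact: iy].
  by move=> i j eij; have [/ne|/ne|/val_inj//] := ltngtP i j; rewrite eij eqxx.
- exists mu, Q', y, Q, x; split=> //.
  by apply: eq_sdec => j; rewrite midpointC.
Qed.

End Halfway.

(** * Equal spectra at [k] and [-k] *)

Section Symmetrization.
Variables (R : realType) (C : complexModel R) (m : nat).

(** Transposing [V = Q^* b Q] exchanges the roles of [Q] and its conjugate, so the conjugate of [Q],
    times [S], diagonalizes the new matrix with the same [b]. *)
Lemma isospectral_transpose (S V : 'M[C]_m) : S \is unitarymx ->
  isospectral V (S^t* *m V^T *m S).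
Proof.
move=> uS Q b uQ ->; exists (map_mx Num.conj Q *m S).
  by apply: mul_unitarymx => //; rewrite conjC_unitary.
rewrite /sdec !trmx_mul tr_diag_mx map_trmx trmxK map_mxM -!mulmxA.
congr (_ *m _); rewrite !mulmxA; congr (_ *m _ *m _ *m _).
by rewrite map_trmx -map_mx_comp; apply/matrixP => i j; rewrite !mxE /= conjCK.
Qed.

Lemma exists_small_scale (K b : R) : 0 <= K -> 0 < b ->
  exists2 d, 0 < d & d <= 1 /\ forall t, t <= d -> K * t < b.
Proof.
move=> K0 b0; have p : 0 < 2 * (K + 1) by lra.
have b2 : 0 < b / (2 * (K + 1)) by rewrite divr_gt0.
exists (Num.min 1 (b / (2 * (K + 1)))); first by rewrite lt_min ltr01.
split; first by rewrite ge_min lexx.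
move=> t; rewrite le_min => /andP[_]; rewrite ler_pdivlMr // => h; nra.
Qed.

Lemma small_le M M' e : 0 < M -> M <= M' -> 0 <= e -> small M' e -> @small R M e.
Proof.
move=> M0 le e0 [M'0]; rewrite lt_min => /andP[h1 h2]; split=> //.
have : M ^+ 2 / 4 * e <= M' ^+ 2 / 4 * e.
  by apply: ler_wpM2r => //; rewrite ler_pM2r ?invr_gt0 // ler_sqr ?nnegrE // ltW.
move=> h; rewrite lt_min; apply/andP; split; last exact: le_lt_trans h2.
by apply: le_lt_trans h _; apply: lt_le_trans h1 _; rewrite lef_pV2 ?posrE.
Qed.

Definition continuous_fam (A : R -> R -> 'M[C]_m) := forall k1 k2 e, 0 < e ->
  exists2 d, 0 < d & forall l1 l2, `|l1 - k1| < d -> `|l2 - k2| < d ->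
    fro2 (A k1 k2 - A l1 l2) <= e.

Theorem exists_symmetric_approx (S : 'M[C]_m) (U : R -> R -> 'M[C]_m) (c : R) :
  S \is unitarymx -> (forall k1 k2, U k1 k2 \is unitarymx) -> int_periodic U ->
  unif_continuous_fam U ->
  (forall k1 k2, U k1 k2 = S^t* *m (U (- k1) (- k2))^T *m S) -> 0 < c ->
  exists A : R -> R -> 'M[C]_m,
   [/\ continuous_fam A, int_periodic A, forall k1 k2, A k1 k2 \is unitarymx,
     forall k1 k2, fro2 (A k1 k2 - U k1 k2) <= c &
     forall k1 k2, exists Q Q' a, [/\ Q \is unitarymx /\ Q' \is unitarymx,
       A k1 k2 = sdec Q a, A (- k1) (- k2) = sdec Q' a & injective a]].
Proof.
move=> uS uU pU cU symU c0; pose n : R := m%:R; have n0 : 0 <= n by exact: ler0n.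
pose M := 4 / unit_gap R m ^+ 2.
have g0 : 0 < unit_gap R m by rewrite invr_gt0 ltr_wpDr // mulr_ge0 ?sqr_ge0.
have M0 : 0 < M by rewrite divr_gt0 // exprn_gt0.
have le4 : M <= 4 * M by lra.
have b0 : 0 < Num.min (4 * M)^-1 (1 / 4).
  by rewrite lt_min invr_gt0 mulr_gt0 //=; lra.
have K1 : 0 <= (4 * M) ^+ 2 / 4 by rewrite divr_ge0 ?sqr_ge0.
have K2 : 0 <= n * (4 * M ^+ 2).
  by apply: mulr_ge0 => //; apply: mulr_ge0 => //; exact: sqr_ge0.
have c4 : 0 < c / 4 by lra.
have [d1 d10 [_ h1]] := exists_small_scale K1 b0; have [d2 d20 [_ h2]] := exists_small_scale K2 c4.
(* [d1] makes [e] small for [4 * M], [d2] bounds the displacement of the eigenvalues, and [c] the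
   distance from [B] to [U]. *)
pose e := Num.min d1 (Num.min d2 c).
have e0 : 0 < e by rewrite !lt_min d10 d20 c0.
have sm4 : small (4 * M) e by split; [lra | apply: h1; rewrite ge_min lexx].
have sm : small M e by apply: small_le sm4 => //; exact: ltW.
have ec : n * (4 * M ^+ 2 * e) <= c / 4.
  by rewrite mulrA ltW // h2 // !ge_min lexx !orbT.
have [|B [L [[L0 lipB] uB nearB pB sB]]] := @exists_simple_approx R C m U (e / 4) _ uU pU cU.
  by rewrite divr_gt0.
have near k1 k2 : near_isospectral e (B k1 k2) (B (- k1) (- k2)).
  exists (S^t* *m (B (- k1) (- k2))^T *m S); first exact: isospectral_transpose.
  have -> : B k1 k2 - S^t* *m (B (- k1) (- k2))^T *m S =
     (B k1 k2 - U k1 k2) - S^t* *m (B (- k1) (- k2) - U (- k1) (- k2))^T *m S.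
    rewrite [U k1 k2]symU raddfB /= mulmxBr mulmxBl; move: (_ *m _ *m S) (_ *m _ *m S) => X Y.
    by apply/matrixP => i j; rewrite !mxE; ring.
  apply: le_trans (fro2B _ _) _; rewrite fro2_unitary_r // fro2_unitary_l ?trmxC_unitary // fro2_tr.
  by have := nearB k1 k2; have := nearB (- k1) (- k2); lra.
(* The choice is made on pairs of matrices, not at each [k], so that [A] inherits the periodicity of
   [B]. The value 0 serves where the conditions fail. *)
have exW (p : 'M[C]_m * 'M[C]_m) : exists W, p.1 \is unitarymx -> p.2 \is unitarymx ->
    simple p.1 -> simple p.2 -> halfway M p.1 p.2 W.
  have [[h [h' [s s']]]|hN] := pselect (p.1 \is unitarymx /\ p.2 \is unitarymx /\ simple p.1 /\ simple p.2).
    by have [W hW] := halfway_exists h h' s s'; exists W.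
  by exists 0 => ? ? ? ?; case: hN.
have [w hw] := choice exW.
pose A k1 k2 := w (B k1 k2, B (- k1) (- k2)).
have hA k1 k2 : halfway M (B k1 k2) (B (- k1) (- k2)) (A k1 k2).
  exact: (hw (B k1 k2, B (- k1) (- k2)) (uB _ _) (uB _ _) (sB _ _) (sB _ _)).
exists A; split.
- move=> k1 k2 t t0.
  have [D [d [D0 d0 hD]]] := halfway_continuous sm sm4 (near k1 k2) (hA k1 k2).
  pose s := Num.min d (t / (2 * D + 1)).
  have s0 : 0 < s by rewrite lt_min d0 divr_gt0 //; lra.
  have [del del0 [del1 hdel]] := exists_small_scale (mulr_ge0 (mulr_ge0 n0 n0) (sqr_ge0 (2 * L))) s0.
  exists del => // l1 l2 hl1 hl2.
  have cont a1 a2 a1' a2' : `|a1 - a1'| < del -> `|a2 - a2'| < del ->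
      fro2 (B a1 a2 - B a1' a2') <= s.
    move=> q1 q2; apply: le_trans (_ : (m * m)%:R * (L * (del + del)) ^+ 2 <= _).
      apply: fro2_le_entries => i j; rewrite mxBE; apply: le_trans (lipB _ _ _ _ _ _) _.
      by apply: ler_wpM2l => //; apply: lerD; exact: ltW.
    apply: ltW; apply: le_lt_trans (hdel _ (lexx _)); rewrite natrM -/n.
    have -> : n * n * (L * (del + del)) ^+ 2 = n * n * (2 * L) ^+ 2 * (del * del) by ring.
    apply: ler_wpM2l; first by rewrite !mulr_ge0 ?sqr_ge0.
    by rewrite ler_piMl // ltW.
  have hF : fro2 (B k1 k2 - B l1 l2) <= s by apply: cont; rewrite distrC.
  have hF' : fro2 (B (- k1) (- k2) - B (- l1) (- l2)) <= s.
    by apply: cont; rewrite -opprD normrN distrC.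
  have sd : s <= d by rewrite ge_min lexx.
  have := hD _ _ _ (uB l1 l2) (uB (- l1) (- l2)) (sB _ _) (sB _ _) (near l1 l2)
    (le_trans hF sd) (le_trans hF' sd) (hA l1 l2).
  move=> /le_trans; apply; apply: le_trans (_ : D * (s + s) <= _).
    by apply: ler_wpM2l => //; exact: lerD.
  have : s <= t / (2 * D + 1) by rewrite ge_min lexx orbT.
  rewrite ler_pdivlMr; last by lra.
  by have := ltW s0; nra.
- by move=> z1 z2 k1 k2; rewrite /A !opprD -!rmorphN /= !pB.
- move=> k1 k2; have [Q [_ [a [[uQ _] -> _ _ a1]]]] := halfway_spectrum sm (near k1 k2) (hA k1 k2).
  exact: sdec_unitary.
- move=> k1 k2; rewrite -[A k1 k2](subrK (B k1 k2)) -addrA.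
  apply: le_trans (fro2D _ _) _.
  have := halfway_near sm (near k1 k2) (hA k1 k2); rewrite -/n.
  have ec' : e <= c by rewrite !ge_min lexx !orbT.
  by have := nearB k1 k2; lra.
move=> k1 k2.
have [Q [Q' [a [uQQ' eA hA' inj _]]]] := halfway_spectrum sm (near k1 k2) (hA k1 k2).
exists Q, Q', a; split=> //.
(* [A] at [-k] is halfway for the swapped pair, and so is the matrix [sdec Q' a] found above. *)
have := near (- k1) (- k2); have := hA (- k1) (- k2); rewrite !opprK => hA2 near2.
exact: halfway_unique sm near2 hA2 hA'.
Qed.

End Symmetrization.

Import complex Rstruct.

(** * The complex numbers as an instance of the interface *)

Section ConcreteModel.
Variable R : realType.
Local Open Scope complex_scope.

Definition complex_model : complexModel R.
Proof.
refine (@ComplexModel R R[i] (@complex.Re R) (@complex.Im R) (@Complex R) _ _ _ _ _ _ _ _ _).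
- by [].
- by [].
- by case.
- by case=> ? ? [].
- by case=> ? ? [].
- by case=> ? ? [].
- by case=> ? ? [].
- by move=> z; have -> : (z^*)%R = conjc z by []; case: z.
- by move=> z; have -> : (z^*)%R = conjc z by []; case: z.
Defined.

End ConcreteModel.

(** * Dictionary between the matrices of the statement and those of MathComp *)

Section Translation.
Local Notation R := Rdefinitions.R.
Variables (C : complexModel R) (m : nat).
Implicit Types (z w : Cx) (A B : Mat) (v : Vec).

Definition toC z : C := mkC C (Defs.re z) (Defs.im z).
Definition ofC (z : C) : Cx := mkCx (re z) (im z).

Lemma ofCK : cancel ofC toC.
Proof. by move=> z; rewrite /toC /= mkC_eta. Qed.

Lemma toCK : cancel toC ofC.
Proof. by case=> a b; rewrite /ofC !reimE. Qed.

Lemma toCD z w : toC (cadd z w) = toC z + toC w.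
Proof. by apply: complex_ext; rewrite !reimE. Qed.
Lemma toCN z : toC (copp z) = - toC z.
Proof. by apply: complex_ext; rewrite !reimE. Qed.
Lemma toCB z w : toC (csub z w) = toC z - toC w.
Proof. by rewrite toCD toCN. Qed.
Lemma toCM z w : toC (cmul z w) = toC z * toC w.
Proof. by apply: complex_ext; rewrite !reimE. Qed.
Lemma toC_conj z : toC (cconj z) = (toC z)^*.
Proof. by apply: complex_ext; rewrite !reimE. Qed.
Lemma toC_C0 : toC Defs.C0 = 0.
Proof. by apply: complex_ext; rewrite !reimE. Qed.
Lemma toC_C1 : toC Defs.C1 = 1.
Proof. by apply: complex_ext; rewrite !reimE. Qed.

Lemma cnorm2E z : cnorm2 z = cabs (toC z) ^+ 2.
Proof. by rewrite sqr_cabsE !reimE !expr2. Qed.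

Lemma cmodE z : cmod z = cabs (toC z).
Proof. by rewrite /cmod Rstruct.RsqrtE cnorm2E sqrtr_sqr ger0_norm // cabs_ge0. Qed.

Lemma toC_sum n (f : nat -> Cx) : toC (csum n f) = \sum_(i < n) toC (f i).
Proof.
elim: n => [|n IH]; first by rewrite big_ord0 toC_C0.
by rewrite big_ord_recr /= -IH toCD.
Qed.

Lemma rsumE n (f : nat -> R) : rsum n f = \sum_(i < n) f i.
Proof.
elim: n => [|n IH]; first by rewrite big_ord0.
by rewrite big_ord_recr /= -IH.
Qed.

Definition toM A : 'M[C]_m := \matrix_(i, j) toC (A i j).
Definition toV v : 'cV[C]_m := \col_i toC (v i).

Definition ofV (v : 'cV[C]_m) : Vec := fun i => if insub i is Some i' then ofC (v i' 0) else Defs.C0.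
Definition ofM (A : 'M[C]_m) : Mat := fun i j =>
  if insub i is Some i' then if insub j is Some j' then ofC (A i' j') else Defs.C0 else Defs.C0.

Lemma ofVE (v : 'cV[C]_m) (i : 'I_m) : ofV v i = ofC (v i 0).
Proof. by rewrite /ofV valK. Qed.

Lemma ofMK : cancel ofM toM.
Proof. by move=> A; apply/matrixP => i j; rewrite mxE /ofM !valK ofCK. Qed.

Lemma ofVK : cancel ofV toV.
Proof. by move=> v; apply/matrixP => i j; rewrite ord1 mxE ofVE ofCK. Qed.

Lemma toM_mul A B : toM (mmul m A B) = toM A *m toM B.
Proof.
apply/matrixP => i j; rewrite !mxE toC_sum; apply: eq_bigr => k _.
by rewrite !mxE toCM.
Qed.

Lemma toM_sub A B : toM (msub A B) = toM A - toM B.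
Proof. by apply/matrixP => i j; rewrite !mxE toCB. Qed.

Lemma toM_tr A : toM (mtr A) = (toM A)^T.
Proof. by apply/matrixP => i j; rewrite !mxE. Qed.

Lemma toM_adj A : toM (madj A) = (toM A)^t*.
Proof. by apply/matrixP => i j; rewrite !mxE toC_conj. Qed.

Lemma toM_mid : toM mid = 1%:M.
Proof.
apply/matrixP => i j; rewrite !mxE /mid.
have -> : Nat.eqb i j = (i == j) by apply/idP/eqP => [/Nat.eqb_eq/val_inj|->] //; exact/Nat.eqb_eq.
by case: eqP => _; rewrite ?toC_C1 ?toC_C0.
Qed.

Lemma meqE A B : meq m A B <-> toM A = toM B.
Proof.
split=> [h|/matrixP h i j /ssrnat.ltP im /ssrnat.ltP jm].
  by apply/matrixP => i j; rewrite !mxE h //; apply/ssrnat.ltP.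
have := h (Ordinal im) (Ordinal jm); rewrite !mxE /= => /(congr1 ofC).
by rewrite !toCK.
Qed.

Lemma unitaryE A : unitary m A <-> toM A \is unitarymx.
Proof.
rewrite /unitary meqE toM_mul toM_adj toM_mid -trmxC_unitary.
by split=> [h|/unitarymxP]; [apply/unitarymxP|]; rewrite trmxCK.
Qed.

Lemma toV_mv A v : toV (mv m A v) = toM A *m toV v.
Proof.
apply/matrixP => i j; rewrite !mxE toC_sum; apply: eq_bigr => k _.
by rewrite !mxE toCM.
Qed.

Lemma vnorm2E v : vnorm2 m v = fro2 (toV v).
Proof.
rewrite /vnorm2 rsumE; apply: eq_bigr => i _.
by rewrite big_ord_recr big_ord0 /= add0r mxE cnorm2E.
Qed.

Lemma opnorm_le_fro2 A B (c : R) : fro2 (toM A - toM B) <= c ^+ 2 -> opnorm_le m (msub A B) c.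
Proof.
move=> h v; apply/Rstruct.RleP; rewrite !vnorm2E toV_mv toM_sub.
by apply: le_trans (fro2M _ _) _; apply: ler_wpM2r; [exact: fro2_ge0 | move: h; rewrite expr2].
Qed.

(** In the basis [Q] the equation reads [(a k - lam) (Q v)_k = 0] for each [k], and [Q v] is
    nonzero. *)
Lemma eigenvalueE A Q (a : 'I_m -> C) (lam : Cx) : Q \is unitarymx -> toM A = sdec Q a ->
  Defs.eigenvalue m A lam <-> exists j, a j = toC lam.
Proof.
move=> uQ eA; split=> [[v [[i [/ssrnat.ltP im vi] hv]]]|[j aj]].
  have ev : sdec Q a *m toV v = toC lam *: toV v.
    apply/matrixP => k l; rewrite -eA -toV_mv ord1 !mxE -toCM hv //.
    by apply/ssrnat.ltP.
  apply: contrapT => hN; apply: vi.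
  have e2 : diag_mx (\row_i a i) *m (Q *m toV v) = toC lam *: (Q *m toV v).
    by rewrite scalemxAr -ev /sdec !mulmxA (unitarymxP uQ) mul1mx.
  have Qv0 : Q *m toV v = 0.
    apply/matrixP => k l; have /matrixP/(_ k l) := e2; rewrite mul_diag_mx mxZE mxE.
    rewrite mxE => /eqP; rewrite -subr_eq0 -mulrBl mulf_eq0 => /orP[|/eqP->].
      by rewrite subr_eq0 => /eqP h; case: hN; exists k.
    by rewrite mxE.
  have : toV v = 0 by rewrite -[toV v]mul1mx -(adj_unitaryP uQ) -mulmxA Qv0 mulmx0.
  move/matrixP/(_ (Ordinal im) 0); rewrite !mxE /= => /(congr1 ofC).
  by rewrite toCK => ->; rewrite -toC_C0 toCK.
exists (ofV (col j (Q^t*))); split.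
  apply: contrapT => hN.
  have z (i : 'I_m) : Q^t* i j = 0.
    apply: contrapT => h; apply: hN; exists i; split; first exact/ssrnat.ltP.
    rewrite ofVE => /(congr1 toC); rewrite ofCK toC_C0 mxE; exact: h.
  have := unitary_row_sum uQ j; rewrite big1 => [/eqP|i _].
    by rewrite eq_sym oner_eq0.
  by have := z i; rewrite !mxE => /(congr1 (@cabs _ _)); rewrite cabs_conj => ->; rewrite cabs0 expr0n.
move=> i /ssrnat.ltP im; apply: (can_inj toCK).
have := sdec_eigen a j uQ; rewrite -eA -{1}[col j _]ofVK -toV_mv.
move/matrixP/(_ (Ordinal im) 0); rewrite mxE [in RHS]mxZE => ->.
by rewrite toCM -aj -[X in ofV _ X]/(val (Ordinal im)) ofVE ofCK.
Qed.

Lemma sdec_nondegenerate A Q (a : 'I_m -> C) : Q \is unitarymx -> toM A = sdec Q a ->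
  injective a -> nondegenerate_spectrum m A.
Proof.
move=> uQ eA inj; pose lam i := if insub i is Some i' then ofC (a i') else Defs.C0.
have lamE (i : 'I_m) : lam i = ofC (a i) by rewrite /lam valK.
exists lam; split=> [i j /ssrnat.ltP im /ssrnat.ltP jm ij e|i /ssrnat.ltP im].
  apply: ij; move: e; rewrite (lamE (Ordinal im)) (lamE (Ordinal jm)) => /(can_inj ofCK)/inj.
  by move/(congr1 val).
by apply/(eigenvalueE _ uQ eA); exists (Ordinal im); rewrite (lamE (Ordinal im)) ofCK.
Qed.

Lemma monomial_unitary (A : 'M[C]_m) (s : 'I_m -> 'I_m) (c : 'I_m -> C) :
  injective s -> (forall i, cabs (c i) = 1) ->
  (forall i j, A i j = if j == s i then c i else 0) -> A \is unitarymx.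
Proof.
move=> inj c1 hA; apply/unitarymxP/matrixP => i j; rewrite !mxE (bigD1 (s i)) //= big1 => [|k ki].
  rewrite !mxE !hA eqxx (inj_eq inj) addr0; case: eqP => [<-|_]; last by rewrite conjC0 mulr0.
  by rewrite -sqr_cabs_conj c1 expr1n rc1.
by rewrite hA (negPf ki) mul0r.
Qed.

Lemma eps_unitary eps : eps_ok eps m -> toM (eps_mat eps m) \is unitarymx.
Proof.
case: eps => [_|[p mp]]; rewrite /eps_mat.
  by rewrite toM_mid; apply/unitarymxP; rewrite trmx1 map_mx1 mulmx1.
have mE : m = (p + p)%N by lia.
have -> : Nat.div m 2 = p by rewrite mp Nat.mul_comm Nat.div_mul.
(* [J] exchanges the two halves of the basis, up to sign. *)
pose f (i : 'I_m) := if (i < p)%N then (i + p)%N else (i - p)%N.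
have fm i : (f i < m)%N by rewrite /f; have := ltn_ord i; case: ifP; lia.
pose s i := Ordinal (fm i).
have sinj : injective s.
  move=> i j /(congr1 val) /=; rewrite /f => e; apply: val_inj => /=.
  have := ltn_ord i; have := ltn_ord j; move: e.
  by case: ifP; case: ifP; lia.
apply: (@monomial_unitary _ s (fun i => if (i < p)%N then 1 else -1)) => //.
  by move=> i; case: ifP; rewrite ?cabsN cabs1.
move=> i j; rewrite mxE /Jmat.
have -> : Nat.ltb i p = (i < p)%N by apply/Nat.ltb_spec0/ssrnat.ltP.
have -> : (j == s i) = (nat_of_ord j == f i) by [].
have eqbE a b : Nat.eqb a b = (a == b).
  by apply/idP/eqP => [/Nat.eqb_eq|->] //; exact/Nat.eqb_eq.
rewrite !eqbE /f; case: ifP => ip; first by case: eqP => _; rewrite ?toC_C1 ?toC_C0.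
have -> : (nat_of_ord i == j + p)%N = (nat_of_ord j == i - p)%N.
  by apply/eqP/eqP; lia.
by case: eqP => _; rewrite ?toCN ?toC_C1 ?toC_C0.
Qed.

End Translation.

(** * Dictionary for families, and the approximating sequence *)

Section Families.
Local Notation R := Rdefinitions.R.
Variables (C : complexModel R) (m : nat).
Implicit Types a : MatFam.

Local Notation toF a := (fun k1 k2 => toM C m (a k1 k2)).

Lemma int_shift (T : Type) (f : R -> T) : (forall x, f (x + 1) = f x) ->
  forall (z : int) x, f (x + z%:~R) = f x.
Proof.
move=> h; have hn (n : nat) x : f (x + n%:R) = f x.
  by elim: n => [|n IH]; rewrite ?addr0 // -natr1 addrA h IH.
by case=> n x; [exact: hn | rewrite NegzE mulrNz -[LHS](hn n.+1) subrK].
Qed.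

Lemma fam_int_periodic a : fam_periodic m a -> int_periodic (toF a).
Proof.
move=> pa z1 z2 k1 k2.
rewrite (@int_shift _ (fun x => toM C m (a x (k2 + z2%:~R)))) => [|x].
  apply: (@int_shift _ (fun x => toM C m (a k1 x))) => x.
  by apply/meqE; case: (pa k1 x).
by apply/meqE; case: (pa x (k2 + z2%:~R)).
Qed.

(** Heine's theorem on [[-1, 2]^2]. The same integers must be subtracted from both points: this puts
    [k] into the unit square and [l], within 1 of it, into the larger one. *)
Lemma unif_continuous_periodic (f : R -> R -> R) :
  (forall x y, Continuity.continuity_2d_pt f x y) ->
  (forall (z1 z2 : int) x y, f (x + z1%:~R) (y + z2%:~R) = f x y) -> unif_continuous2 f.
Proof.
move=> cf pf e e0.
have [d hd] := Continuity.uniform_continuity_2d f (-1) 2 (-1) 2 (fun x y _ _ => cf x y)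
  (RIneq.mkposreal e (elimT Rstruct.RltP e0)).
have d0 : 0 < RIneq.pos d by apply/Rstruct.RltP; exact: RIneq.cond_pos.
exists (Num.min (RIneq.pos d) 1); first by rewrite lt_min d0 ltr01.
move=> k1 k2 l1 l2; rewrite !lt_min => /andP[h1 h1'] /andP[h2 h2'].
rewrite -(pf (- Num.floor k1) (- Num.floor k2) k1) -(pf (- Num.floor k1) (- Num.floor k2) l1).
have box (k l : R) : `|k - l| < 1 ->
   [/\ -1 <= k + (- Num.floor k)%:~R <= 2, -1 <= l + (- Num.floor k)%:~R <= 2 &
       (k + (- Num.floor k)%:~R) - (l + (- Num.floor k)%:~R) = k - l].
  move=> h; have f1 := ge_floor k; have f2 := floorD1_gt k.
  move: f1 f2; rewrite intrD rmorphN /=; set t := (Num.floor k)%:~R => f1 f2.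
  move: h; rewrite ltr_norml => /andP[h3 h4].
  by split; [lra | lra | ring].
have [/andP[a1 a2] /andP[a3 a4] a5] := box k1 l1 h1'.
have [/andP[b1 b2] /andP[b3 b4] b5] := box k2 l2 h2'.
have toR (x y : R) : x <= y -> Rdefinitions.Rle x y by move/Rstruct.RleP.
apply/Rstruct.RltP; rewrite -Rstruct.RabsE; apply: hd; try by split; apply: toR.
  by apply/Rstruct.RltP; rewrite Rstruct.RabsE [X in `|X|]a5.
by apply/Rstruct.RltP; rewrite Rstruct.RabsE [X in `|X|]b5.
Qed.

Lemma fam_unif_continuous a : fam_continuous m a -> fam_periodic m a ->
  unif_continuous_fam (toF a).
Proof.
move=> ca pa i j; have pF := fam_int_periodic pa.
split; apply: unif_continuous_periodic => [x y|z1 z2 x y]; try by rewrite pF.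
  move=> e; have [d [d0 hd]] := ca x y _ (RIneq.cond_pos e).
  exists (RIneq.mkposreal d d0) => u v hu hv /=.
  have /Rstruct.RltP := hd u v hu hv i j (elimT ssrnat.ltP (ltn_ord i)) (elimT ssrnat.ltP (ltn_ord j)).
  rewrite (cmodE C) toCB => h; apply/Rstruct.RltP; rewrite Rstruct.RabsE.
  apply: le_lt_trans h; apply: le_trans (normr_re_le _); rewrite !mxE.
  by rewrite !reimE.
move=> e; have [d [d0 hd]] := ca x y _ (RIneq.cond_pos e).
exists (RIneq.mkposreal d d0) => u v hu hv /=.
have /Rstruct.RltP := hd u v hu hv i j (elimT ssrnat.ltP (ltn_ord i)) (elimT ssrnat.ltP (ltn_ord j)).
rewrite (cmodE C) toCB => h; apply/Rstruct.RltP; rewrite Rstruct.RabsE.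
apply: le_lt_trans h; apply: le_trans (normr_im_le _); rewrite !mxE.
by rewrite !reimE.
Qed.

Lemma ofM_continuous (A : R -> R -> 'M[C]_m) : continuous_fam A ->
  fam_continuous m (fun k1 k2 => ofM (A k1 k2)).
Proof.
move=> cA k1 k2 e /Rstruct.RltP e0.
have {}e0 : 0 < e := e0; have e2 : 0 < e / 2 by rewrite divr_gt0.
have [d d0 hd] := cA k1 k2 ((e / 2) ^+ 2) (exprn_gt0 _ e2).
exists d; split; first exact/Rstruct.RltP.
move=> l1 l2 /Rstruct.RltP; rewrite Rstruct.RabsE => h1 /Rstruct.RltP; rewrite Rstruct.RabsE => h2.
move=> i j /ssrnat.ltP im /ssrnat.ltP jm; apply/Rstruct.RltP; rewrite (cmodE C) toCB.
have E B : toC C (ofM B i j) = B (Ordinal im) (Ordinal jm).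
  by have := ofMK B => /matrixP/(_ (Ordinal im) (Ordinal jm)); rewrite mxE.
rewrite !E cabsBC -mxBE; apply: le_lt_trans (_ : e / 2 < e); last by lra.
rewrite -ler_sqr ?nnegrE ?cabs_ge0 //; last by lra.
exact: le_trans (entry_le_fro2 _ _ _) (hd l1 l2 h1 h2).
Qed.

Lemma exists_approx eps a (c : R) : eps_ok eps m -> matching_family eps m a -> 0 < c ->
  exists b : MatFam, [/\ fam_continuous m b, fam_periodic m b, fam_unitary m b,
    forall k1 k2, opnorm_le m (msub (b k1 k2) (a k1 k2)) c &
    forall k1 k2, nondegenerate_spectrum m (b k1 k2) /\
      same_spectrum m (b k1 k2) (b (Rdefinitions.Ropp k1) (Rdefinitions.Ropp k2))].
Proof.
move=> ok [ca [pa [ua trs]]] c0.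
have uS := eps_unitary C ok; set S := toM C m (eps_mat eps m) in uS.
have uF k1 k2 : toM C m (a k1 k2) \is unitarymx by apply/unitaryE; exact: ua.
have trF k1 k2 : toM C m (a k1 k2) = S^t* *m (toM C m (a (- k1) (- k2)))^T *m S.
  have /meqE := trs k1 k2; move=> /(_ C).
  by rewrite !toM_mul toM_tr -/S -mulmxA => <-; rewrite mulmxA adj_unitaryP // mul1mx.
have [A [cA pA uA nA sA]] := exists_symmetric_approx uS uF (fam_int_periodic pa)
  (fam_unif_continuous ca pa) trF (exprn_gt0 2 c0).
exists (fun k1 k2 => ofM (A k1 k2)); split.
- exact: ofM_continuous.
- move=> k1 k2; split; apply/(meqE C); rewrite !ofMK.
    by have := pA 1 0 k1 k2; rewrite addr0.
  by have := pA 0 1 k1 k2; rewrite addr0.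
- by move=> k1 k2; apply/(unitaryE C); rewrite ofMK.
- by move=> k1 k2; apply: (@opnorm_le_fro2 C); rewrite ofMK.
move=> k1 k2; have [Q [Q' [b [[uQ uQ'] e1 e2 inj]]]] := sA k1 k2.
have E1 : toM C m (ofM (A k1 k2)) = sdec Q b by rewrite ofMK.
have E2 : toM C m (ofM (A (- k1) (- k2))) = sdec Q' b by rewrite ofMK.
split; first exact: sdec_nondegenerate uQ E1 inj.
move=> lam; rewrite (eigenvalueE _ uQ E1); symmetry; exact: eigenvalueE uQ' E2.
Qed.

End Families.

Theorem exists_approx_sequence (eps : eps_choice) (m : nat) (a : MatFam) :
  eps_ok eps m -> matching_family eps m a ->
  exists b : nat -> MatFam,
    (forall n, fam_continuous m (b n) /\ fam_periodic m (b n) /\ fam_unitary m (b n)) /\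
    (forall c, Rdefinitions.Rlt (Rdefinitions.IZR BinNums.Z0) c -> exists N : nat, forall n : nat, le N n ->
        forall k1 k2, opnorm_le m (msub (b n k1 k2) (a k1 k2)) c) /\
    (forall n k1 k2,
        nondegenerate_spectrum m (b n k1 k2) /\
        same_spectrum m (b n k1 k2) (b n (Rdefinitions.Ropp k1) (Rdefinitions.Ropp k2))).
Proof.
move=> ok ma.
have ex (n : nat) := exists_approx (complex_model Rdefinitions.R) ok ma
  (divr_gt0 ltr01 (ltr0Sn Rdefinitions.R n)).
have [b hb] := choice ex; exists b; split; [|split].
- by move=> n; have [] := hb n.
- move=> c /Rstruct.RltP c0; exists (Num.trunc c^-1) => n /ssrnat.leP le k1 k2 v.
  have [_ _ _ /(_ k1 k2 v) h _] := hb n; apply: RIneq.Rle_trans h _.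
  apply/Rstruct.RleP; rewrite !(vnorm2E (complex_model Rdefinitions.R)).
  apply: ler_wpM2r; first exact: fro2_ge0.
  have c1 : 1 / n.+1%:R <= c.
    have ci : 0 <= c^-1 by rewrite invr_ge0 ltW.
    have /andP[_ lt] := truncn_itv ci.
    by rewrite ler_pdivrMr ?ltr0n // -ler_pdivrMl // mulr1 (le_trans (ltW lt)) // ler_nat.
  have n0 : 0 <= 1 / n.+1%:R :> Rdefinitions.R by rewrite divr_ge0.
  exact: (ler_pM n0 n0 c1 c1).
- by move=> n; have [_ _ _ _] := hb n.
Qed.

End Approximation.

Open Scope R_scope.

Theorem theorem4p3 (e : eps_choice) (m : nat) (alpha : MatFam) :
  eps_ok e m ->
  matching_family e m alpha ->
  exists ahat : nat -> MatFam,
    (forall n, fam_continuous m (ahat n) /\ fam_periodic m (ahat n) /\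
               fam_unitary m (ahat n)) /\
    (forall c, 0 < c -> exists N : nat, forall n : nat, (N <= n)%nat ->
        forall k1 k2, opnorm_le m (msub (ahat n k1 k2) (alpha k1 k2)) c) /\
    (forall n k1 k2,
        nondegenerate_spectrum m (ahat n k1 k2) /\
        same_spectrum m (ahat n k1 k2) (ahat n (- k1) (- k2))).
Proof. exact (@Approximation.exists_approx_sequence e m alpha). Qed.
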